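(* Let $f\in C^1_b(\mathbb{R})\cap C^2(\mathbb{R})$ with $f'\ge0$, and let $(u,m)\in C^{2,\alpha}(\mathbb{T}^d)\times C^{2,\alpha}(\mathbb{T}^d)$ be a stable solution of the MFG system. Then there exists a neighborhood $\mathcal{O}$ of $(u,m)$ in $C^{2,\alpha}(\mathbb{T}^d)\times C^{2,\alpha}(\mathbb{T}^d)$ such that, if $(u^0,m^0)\in\mathcal{O}$, the sequence $(u^k,m^k)$ generated by Newton's method $(u^{k+1},m^{k+1}) + T\big(G(u^k,m^k)+dG[u^k,m^k](u^{k+1}-u^k,m^{k+1}-m^k)\big)=0$ converges superlinearly to $(u,m)$ in $C^{2,\alpha}(\mathbb{T}^d)\times C^{2,\alpha}(\mathbb{T}^d)$. If moreover $f\in C^{2,1}_{\mathrm{loc}}(\mathbb{R})$, the convergence is quadratic.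
   Context: $\mathbb{T}^d$ is the flat torus, $\lambda>0$, $\alpha\in(0,1)$, $m_0\in C^{0,\alpha}(\mathbb{T}^d)$ a probability density. $C^1_b(\mathbb{R})$: $C^1$ functions with $f,f'$ bounded; $C^{2,1}_{\mathrm{loc}}(\mathbb{R})$: $C^2$ functions with $f''$ Lipschitz on bounded sets. The MFG system is $-\Delta u + \tfrac12|Du|^2 + \lambda u = f(m)$, $-\Delta m - \operatorname{div}(m Du) + \lambda m = \lambda m_0$ in $\mathbb{T}^d$ (classical solution: $C^2$ pair satisfying it pointwise). A classical solution $(u,m)$ is stable if $(0,0)$ is the unique classical solution of $-\Delta v + Du\cdot Dv + \lambda v = f'(m)\rho$, $-\Delta\rho - \operatorname{div}(\rho Du) + \lambda\rho = \operatorname{div}(m Dv)$. $T$ maps $(\xi,\zeta)\in C^{0,\alpha}\times C^{0,\alpha}(\mathbb{T}^d)$ to the solution $(v,\rho)$ of $-\Delta v+\lambda v=\xi$, $-\Delta\rho+\lambda\rho=\zeta$. $G(v,\rho)=(\tfrac12|Dv|^2-f(\rho),-\operatorname{div}(\rho Dv)-\lambda m_0)$, $dG[v,\rho](w,\mu)=(Dv\cdot Dw-f'(\rho)\mu,-\operatorname{div}(\mu Dv)-\operatorname{div}(\rho Dw))$. (The Newton initial guess is denoted $(u^0,m^0)$, distinct from the datum $m_0$.) *)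

(* Defs.v *)
From HB Require Import structures.
From mathcomp Require Import all_boot all_order all_algebra.
From mathcomp Require Import all_classical all_reals all_analysis.
Set Implicit Arguments. Unset Strict Implicit. Unset Printing Implicit Defensive.
Import Order.TTheory GRing.Theory Num.Theory.
Import numFieldNormedType.Exports.
Local Open Scope classical_set_scope.
Local Open Scope ring_scope.

Section MFG.
Variable R : realType.

(* Points of R^d are row vectors 'rV[R]_d; a function on T^d is a
   Z^d-periodic function on R^d. *)
Definition evec (d : nat) (i : 'I_d) : 'rV[R]_d := delta_mx 0 i.

Definition periodic (d : nat) (g : 'rV[R]_d -> R) :=
  forall (i : 'I_d) (x : 'rV[R]_d), g (x + evec i) = g x.

Definition pd (d : nat) (i : 'I_d) (g : 'rV[R]_d -> R) : 'rV[R]_d -> R :=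
  fun x => 'D_(evec i) g x.

Definition C2 (d : nat) (g : 'rV[R]_d -> R) :=
  continuous g /\
  (forall i x, derivable g x (evec i)) /\
  (forall i, continuous (pd i g)) /\
  (forall i j x, derivable (pd i g) x (evec j)) /\
  (forall i j, continuous (pd j (pd i g))).

Definition C2per (d : nat) (g : 'rV[R]_d -> R) := C2 g /\ periodic g.

Definition bounded_fun (d : nat) (g : 'rV[R]_d -> R) :=
  exists M : R, forall x, `|g x| <= M.

Definition holder (d : nat) (a : R) (g : 'rV[R]_d -> R) :=
  exists M : R, forall x y, x != y -> `|g x - g y| <= M * (`|x - y| `^ a).

Definition C0a (d : nat) (a : R) (g : 'rV[R]_d -> R) :=
  periodic g /\ continuous g /\ bounded_fun g /\ holder a g.

Definition C2a (d : nat) (a : R) (g : 'rV[R]_d -> R) :=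
  C2per g /\ (forall i j, holder a (pd j (pd i g))).

Definition supnorm (d : nat) (g : 'rV[R]_d -> R) : R :=
  sup [set `|g x| | x in setT].

Definition holder_semi (d : nat) (a : R) (g : 'rV[R]_d -> R) : R :=
  sup [set r | exists x y, x != y /\ r = `|g x - g y| / (`|x - y| `^ a)].

Definition c2a_norm (d : nat) (a : R) (g : 'rV[R]_d -> R) : R :=
  supnorm g + \sum_(i < d) supnorm (pd i g)
  + \sum_(i < d) \sum_(j < d) supnorm (pd j (pd i g))
  + \sum_(i < d) \sum_(j < d) holder_semi a (pd j (pd i g)).

Definition c2a_dist (d : nat) (a : R) (u1 m1 u2 m2 : 'rV[R]_d -> R) : R :=
  c2a_norm a (fun x => u1 x - u2 x) + c2a_norm a (fun x => m1 x - m2 x).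

Definition lap (d : nat) (g : 'rV[R]_d -> R) : 'rV[R]_d -> R :=
  fun x => \sum_(i < d) pd i (pd i g) x.

Definition dot_grad (d : nat) (g h : 'rV[R]_d -> R) : 'rV[R]_d -> R :=
  fun x => \sum_(i < d) pd i g x * pd i h x.

Definition div_mul_grad (d : nat) (r g : 'rV[R]_d -> R) : 'rV[R]_d -> R :=
  fun x => \sum_(i < d) pd i (fun y => r y * pd i g y) x.

Fixpoint cube_int (n : nat) : ('rV[R]_n -> R) -> R :=
  match n with
  | 0 => fun g => g 0
  | n'.+1 => fun g : 'rV[R]_n'.+1 -> R =>
      Rintegral lebesgue_measure `[0%R, 1%R]
        (fun t : R => cube_int (fun y : 'rV[R]_n' => g (row_mx (const_mx t : 'rV[R]_1) y)))
  end.

Definition prob_density (d : nat) (m0 : 'rV[R]_d -> R) :=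
  (forall x, 0 <= m0 x) /\ cube_int m0 = 1.

Definition C1b_C2 (f : R -> R) :=
  (forall x, derivable f x 1) /\ continuous (derive1 f) /\
  (exists M, forall x, `|f x| <= M) /\ (exists M, forall x, `|(derive1 f) x| <= M) /\
  (forall x, derivable (derive1 f) x 1) /\ continuous (derive1n 2 f).

Definition C21loc (f : R -> R) :=
  (forall x, derivable f x 1) /\ (forall x, derivable (derive1 f) x 1) /\
  continuous (derive1n 2 f) /\
  forall M : R, exists L : R, forall x y, `|x| <= M -> `|y| <= M ->
    `|(derive1n 2 f) x - (derive1n 2 f) y| <= L * `|x - y|.

Definition MFG_solution (d : nat) (lam : R) (m0 : 'rV[R]_d -> R) (f : R -> R)
  (u m : 'rV[R]_d -> R) :=
  C2per u /\ C2per m /\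
  (forall x, - lap u x + 2^-1 * dot_grad u u x + lam * u x = f (m x)) /\
  (forall x, - lap m x - div_mul_grad m u x + lam * m x = lam * m0 x).

Definition stable (d : nat) (lam : R) (f : R -> R) (u m : 'rV[R]_d -> R) :=
  forall v rho : 'rV[R]_d -> R, C2per v -> C2per rho ->
    (forall x, - lap v x + dot_grad u v x + lam * v x = (derive1 f) (m x) * rho x) ->
    (forall x, - lap rho x - div_mul_grad rho u x + lam * rho x
                 = div_mul_grad m v x) ->
    v = (fun _ => 0) /\ rho = (fun _ => 0).

Definition Tsol (d : nat) (lam : R) (xi : 'rV[R]_d -> R) : 'rV[R]_d -> R :=
  xget (fun _ => 0)
    [set v | C2per v /\ forall x, - lap v x + lam * v x = xi x].

Definition G1 (d : nat) (f : R -> R) (v rho : 'rV[R]_d -> R) : 'rV[R]_d -> R :=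
  fun x => 2^-1 * dot_grad v v x - f (rho x).
Definition G2 (d : nat) (lam : R) (m0 v rho : 'rV[R]_d -> R) : 'rV[R]_d -> R :=
  fun x => - div_mul_grad rho v x - lam * m0 x.
Definition dG1 (d : nat) (f : R -> R) (v rho w mu : 'rV[R]_d -> R) :
  'rV[R]_d -> R :=
  fun x => dot_grad v w x - (derive1 f) (rho x) * mu x.
Definition dG2 (d : nat) (v rho w mu : 'rV[R]_d -> R) : 'rV[R]_d -> R :=
  fun x => - div_mul_grad mu v x - div_mul_grad rho w x.

Definition newton_seq (d : nat) (a lam : R) (m0 : 'rV[R]_d -> R) (f : R -> R)
  (u0 mi0 : 'rV[R]_d -> R) (U M : nat -> 'rV[R]_d -> R) :=
  U 0%N = u0 /\ M 0%N = mi0 /\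
  (forall k, C2a a (U k) /\ C2a a (M k)) /\
  forall k,
    let du := fun x => U k.+1 x - U k x in
    let dm := fun x => M k.+1 x - M k x in
    (forall x, U k.+1 x + Tsol lam (fun y => G1 f (U k) (M k) y
                                     + dG1 f (U k) (M k) du dm y) x = 0) /\
    (forall x, M k.+1 x + Tsol lam (fun y => G2 lam m0 (U k) (M k) y
                                     + dG2 (U k) (M k) du dm y) x = 0).

End MFG.

(* Main.v *)
(** The linearized system at [(u, m)] is a compact perturbation of the pair of invertible operators
[- lap + lam], so by the Fredholm alternative stability makes it boundedly invertible from
[C^{0,a} x C^{0,a}] to [C^{2,a} x C^{2,a}], and by absorption so are the linearized systems at nearby
points, with a uniform bound.  The error after one Newton step at [(U, M)], at distance [e] from
[(u, m)], solves the system linearized at [(U, M)] with right-hand side the second-order Taylor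
remainder of [G].  The bilinear terms are [O(e^2)] in [C^{0,a}].  The remainder of [f] is [O(e^2)] in
the sup norm but only [O(e)] in the Lipschitz norm when [f''] is merely continuous; interpolation then
gives [O(e^(2 - a))] in [C^{0,a}], and [O(e^2)] if [f''] is locally Lipschitz.

The Schauder estimate for [- lap + lam] comes from dyadic lattices.  The resolvent of a lattice random
walk is the Neumann series of the powers of an averaging operator; each difference of the [k]-th power
gains a factor [k^(-1/2)] by the size of the central binomial coefficient, and splitting the
right-hand side by inf-convolution into a small and a Lipschitz part turns [a]-Hoelder continuity into
the extra decay that makes the series of second differences summable, uniformly in the mesh.  The
solution is the limit of the lattice solutions along an ultrafilter. *)
Require Import Defs.
From HB Require Import structures.
From mathcomp Require Import all_boot all_order all_algebra.
From mathcomp Require Import all_classical all_reals all_analysis.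
From mathcomp Require Import ring lra zify.
Set Implicit Arguments. Unset Strict Implicit. Unset Printing Implicit Defensive.
Import Order.TTheory GRing.Theory Num.Theory.
Import numFieldNormedType.Exports.
Local Open Scope classical_set_scope.
Local Open Scope ring_scope.

(** Compactness fails for the linearized system as it stands: [- div_mul_grad rho w] contains rho
    times the Laplacian of w, of second order in the unknown, and inverting [- lap + lam] only
    recovers the two derivatives lost. Subtracting rho times the first equation from the second
    removes this term. The system then depends on the unknowns through their 1-jets, which are
    precompact in C^{0,a}, and the right-hand side changes by an invertible triangular substitution.
    The definition of [stable] supplies only injectivity at (u, m). The estimate extended to nearby
    points yields injectivity there, and the Fredholm argument is run again at each iterate, so that
    existence and uniqueness of a Newton step come from one source. Since [Tsol] is a choice among
    solutions, the maximum principle is what ties it to the solution built on lattices and makes it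
    linear. No heat kernel is available in closed form on the lattice, so all decay is obtained from
    binomial weights; an ultrafilter gives limits at all points simultaneously, and Taylor bounds
    along dyadic steps identify the limits of difference quotients as derivatives. *)

Section Basics.
Variable R : realType.
Implicit Types (a b x y : R).

Lemma le_of_eq x y : x = y -> x <= y.
Proof. by move->. Qed.

Lemma powR_ge_id a x : 0 < a < 1 -> 0 <= x <= 1 -> x <= x `^ a.
Proof.
move=> /andP[a0 a1] /andP[]; rewrite le_eqVlt => /orP[/eqP<- _|x0 x1].
  exact: powR_ge0.
by rewrite -{1}[x]powRr1 ?(ltW x0)// ger_powR ?x0// ltW.
Qed.

Lemma powR_ge_one a x : 0 < a -> 1 <= x -> 1 <= x `^ a.
Proof.
move=> a0 x1; have -> : 1 = 1 `^ a :> R by rewrite powR1.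
by rewrite ge0_ler_powR ?nnegrE// ?ltW// (lt_le_trans _ x1).
Qed.

(** Write a positive y as y^(1-a) times y^a and apply one of the two bounds to each factor. *)
Lemma powR_interpolation a x A B (y : R) : 0 < a < 1 -> 0 < A -> 0 < B -> 0 <= x ->
  y <= A -> y <= B * x -> y <= A `^ (1 - a) * B `^ a * x `^ a.
Proof.
move=> /andP[a0 a1] A0 B0 x0 yA yB.
case: (leP y 0) => [y0|y0].
  by rewrite (le_trans y0)// !mulr_ge0 ?powR_ge0.
have -> : y = y `^ (1 - a) * y `^ a.
  rewrite -powRD; last by rewrite (gt_eqF y0) implybT.
  by rewrite subrK powRr1 // ltW.
rewrite -mulrA -powRM ?(ltW B0)//.
apply: ler_pM; rewrite ?powR_ge0//.
  by rewrite ge0_ler_powR ?nnegrE ?subr_ge0 ?(ltW a1) ?(ltW y0) ?(ltW A0).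
rewrite ge0_ler_powR ?nnegrE ?(ltW a0) ?(ltW y0)//.
by rewrite mulr_ge0 ?(ltW B0).
Qed.

End Basics.

(** * Mean value estimates along lines and coordinate paths *)

Section LineMVT.
Variables (R : realType) (V : normedModType R).

Lemma is_derive_line (g : V -> R) (x v : V) (t : R) :
  derivable g (x + t *: v) v ->
  is_derive t 1 (fun s : R => g (x + s *: v)) ('D_v g (x + t *: v)).
Proof.
move=> dg.
have e : (fun h : R => h^-1 *: (((fun s : R => g (x + s *: v)) \o shift t) (h *: 1) - g (x + t *: v)))
  = (fun h : R => h^-1 *: ((g \o shift (x + t *: v)) (h *: v) - g (x + t *: v))).
  apply/funext => h /=; congr (_ *: (g _ - _)).
  by rewrite [h *: 1]mulr1 scalerDl addrCA.
apply: DeriveDef; first by rewrite /derivable e.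
by rewrite /derive e.
Qed.

Lemma line_taylor (g : V -> R) (x v : V) (s c B : R) :
  (forall y, derivable g y v) ->
  (forall t, `|t| <= `|s| -> `|'D_v g (x + t *: v) - c| <= B) ->
  `|g (x + s *: v) - g x - s * c| <= B * `|s|.
Proof.
move=> dg bg.
pose p := fun t : R => g (x + t *: v) - t * c.
have dp (t : R) : is_derive t 1 p ('D_v g (x + t *: v) - c).
  have h1 := is_derive_line (dg (x + t *: v)).
  have h2 : is_derive t 1 (fun t : R => t * c) c.
    have := @is_deriveM _ _ (@id R) (cst c) t 1 1 0 (is_derive_id _ _) (is_derive_cst _ _ _).
    by rewrite /= scaler0 add0r [_ *: 1]mulr1.
  exact: is_deriveB.
have cp A : {within A, continuous p}.
  apply: continuous_subspaceT => t.
  by apply: differentiable_continuous; apply/derivable1_diffP; case: (dp t).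
have -> : g (x + s *: v) - g x - s * c = p s - p 0.
  by rewrite /p scale0r addr0 mul0r subr0 addrAC.
case: (leP 0 s) => s0.
  have [z zs ->] := MVT_segment s0 (fun t _ => dp t) (cp _).
  rewrite subr0 normrM ler_wpM2r// bg//.
  by move: zs; rewrite in_itv/= => /andP[z0 zs]; rewrite !ger0_norm.
have [z zs e] := MVT_segment (ltW s0) (fun t _ => dp t) (cp _).
rewrite distrC e sub0r normrM normrN ler_wpM2r// bg//.
by move: zs; rewrite in_itv/= => /andP[z0 zs]; rewrite !ler0_norm ?lerN2// ltW.
Qed.

Lemma line_lipschitz (g : V -> R) (x v : V) (s B : R) :
  (forall y, derivable g y v) -> (forall y, `|'D_v g y| <= B) ->
  `|g (x + s *: v) - g x| <= B * `|s|.
Proof.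
move=> dg bg; have := @line_taylor g x v s 0 B dg.
by rewrite mulr0 subr0; apply => t _; rewrite subr0.
Qed.

End LineMVT.

Section Torus.
Variables (R : realType) (d : nat).
Implicit Types (g : 'rV[R]_d -> R) (x y r : 'rV[R]_d) (a B H : R).

(** Move from x to x + r one coordinate at a time; in this way bounds on partial derivatives alone
    yield a Lipschitz bound. *)
Lemma coord_telescope g r B :
  (forall i x, `|g (x + r 0 i *: evec R i) - g x| <= B) ->
  forall x, `|g (x + r) - g x| <= d%:R * B.
Proof.
move=> h.
suff H (s : seq 'I_d) x : `|g (x + \sum_(i <- s) r 0 i *: evec R i) - g x| <= (size s)%:R * B.
  move=> x; rewrite {1}(row_sum_delta r); have := H (index_enum 'I_d) x.
  suff -> : size (index_enum 'I_d) = d by [].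
  by rewrite [index_enum _]unlock -enumT size_enum_ord.
elim: s x => [|i s IH] x; first by rewrite big_nil addr0 subrr normr0 mul0r.
rewrite big_cons addrA -[X in `|X|](subrKA (g (x + r 0 i *: evec R i))).
by rewrite (le_trans (ler_normD _ _))// /= -natr1 mulrDl mul1r lerD.
Qed.

Lemma coord_le_norm r i : `|r 0 i| <= `|r|.
Proof.
rewrite [leRHS]mx_normrE.
by rewrite (le_trans _ (le_bigmax _ _ (0, i)))//=.
Qed.

Lemma norm_le_coord r B : 0 <= B -> (forall i, `|r 0 i| <= B) -> `|r| <= B.
Proof.
move=> B0 h; rewrite [leLHS]mx_normrE; apply/bigmax_leP; split => //.
by move=> [j i] _; rewrite ord1 h.
Qed.

Lemma norm_scale_evec (i : 'I_d) (s : R) : `|s *: evec R i| = `|s|.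
Proof.
rewrite normrZ; suff -> : `|evec R i| = 1 by rewrite mulr1.
apply/eqP; rewrite eq_le; apply/andP; split.
  by apply: norm_le_coord => // j; rewrite mxE eqxx/=; case: (j == i); rewrite ?normr1 ?normr0.
by have := coord_le_norm (evec R i) i; rewrite mxE !eqxx normr1.
Qed.

Lemma gradient_lipschitz g B : 0 <= B ->
  (forall i x, derivable g x (evec R i)) -> (forall i x, `|pd i g x| <= B) ->
  forall x y, `|g x - g y| <= d%:R * B * `|x - y|.
Proof.
move=> B0 dg bg x y; rewrite -{1}(subrKC y x) -mulrA.
apply: (@coord_telescope g) => i z.
rewrite (le_trans (line_lipschitz _ _ (dg i) (bg i)))//.
by rewrite ler_wpM2l// coord_le_norm.
Qed.

End Torus.

(** * Sums of powers and central binomial coefficients *)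

Section PowerSums.
Variable R : realType.
Implicit Types (a b c x y : R).

(** The right-hand expression is the tangent at 1 of a convex power; it follows from exp t >= 1 + t
    and ln y <= y - 1. Both discrete derivatives below rest on it. *)
Lemma powRN_ge_affine c y : 0 <= c -> 0 < y -> 1 + c * (1 - y) <= y `^ (- c).
Proof.
move=> c0 y0; rewrite /powR gt_eqF//.
apply: le_trans (expR_ge1Dx _); rewrite lerD2l mulNr -mulrN ler_wpM2l//.
have := @le_ln1Dx R (y - 1); rewrite subrKC ltrBrDl subrr => /(_ y0); lra.
Qed.

(** Discrete derivative of n^b, to be telescoped in [sum_powR_le]. With y = n/(n+1) and q = b/(n+1)
    the affine bound gives 1 - y^b >= q/(1+q), and q <= 1 costs the factor 1/2. *)
Lemma powR_succ_sub_ge b (n : nat) : 0 < b <= 1 ->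
  b / 2 * n.+1%:R `^ (b - 1) <= n.+1%:R `^ b - n%:R `^ b.
Proof.
move=> /andP[b0 b1]; set N : R := n.+1%:R; have N0 : 0 < N by rewrite ltr0n.
have e : N `^ b = N * N `^ (b - 1) by rewrite mulr_powRB1 ?ltW.
have p0 := powR_gt0 (b - 1) N0; have qb0 := powR_gt0 b N0.
case: n @N N0 e p0 qb0 => [|n] N N0 e p0 qb0.
  rewrite powR0 ?gt_eqF// subr0 e ler_wpM2r ?(ltW p0)// /N.
  by rewrite ler_pdivrMr//; lra.
set M : R := n.+1%:R; have M0 : 0 < M by rewrite ltr0n.
have NM : N = M + 1 by rewrite /N /M -[LHS]natr1.
pose y := M / N; have y0 : 0 < y by rewrite divr_gt0.
have My : M `^ b = N `^ b * y `^ b.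
  by rewrite -powRM ?ltW// /y mulrCA mulfV ?gt_eqF// mulr1.
have yle : y `^ b <= (1 + b * (1 - y))^-1.
  rewrite -[y `^ b]invrK -powRN lef_pV2 ?posrE ?powR_gt0//; last first.
    rewrite ltr_wpDr// mulr_ge0 ?(ltW b0)// subr_ge0 /y ler_pdivrMr// mul1r NM; lra.
  exact: powRN_ge_affine (ltW b0) y0.
have u : 1 - y = N^-1.
  by rewrite -[X in X - _](@divff _ N) ?gt_eqF// -mulrBl NM addrAC subrr add0r mul1r.
have N1 : N^-1 <= 1 by rewrite invf_le1// ler1n.
have Ni : 0 < N^-1 by rewrite invr_gt0.
rewrite My -{1}[N `^ b]mulr1 -mulrBr e -[leRHS]mulrA [leRHS]mulrCA [leLHS]mulrC ler_pM2l//.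
have k : b / 2 * N^-1 <= 1 - y `^ b.
  rewrite lerBrDl addrC -lerBrDl (le_trans yle)// u.
  have q0 : 0 < b * N^-1 by rewrite mulr_gt0.
  have q1 : b * N^-1 <= 1 by rewrite mulr_ile1 // ltW.
  rewrite mulrAC; set q := b * N^-1 in q0 q1 *.
  rewrite -[X in X <= _]mul1r ler_pdivrMr; nra.
by rewrite -(ler_pM2l Ni) [X in _ <= X]mulrA mulVf ?gt_eqF// mul1r mulrC.
Qed.

Lemma sum_powR_le b (n : nat) : 0 < b <= 1 ->
  \sum_(1 <= k < n.+1) k%:R `^ (b - 1) <= 2 / b * n%:R `^ b.
Proof.
move=> hb; have /andP[b0 b1] := hb.
elim: n => [|n IH]; first by rewrite big_geq// mulr_ge0 ?powR_ge0// divr_ge0// ltW.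
rewrite big_nat_recr//= -lerBrDr (le_trans IH)// lerBrDr addrC -lerBrDr -mulrBr.
have h := powR_succ_sub_ge n hb.
rewrite -(ler_pM2l (_ : 0 < 2 / b)) ?divr_gt0// in h; apply: le_trans h.
by rewrite mulrA (_ : 2 / b * (b / 2) = 1) ?mul1r//; field; rewrite gt_eqF.
Qed.

Lemma powR_pred_sub_ge c (n : nat) : 0 < c ->
  c * n.+2%:R `^ (- c - 1) <= n.+1%:R `^ (- c) - n.+2%:R `^ (- c).
Proof.
move=> c0; set N : R := n.+2%:R; set M : R := n.+1%:R.
have N0 : 0 < N by rewrite ltr0n.
have M0 : 0 < M by rewrite ltr0n.
have NM : N = M + 1 by rewrite /N /M -[LHS]natr1.
pose y := M / N; have y0 : 0 < y by rewrite divr_gt0.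
have u : 1 - y = N^-1.
  by rewrite -[X in X - _](@divff _ N) ?gt_eqF// -mulrBl NM addrAC subrr add0r mul1r.
have My : M `^ (- c) = N `^ (- c) * y `^ (- c).
  by rewrite -powRM ?ltW// /y mulrCA mulfV ?gt_eqF// mulr1.
rewrite My -{2}[N `^ (- c)]mulr1 -mulrBr.
have -> : N `^ (- c - 1) = N `^ (- c) * N^-1.
  by rewrite powRD ?powR_inv1 ?(ltW N0)// (gt_eqF N0) implybT.
rewrite mulrCA ler_wpM2l ?powR_ge0// lerBrDl -u; exact: powRN_ge_affine (ltW c0) y0.
Qed.

Lemma sum_powRN_le c (n m : nat) : 0 < c ->
  \sum_(n.+2 <= k < m) k%:R `^ (- c - 1) <= n.+1%:R `^ (- c) / c.
Proof.
move=> c0.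
suff h p : \sum_(n.+2 <= k < n.+2 + p) k%:R `^ (- c - 1)
    <= (n.+1%:R `^ (- c) - (n.+1 + p)%:R `^ (- c)) / c.
  case: (leqP m n.+2) => [mn|mn]; first by rewrite big_geq// divr_ge0 ?powR_ge0// ltW.
  rewrite -(subnKC (ltnW mn)) (le_trans (h _))// ler_pM2r ?invr_gt0//.
  by rewrite lerBlDr lerDl powR_ge0.
elim: p => [|p IH]; first by rewrite !addn0 big_geq// subrr mul0r.
rewrite addnS big_nat_recr; last exact: leq_addr.
apply: (le_trans (lerD IH (lexx _))).
have := powR_pred_sub_ge (n + p) c0; rewrite addSn addnS addSn.
move=> h; rewrite -(ler_pM2r c0) mulrDl !divfK ?gt_eqF//; lra.
Qed.

End PowerSums.

Section CentralBinomial.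
Variable R : realType.

Lemma leq_bin_central m j : (j < m)%N -> ('C(m.*2, j) <= 'C(m.*2, j.+1))%N.
Proof.
move=> jm; have := mul_bin_left m.*2 j => e.
rewrite -(@leq_pmul2l j.+1)// e leq_mul2r; apply/orP; right.
by rewrite -addnn ltn_subRL -addnS leq_add// ltnW.
Qed.

(** An even row of binomial coefficients rises to its middle and falls afterwards, so its total
    variation telescopes on each half to the middle value. The row is extended by 0 at both ends: by
    the match at [j = 0], and by the vanishing coefficient at the last index. *)
Lemma sum_abs_diff_bin m :
  \sum_(0 <= j < m.*2.+2) `|(if j is j'.+1 then 'C(m.*2, j')%:R else 0) - 'C(m.*2, j)%:R : R|
    = 2 * 'C(m.*2, m)%:R.
Proof.
pose b (j : nat) : R := 'C(m.*2, j)%:R.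
pose b' (j : nat) : R := if j is j'.+1 then b j' else 0.
rewrite -[LHS]/(\sum_(0 <= j < m.*2.+2) `|b' j - b j|).
rewrite (big_cat_nat (n:=m.+1)) ?ltnS ?leq_double//=; last by rewrite -addnn; lia.
have h1 n : (n <= m.+1)%N -> \sum_(0 <= j < n) `|b' j - b j| = b' n.
  elim: n => [|n IH] nm; first by rewrite big_nil.
  rewrite big_nat_recr//= IH ?(ltnW nm)//.
  have le : b' n <= b n.
    case: n nm {IH} => [|n] nm /=; first by rewrite /b ler0n.
    by rewrite ler_nat leq_bin_central.
  by rewrite ler0_norm ?subr_le0//; lra.
have h2 n : (m.+1 <= n)%N -> \sum_(m.+1 <= j < n) `|b' j - b j| = b m - b' n.
  move=> mn; pose f k := - b' k.
  rewrite (_ : b m - b' n = f n - f m.+1); last by rewrite /f /= opprK addrC.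
  rewrite -(telescope_sumr _ mn); apply: eq_big_nat => -[//|j] /andP[mj _].
  have le : b j.+1 <= b j.
    rewrite ler_nat; case: (leqP j.+1 m.*2) => jm2; last by rewrite bin_small.
    have km : (m.*2 - j.+1 < m)%N by clear -mj jm2; rewrite -addnn in jm2 *; lia.
    have := leq_bin_central km; rewrite (bin_sub jm2) subnSK// bin_sub//.
    exact: ltnW.
  by rewrite /f /= ger0_norm ?subr_ge0// opprK addrC.
rewrite h1// h2; last by rewrite ltnS -addnn leqW// leq_addr.
have -> : b' m.*2.+2 = 0 by rewrite /b' /b bin_small.
by rewrite subr0 /b' mulr_natl mulr2n.
Qed.

(** The factor 2m + 1 makes the induction close: with x = 2m the ratio of consecutive terms is
    (x+1)(x+3)/(x+2)^2, which is below 1. *)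
Lemma central_bin_sq m : ('C(m.*2, m)%:R / 4 ^+ m) ^+ 2 * (m.*2.+1)%:R <= 1 :> R.
Proof.
elim: m => [|m IH]; first by rewrite bin0 expr0 divr1 expr1n mul1r.
have e : (m.+1)%:R * 'C(m.+1.*2, m.+1)%:R = 2 * (m.*2.+1)%:R * 'C(m.*2, m)%:R :> R.
  rewrite -!natrM; congr (_%:R).
  have h1 := mul_bin_diag m.*2.+1 m.
  have h2 := mul_bin_left m.*2.+1 m.
  have h3 := mul_bin_diag m.*2 m.
  have h4 : ('C(m.+1.*2, m.+1) = 2 * 'C(m.*2.+1, m))%N.
    rewrite doubleS binS -[in X in (X + _)%N]bin_sub; last by rewrite -addnn; lia.
    have -> : (m.*2.+1 - m.+1 = m)%N by rewrite -addnn; lia.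
    by rewrite mul2n addnn.
  have h5 : (m.+1 * 'C(m.*2.+1, m) = m.*2.+1 * 'C(m.*2, m))%N.
    by rewrite /= in h1; rewrite h1 h2 -addnn subSn ?leq_addr// addnK.
  by rewrite h4 mulnCA h5 mulnA.
set c : R := 'C(m.*2, m)%:R / 4 ^+ m in IH.
set c' : R := 'C(m.+1.*2, m.+1)%:R / 4 ^+ m.+1.
have ec : (m.*2.+2)%:R * c' = (m.*2.+1)%:R * c.
  have -> : (m.*2.+2)%:R = 2 * m.+1%:R :> R by rewrite -natrM mul2n doubleS.
  rewrite /c' mulrA -[2 * _ * _]mulrA e exprS invfM /c.
  by field; rewrite expf_neq0.
pose x : R := m.*2%:R; have x0 : 0 <= x by rewrite ler0n.
have e1 : (m.*2.+1)%:R = x + 1 by rewrite -[LHS]natr1.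
have e2 : (m.*2.+2)%:R = x + 2 by rewrite -[LHS]natr1 e1 -addrA.
have e3 : (m.+1.*2.+1)%:R = x + 3 by rewrite doubleS -[LHS]natr1 e2; lra.
rewrite e3; rewrite e1 in IH ec; rewrite e2 in ec.
have c0 : 0 <= c by rewrite divr_ge0// exprn_ge0.
rewrite -(@ler_pM2l _ ((x + 2) ^+ 2)); last by rewrite exprn_gt0; lra.
rewrite mulrA -exprMn ec mulr1 exprMn.
have : (x + 1) * (x + 3) * (c ^+ 2 * (x + 1)) <= (x + 2) ^+ 2 * 1.
  apply: ler_pM => //; [by apply: mulr_ge0; lra|by rewrite mulr_ge0 ?sqr_ge0//; lra|].
    by rewrite (_ : (x + 2) ^+ 2 = (x + 1) * (x + 3) + 1) ?lerDl//; ring.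
by rewrite mulr1; apply: le_trans; apply: le_of_eq; ring.
Qed.

Lemma central_bin_le m : (0 < m)%N -> 'C(m.*2, m)%:R / 4 ^+ m <= (Num.sqrt m%:R)^-1 :> R.
Proof.
move=> m0; have M0 : 0 < m%:R :> R by rewrite ltr0n.
have s0 : 0 < Num.sqrt m%:R :> R by rewrite sqrtr_gt0.
rewrite -[X in _ <= X]mul1r ler_pdivlMr//.
rewrite -(@ler_pXn2r _ 2) ?nnegrE ?ler01 ?mulr_ge0 ?divr_ge0 ?exprn_ge0 ?(ltW s0)//.
rewrite expr1n exprMn sqr_sqrtr ?(ltW M0)//; apply: le_trans (central_bin_sq m).
by rewrite ler_wpM2l ?sqr_ge0// ler_nat -addnn; lia.
Qed.

End CentralBinomial.

(** * Lattice averages *)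

Section Convolution.
Variables (R : realType) (V : lmodType R).
Local Notation F := (V -> R).
Implicit Types (g : F) (A B : F -> F) (z w x : V) (M : R).

(** The algebra generated by translations, that is, convolutions with finitely supported weights.
    Its members are linear, and they commute because translations do; both facts follow by induction
    on this description. *)
Inductive shiftop : (F -> F) -> Prop :=
| shiftop_id : shiftop id
| shiftop_shift z : shiftop (fun g x => g (x + z))
| shiftop_comp A B : shiftop A -> shiftop B -> shiftop (fun g => A (B g))
| shiftop_add A B : shiftop A -> shiftop B -> shiftop (fun g x => A g x + B g x)
| shiftop_scale c A : shiftop A -> shiftop (fun g x => c * A g x).

Lemma shiftop_linear A c g g' : shiftop A ->
  A (fun x => c * g x + g' x) = (fun x => c * A g x + A g' x).
Proof.
move=> cA; elim: cA c g g' => // {A}.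
- by move=> A B cA IA cB IB c g g'; rewrite IB IA.
- by move=> A B cA IA cB IB c g g'; rewrite IB IA; apply/funext => x; ring.
- by move=> k A cA IA c g g'; rewrite IA; apply/funext => x; ring.
Qed.

Lemma shiftop0 A : shiftop A -> A (fun=> 0) = (fun=> 0).
Proof.
move=> cA; have := shiftop_linear (-1) (fun=> 0) (fun=> 0) cA.
under eq_fun do rewrite mulr0 addr0.
by move=> ->; apply/funext => x; rewrite mulN1r addNr.
Qed.

Lemma shiftopZ A c g : shiftop A -> A (fun x => c * g x) = (fun x => c * A g x).
Proof.
move=> cA; have := shiftop_linear c g (fun=> 0) cA; rewrite shiftop0//.
under eq_fun do rewrite addr0.
by under [in RHS]eq_fun do rewrite addr0.
Qed.

Lemma shiftopD A g g' : shiftop A -> A (fun x => g x + g' x) = (fun x => A g x + A g' x).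
Proof.
move=> cA; have := shiftop_linear 1 g g' cA.
under eq_fun do rewrite mul1r.
by under [in RHS]eq_fun do rewrite mul1r.
Qed.

Lemma shiftopB A g g' : shiftop A -> A (fun x => g x - g' x) = (fun x => A g x - A g' x).
Proof.
move=> cA; have -> : (fun x => g x - g' x) = (fun x => (-1) * g' x + g x).
  by apply/funext => x; ring.
by rewrite shiftop_linear//; apply/funext => x; ring.
Qed.

Lemma shiftop_sum A (n : nat) (c : nat -> R) (G : nat -> F) : shiftop A ->
  A (fun x => \sum_(k < n) c k * G k x) = (fun x => \sum_(k < n) c k * A (G k) x).
Proof.
move=> cA; elim: n => [|n IH].
  under eq_fun do rewrite big_ord0.
  by rewrite shiftop0//; apply/funext => x; rewrite big_ord0.
under eq_fun do rewrite big_ord_recr /= addrC.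
by rewrite shiftop_linear// IH; apply/funext => x; rewrite big_ord_recr /= addrC.
Qed.

Lemma shiftop_shiftC A z g : shiftop A -> A (fun x => g (x + z)) = (fun x => A g (x + z)).
Proof.
move=> cA; elim: cA z g => // {A}.
- by move=> w z g; apply/funext => x; rewrite addrAC.
- by move=> A B cA IA cB IB z g; rewrite IB IA.
- by move=> A B cA IA cB IB z g; rewrite IB IA.
- by move=> k A cA IA z g; rewrite IA.
Qed.

Lemma shiftopC A B g : shiftop A -> shiftop B -> A (B g) = B (A g).
Proof.
move=> cA cB; elim: cA g => // {A}.
- by move=> z g; rewrite (shiftop_shiftC z g cB).
- by move=> A B' cA IA cB' IB g; rewrite IB IA.
- by move=> A B' cA IA cB' IB g; rewrite IA IB -shiftopD.
- by move=> k A cA IA g; rewrite IA -shiftopZ.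
Qed.

Lemma shiftop_iter A k : shiftop A -> shiftop (iter k A).
Proof.
move=> cA; elim: k => [|k IH]; first exact: shiftop_id.
exact: (shiftop_comp cA IH).
Qed.

(** Contraction in the sup norm, phrased through bounds [M] so that no supremum has to be known
    finite. *)
Definition nonexp A := forall M g, (forall x, `|g x| <= M) -> forall x, `|A g x| <= M.

Lemma nonexp_comp A B : nonexp A -> nonexp B -> nonexp (fun g => A (B g)).
Proof. by move=> nA nB M g gM; apply: nA; apply: nB. Qed.

Lemma nonexp_iter A k : nonexp A -> nonexp (iter k A).
Proof.
move=> nA; elim: k => [|k IH] //; exact: (nonexp_comp nA IH).
Qed.

Definition fdiff z g : F := fun x => g (x + z) - g x.

Lemma shiftop_fdiff z : shiftop (fdiff z).
Proof.
have -> : fdiff z = (fun g x => g (x + z) + (-1) * id g x).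
  by apply/funext => g; apply/funext => x; rewrite mulN1r.
exact: (shiftop_add (shiftop_shift z) (shiftop_scale _ shiftop_id)).
Qed.

Lemma fdiff_le z g M : (forall x, `|g x| <= M) -> forall x, `|fdiff z g x| <= 2 * M.
Proof.
by move=> gM x; rewrite (le_trans (ler_normB _ _))// mulr_natl mulr2n lerD.
Qed.

Definition avg z g : F := fun x => 2^-1 * (g x + g (x + z)).

Lemma shiftop_avg z : shiftop (avg z).
Proof. exact: (shiftop_scale _ (shiftop_add shiftop_id (shiftop_shift z))). Qed.

Lemma nonexp_avg z : nonexp (avg z).
Proof.
move=> M g gM x; rewrite normrM ger0_norm// mulrC ler_pdivrMr//.
by rewrite (le_trans (ler_normD _ _))// mulr_natr mulr2n lerD.
Qed.

Lemma iter_avgE N z g x :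
  iter N (avg z) g x = 2^-1 ^+ N * \sum_(0 <= j < N.+1) 'C(N, j)%:R * g (x + z *+ j).
Proof.
elim: N x => [|N IH] x.
  by rewrite big_nat1 bin0 expr0 !mul1r addr0.
rewrite iterS /avg !IH -mulrDr mulrA -exprS; congr (_ * _).
rewrite [in RHS]big_nat_recl//= bin0 mul1r mulr0n addr0.
have -> : \sum_(0 <= j < N.+1) 'C(N, j)%:R * g (x + z *+ j)
    = g x + \sum_(0 <= j < N.+1) 'C(N, j.+1)%:R * g (x + z *+ j.+1).
  rewrite -[LHS]addr0 -[X in _ + X](_ : 'C(N, N.+1)%:R * g (x + z *+ N.+1) = 0); last first.
    by rewrite bin_small// mul0r.
  by rewrite -big_nat_recr//= big_nat_recl//= bin0 mul1r addr0.
rewrite -addrA; congr (_ + _); rewrite -big_split/=; apply: eq_bigr => j _.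
by rewrite binS natrD mulrDl -addrA -mulrS.
Qed.

(** Summation by parts moves the difference onto the binomial weights. What appears is the total
    variation of the row, 2 C(2m, m) / 4^m after normalization. *)
Lemma iter_avg_smooth m z g M : (0 < m)%N -> (forall x, `|g x| <= M) ->
  forall x, `|fdiff z (iter m.*2 (avg z) g) x| <= 2 / Num.sqrt m%:R * M.
Proof.
move=> m0 gM x; rewrite /fdiff !iter_avgE -mulrBr.
set N := m.*2; pose b' (j : nat) : R := if j is j'.+1 then 'C(N, j')%:R else 0.
have -> : \sum_(0 <= j < N.+1) 'C(N, j)%:R * g (x + z + z *+ j)
   - \sum_(0 <= j < N.+1) 'C(N, j)%:R * g (x + z *+ j)
   = \sum_(0 <= j < N.+2) (b' j - 'C(N, j)%:R) * g (x + z *+ j).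
  under [RHS]eq_bigr do rewrite mulrBl.
  rewrite [RHS]sumrB; congr (_ - _).
    rewrite [RHS]big_nat_recl//= mul0r add0r; apply: eq_bigr => j _.
    by rewrite -addrA -mulrS.
  by rewrite [RHS]big_nat_recr//= bin_small// mul0r addr0.
have M0 : 0 <= M by rewrite (le_trans _ (gM 0)).
rewrite normrM ger0_norm ?exprn_ge0// (le_trans (_ : _ <= 2^-1 ^+ N * (2 * 'C(N, m)%:R * M)))//.
  rewrite ler_wpM2l ?exprn_ge0// (le_trans (ler_norm_sum _ _ _))//.
  rewrite -sum_abs_diff_bin mulr_suml; apply: ler_sum => j _.
  by rewrite normrM ler_wpM2l.
rewrite -/N -!mulrA mulrCA ler_wpM2l// mulrA ler_wpM2r//.
have -> : 2^-1 ^+ N = (4 ^+ m)^-1 :> R.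
  by rewrite /N -mul2n exprM !exprVn (_ : 2 ^+ 2 = 4)//; ring.
by rewrite mulrC central_bin_le.
Qed.

(** The symmetric average with weights 1/4, 1/2, 1/4. It is the square of [avg z] translated back by
    [z], so its powers are even binomial averages, and [bavg z] minus the identity is a quarter of
    the central second difference. *)
Definition bavg z g : F := avg z (avg (- z) g).

Lemma shiftop_bavg z : shiftop (bavg z).
Proof. exact: shiftop_comp (shiftop_avg z) (shiftop_avg (- z)). Qed.

Lemma nonexp_bavg z : nonexp (bavg z).
Proof. exact: nonexp_comp (nonexp_avg z) (nonexp_avg (- z)). Qed.

Lemma bavgE z g x : bavg z g x = avg z (avg z g) (x - z).
Proof.
by rewrite /bavg /avg !addrK [x - z + z]subrK; ring.
Qed.

Lemma iter_bavg k z g x : iter k (bavg z) g x = iter k.*2 (avg z) g (x - z *+ k).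
Proof.
elim: k x => [|k IH] x; first by rewrite subr0.
rewrite iterS bavgE doubleS !iterS.
have -> : iter k (bavg z) g = fun y => iter k.*2 (avg z) g (y + - (z *+ k)).
  by apply/funext => y; rewrite IH.
by rewrite !(shiftop_shiftC _ _ (shiftop_avg z)) mulrS opprD addrA.
Qed.

Lemma bavg_smooth k z g M : (0 < k)%N -> (forall x, `|g x| <= M) ->
  forall x, `|fdiff z (iter k (bavg z) g) x| <= 2 / Num.sqrt k%:R * M.
Proof.
move=> k0 gM x; rewrite /fdiff !iter_bavg addrAC.
exact: (iter_avg_smooth z k0 gM (x - z *+ k)).
Qed.

Definition bavgs (s : seq V) g : F := foldr bavg g s.

Lemma shiftop_bavgs s : shiftop (bavgs s).
Proof.
elim: s => [|z s IH]; first exact: shiftop_id.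
exact: shiftop_comp (shiftop_bavg z) IH.
Qed.

Lemma nonexp_bavgs s : nonexp (bavgs s).
Proof.
elim: s => [|z s IH] //; exact: nonexp_comp (nonexp_bavg z) IH.
Qed.

(** By commutation any direction of the list can be made the outer factor; the other factors do not
    expand the sup norm, so the smoothing along [z] survives them. *)
Lemma bavgs_factor s z : z \in s ->
  exists A, [/\ shiftop A, nonexp A & forall g, bavgs s g = bavg z (A g)].
Proof.
elim: s => [//|y s IH]; rewrite inE => /orP[/eqP->|/IH[A [cA nA eA]]].
  by exists (bavgs s); split; [exact: shiftop_bavgs|exact: nonexp_bavgs|].
exists (fun g => bavg y (A g)); split.
- exact: shiftop_comp (shiftop_bavg y) cA.
- exact: nonexp_comp (nonexp_bavg y) nA.
- by move=> g; rewrite /= eA (shiftopC _ (shiftop_bavg y) (shiftop_bavg z)).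
Qed.

Lemma iter_factor (A B : F -> F) k g : shiftop A -> shiftop B ->
  iter k (fun g => A (B g)) g = iter k A (iter k B g).
Proof.
move=> cA cB; elim: k => [//|k IH]; rewrite !iterS IH.
by rewrite (shiftopC _ cB (shiftop_iter k cA)).
Qed.

Lemma bavgs_smooth s z k g M : z \in s -> (0 < k)%N -> (forall x, `|g x| <= M) ->
  forall x, `|fdiff z (iter k (bavgs s) g) x| <= 2 / Num.sqrt k%:R * M.
Proof.
move=> zs k0 gM x; have [A [cA nA eA]] := bavgs_factor zs.
have -> : bavgs s = (fun g => bavg z (A g)) by apply/funext.
rewrite iter_factor//; last exact: shiftop_bavg.
by apply: bavg_smooth => //; apply: nonexp_iter.
Qed.

End Convolution.

(** * Splitting a Hoelder function into a small and a Lipschitz part *)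

Section InfConvolution.
Variables (R : realType) (V : normedModType R).

(** [eta] is the inf-convolution of [xi] with a cone of slope L = H t^(a-1). At distances above t
    the cone exceeds the Hoelder modulus; at distances below t the modulus is at most H t^a. Hence
    [eta] lies below [xi] by at most H t^a. *)
Lemma lipschitz_split (xi : V -> R) (a H t : R) : 0 < a < 1 -> 0 <= H -> 0 < t ->
  (forall x y, `|xi x - xi y| <= H * `|x - y| `^ a) ->
  exists b eta : V -> R, [/\ xi = (fun x => b x + eta x),
    forall x, `|b x| <= H * t `^ a &
    forall x y, `|eta x - eta y| <= H * t `^ (a - 1) * `|x - y|].
Proof.
move=> /andP[a0 a1] H0 t0 hxi; pose L := H * t `^ (a - 1).
have L0 : 0 <= L by rewrite mulr_ge0 ?powR_ge0.
pose E x := [set xi y + L * `|x - y| | y in setT].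
have lb x y : xi x - H * t `^ a <= xi y + L * `|x - y|.
  rewrite lerBlDr; have := hxi x y; rewrite ler_norml => /andP[_].
  rewrite lerBlDl => h; rewrite (le_trans h)// -addrA lerD2l.
  have n0 := normr_ge0 (x - y).
  case: (leP t `|x - y|) => tx.
    rewrite (@le_trans _ _ (L * `|x - y|))//; last by rewrite lerDl mulr_ge0 ?powR_ge0.
    rewrite /L -mulrA ler_wpM2l//.
    have p0 := lt_le_trans t0 tx.
    rewrite -[X in X <= _]mulr_powRB1// mulrC ler_wpM2r//.
    rewrite -[a - 1]opprB !powRN lef_pV2 ?posrE ?powR_gt0//.
    by rewrite ge0_ler_powR ?nnegrE ?subr_ge0 // ltW.
  rewrite (@le_trans _ _ (H * t `^ a))//; last by rewrite lerDr mulr_ge0.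
  by rewrite ler_wpM2l// ge0_ler_powR ?nnegrE// ltW.
have E0 x : E x !=set0 by exists (xi x + L * `|x - x|); exists x.
have hlb x : has_lbound (E x).
  by exists (xi x - H * t `^ a) => _ [y _ <-]; exact: lb.
pose eta x := inf (E x).
have eta_le x y : eta x <= xi y + L * `|x - y|.
  by apply: ge_inf => //; exists y.
have etaL x y : eta x <= eta y + L * `|x - y|.
  rewrite -lerBlDr; apply: lb_le_inf => // _ [z _ <-].
  rewrite lerBlDr (le_trans (eta_le x z))// -addrA lerD2l -mulrDr ler_wpM2l//.
  by rewrite [leRHS]addrC ler_distD.
exists (fun x => xi x - eta x), eta; split.
- by apply/funext => x; rewrite subrK.
- move=> x; rewrite ger0_norm; last first.
    by rewrite subr_ge0; have := eta_le x x; rewrite subrr normr0 mulr0 addr0.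
  rewrite lerBlDr addrC -lerBlDr; apply: lb_le_inf => // _ [z _ <-].
  exact: lb.
- move=> x y; rewrite ler_norml lerBlDl etaL andbT lerNl opprB lerBlDl.
  by rewrite distrC etaL.
Qed.

End InfConvolution.

(** * Schauder estimates for the discrete resolvent *)

Section DiscreteResolvent.
Variables (R : realType) (V : normedModType R).
Variables (s : seq V) (h lam a : R).
Hypotheses (h0 : 0 < h) (lam0 : 0 < lam) (a01 : 0 < a < 1).
Hypothesis sh : forall z, z \in s -> `|z| <= h.
Implicit Types (g xi : V -> R) (x z w y r : V) (H M E : R).

Let a0 : 0 < a. Proof. by case/andP: a01. Qed.
Let a1 : a < 1. Proof. by case/andP: a01. Qed.

(* The cube of the lattice average leaves one smoothing factor for each of the three differences. *)
Definition heat_step g : V -> R := bavgs s (bavgs s (bavgs s g)).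

Lemma shiftop_heat_step : shiftop heat_step.
Proof. exact: shiftop_comp (shiftop_bavgs s) (shiftop_comp (shiftop_bavgs s) (shiftop_bavgs s)). Qed.

Lemma nonexp_heat_step : nonexp heat_step.
Proof.
exact: nonexp_comp (@nonexp_bavgs _ _ s) (nonexp_comp (@nonexp_bavgs _ _ s) (@nonexp_bavgs _ _ s)).
Qed.

Lemma iter_heat_step k g :
  iter k heat_step g = iter k (bavgs s) (iter k (bavgs s) (iter k (bavgs s) g)).
Proof.
have cB := shiftop_bavgs s.
by rewrite (iter_factor k g cB (shiftop_comp cB cB)) (iter_factor k g cB cB).
Qed.

Lemma fdiff_heat1 xi H z k : 0 <= H -> (0 < k)%N -> z \in s ->
  (forall x y, `|xi x - xi y| <= H * `|x - y| `^ a) ->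
  forall x, `|fdiff z (iter k (bavgs s) xi) x| <= 3 * (H * h `^ a * k%:R `^ ((a - 1) / 2)).
Proof.
(* The scale sqrt k * h is the distance covered by the walk in k steps. At this scale the small
   part, which gains 2 / sqrt k, and the Lipschitz part, which gains h, have the same size. *)
move=> H0 k0 zs hxi x; pose t := Num.sqrt k%:R * h.
have K0 : 0 < k%:R :> R by rewrite ltr0n.
have sk0 : 0 < Num.sqrt k%:R :> R by rewrite sqrtr_gt0.
have t0 : 0 < t by rewrite mulr_gt0.
have [b [eta [-> bM etaL]]] := lipschitz_split a01 H0 t0 hxi.
have cB := shiftop_iter k (shiftop_bavgs s).
have tE : t `^ (a - 1) * h = h `^ a * k%:R `^ ((a - 1) / 2).
  rewrite powRM ?ltW// -powR12_sqrt ?ltW// -powRrM mulrAC [2^-1 * _]mulrC mulrC.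
  rewrite -[LHS]mulrA (mulr_powRB1 (ltW h0) a0).
  exact: mulrC.
rewrite -[H * _ * _]mulrA -tE shiftopD// (shiftopD _ _ (shiftop_fdiff z)).
rewrite (le_trans (ler_normD _ _))// [3]( _ : _ = 2 + 1); last by ring.
rewrite mulrDl mul1r; apply: lerD.
  rewrite (le_trans (bavgs_smooth zs k0 bM x))//; apply: le_of_eq.
  rewrite -[in LHS](mulr_powRB1 (ltW t0) a0) {1}/t; field; exact: lt0r_neq0.
rewrite (shiftopC _ (shiftop_fdiff z) cB); apply: nonexp_iter => [|y].
  exact: nonexp_bavgs.
rewrite (le_trans (etaL _ _))// -mulrA ler_wpM2l// ler_wpM2l ?powR_ge0//.
by rewrite addrAC subrr add0r sh.
Qed.

Let powR_half k (c : R) : (0 < k)%N ->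
  (Num.sqrt k%:R)^-1 * k%:R `^ c = k%:R `^ (c - 2^-1) :> R.
Proof.
move=> k0; have K0 : 0 < k%:R :> R by rewrite ltr0n.
by rewrite powRB ?(gt_eqF K0) ?implybT// powR12_sqrt ?ltW// mulrC.
Qed.

Lemma fdiff_heat2 xi H z w k : 0 <= H -> (0 < k)%N -> z \in s -> w \in s ->
  (forall x y, `|xi x - xi y| <= H * `|x - y| `^ a) ->
  forall x, `|fdiff w (fdiff z (iter k (bavgs s) (iter k (bavgs s) xi))) x|
     <= 6 * (H * h `^ a * k%:R `^ (a / 2 - 1)).
Proof.
move=> H0 k0 zs ws hxi x.
have cB := shiftop_iter k (shiftop_bavgs s).
rewrite (shiftopC _ (shiftop_fdiff z) cB).
have := bavgs_smooth ws k0 (fdiff_heat1 H0 k0 zs hxi) x => /le_trans; apply.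
rewrite -(_ : (a - 1) / 2 - 2^-1 = a / 2 - 1); last by field.
by rewrite -powR_half//; apply: le_of_eq; ring.
Qed.

(** The first difference costs the factor 3; each further one meets a fresh factor of
    [iter_heat_step], which doubles the constant and contributes k^(-1/2). *)
Lemma fdiff_heat3 xi H z w y k : 0 <= H -> (0 < k)%N -> z \in s -> w \in s -> y \in s ->
  (forall x y, `|xi x - xi y| <= H * `|x - y| `^ a) ->
  forall x, `|fdiff y (fdiff w (fdiff z (iter k heat_step xi))) x|
     <= 12 * (H * h `^ a * k%:R `^ ((a - 1) / 2 - 1)).
Proof.
move=> H0 k0 zs ws ys hxi x.
have cB := shiftop_iter k (shiftop_bavgs s).
rewrite iter_heat_step (shiftopC _ (shiftop_fdiff z) cB) (shiftopC _ (shiftop_fdiff w) cB).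
have := bavgs_smooth ys k0 (fdiff_heat2 H0 k0 zs ws hxi) x => /le_trans; apply.
rewrite -(_ : a / 2 - 1 - 2^-1 = (a - 1) / 2 - 1); last by field.
by rewrite -powR_half//; apply: le_of_eq; ring.
Qed.

Lemma fdiff_heat2' xi H z w k : 0 <= H -> (0 < k)%N -> z \in s -> w \in s ->
  (forall x y, `|xi x - xi y| <= H * `|x - y| `^ a) ->
  forall x, `|fdiff w (fdiff z (iter k heat_step xi)) x|
     <= 6 * (H * h `^ a * k%:R `^ (a / 2 - 1)).
Proof.
move=> H0 k0 zs ws hxi x.
have cB := shiftop_iter k (shiftop_bavgs s).
rewrite iter_heat_step (shiftopC _ (shiftop_fdiff z) cB) (shiftopC _ (shiftop_fdiff w) cB).
by apply: nonexp_iter; [exact: nonexp_bavgs|exact: fdiff_heat2].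
Qed.

Lemma fdiff_heat0 xi H z w : 0 <= H -> z \in s ->
  (forall x y, `|xi x - xi y| <= H * `|x - y| `^ a) ->
  forall x, `|fdiff w (fdiff z xi) x| <= 2 * (H * h `^ a).
Proof.
move=> H0 zs hxi; apply: fdiff_le => x; rewrite (le_trans (hxi _ _))//.
by rewrite ler_wpM2l// addrAC subrr add0r ge0_ler_powR ?nnegrE ?(ltW a0) ?(ltW h0) ?sh.
Qed.

(** The time step of [heat_step]: each direction is averaged three times, and each average adds h^2
    / 4 times a second difference quotient. *)
Definition tau : R := 3 / 4 * h ^+ 2.
Definition theta : R := (1 + lam * tau)^-1.

Lemma tau_gt0 : 0 < tau. Proof. by rewrite /tau mulr_gt0 ?exprn_gt0. Qed.

Let lt0 : 0 < 1 + lam * tau. Proof. by rewrite ltr_wpDr// mulr_ge0 ?ltW// tau_gt0. Qed.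

Lemma theta_gt0 : 0 < theta. Proof. by rewrite invr_gt0. Qed.

Lemma theta_le1 : theta <= 1.
Proof. by rewrite invf_le1// lerDl mulr_ge0 ?ltW// tau_gt0. Qed.

Lemma thetaE : lam * tau * theta = 1 - theta.
Proof. by rewrite /theta; field; exact: lt0r_neq0. Qed.

Lemma sum_theta_le K : \sum_(0 <= k < K) tau * theta ^+ k.+1 <= lam^-1.
Proof.
suff -> : \sum_(0 <= k < K) tau * theta ^+ k.+1 = (1 - theta ^+ K) / lam.
  by rewrite ler_pdivrMr// mulVf ?gt_eqF// gerBl exprn_ge0// ltW// theta_gt0.
elim: K => [|K IH]; first by rewrite big_geq// expr0 subrr mul0r.
rewrite big_nat_recr//= IH; apply: (mulIf (lt0r_neq0 lam0)).
rewrite mulrDl !divfK ?gt_eqF//.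
have -> : tau * theta ^+ K.+1 * lam = theta ^+ K * (1 - theta).
  by rewrite -thetaE exprS; ring.
by rewrite exprS; ring.
Qed.

(* Truncated Neumann series of [tau * (1 + lam * tau - heat_step)^-1], with [theta = (1 + lam * tau)^-1]. *)
Definition resolvent K xi : V -> R :=
  fun x => \sum_(k < K) tau * theta ^+ k.+1 * iter k heat_step xi x.

Lemma resolvent_shiftop A K xi : shiftop A ->
  A (resolvent K xi) = fun x => \sum_(k < K) tau * theta ^+ k.+1 * A (iter k heat_step xi) x.
Proof.
by move=> cA; rewrite (shiftop_sum _ (fun k => tau * theta ^+ k.+1)).
Qed.

Let coef_ge0 k : 0 <= tau * theta ^+ k.+1.
Proof. by rewrite mulr_ge0 ?exprn_ge0// ltW ?tau_gt0 ?theta_gt0. Qed.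

Lemma resolvent_le xi M K : (forall x, `|xi x| <= M) -> forall x, `|resolvent K xi x| <= M / lam.
Proof.
move=> xiM x; have M0 : 0 <= M by rewrite (le_trans _ (xiM 0)).
rewrite /resolvent (le_trans (ler_norm_sum _ _ _))//.
rewrite (@le_trans _ _ (\sum_(k < K) tau * theta ^+ k.+1 * M))//.
  apply: ler_sum => k _; rewrite normrM ger0_norm// ler_wpM2l//.
  by apply: nonexp_iter => //; exact: nonexp_heat_step.
rewrite -mulr_suml mulrC ler_wpM2l//.
by rewrite -(big_mkord xpredT (fun k => tau * theta ^+ k.+1)) sum_theta_le.
Qed.

Lemma resolvent_holder xi H K : (forall x y, `|xi x - xi y| <= H * `|x - y| `^ a) ->
  forall x y, `|resolvent K xi x - resolvent K xi y| <= H / lam * `|x - y| `^ a.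
Proof.
move=> hxi x y; pose r := x - y.
have -> : x = y + r by rewrite subrKC.
rewrite -/(fdiff r (resolvent K xi) y) mulrAC [y + r - y]addrAC subrr add0r.
have -> : fdiff r (resolvent K xi) = resolvent K (fdiff r xi).
  rewrite (resolvent_shiftop _ _ (shiftop_fdiff r)); apply/funext => z.
  apply: eq_bigr => k _; rewrite (shiftopC _ (shiftop_fdiff r))//.
  exact: shiftop_iter shiftop_heat_step.
apply: resolvent_le => z; rewrite /fdiff (le_trans (hxi _ _))//.
by rewrite addrAC subrr add0r.
Qed.

(** Since lam * tau * theta + theta = 1, the truncated series telescopes in the resolvent equation
    and leaves only the first omitted power. *)
Lemma resolvent_eq xi M K : (forall x, `|xi x| <= M) -> forall x,
  `|lam * tau * resolvent K xi x - (heat_step (resolvent K xi) x - resolvent K xi x) - tau * xi x|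
    <= tau * (theta ^+ K * M).
Proof.
move=> xiM x; rewrite (resolvent_shiftop _ _ shiftop_heat_step) /resolvent.
have -> : lam * tau * (\sum_(k < K) tau * theta ^+ k.+1 * iter k heat_step xi x) -
    (\sum_(k < K) tau * theta ^+ k.+1 * heat_step (iter k heat_step xi) x -
    \sum_(k < K) tau * theta ^+ k.+1 * iter k heat_step xi x) - tau * xi x
   = - (tau * (theta ^+ K * iter K heat_step xi x)).
  elim: K => [|K IH]; first by rewrite !big_ord0 /= expr0; ring.
  rewrite !big_ord_recr/=; move: IH.
  set A := \sum_(_ < _) _; set B := \sum_(_ < _) _ => IH.
  set p := iter K heat_step xi x; set q := heat_step _ _.
  rewrite -/p in IH.
  have -> : lam * tau * (A + tau * theta ^+ K.+1 * p) -
     (B + tau * theta ^+ K.+1 * q - (A + tau * theta ^+ K.+1 * p)) - tau * xi x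
     = (lam * tau * A - (B - A) - tau * xi x) + tau * theta ^+ K * p * (lam * tau * theta + theta)
       - tau * theta ^+ K.+1 * q by rewrite exprS; ring.
  by rewrite IH thetaE; ring.
have c0 : 0 <= tau * theta ^+ K.
  by rewrite mulr_ge0 ?exprn_ge0// ltW ?tau_gt0 ?theta_gt0.
rewrite normrN !mulrA normrM (ger0_norm c0) ler_wpM2l//.
by apply: nonexp_iter => //; exact: nonexp_heat_step.
Qed.

(** Three regimes of the Neumann series: the term k = 0, to which no smoothing applies, then k up to
    [n], then the tail. The bounds are summed past [K], so the truncation may fall on either side of
    [n]. *)
Lemma sum_split3 (x A B : nat -> R) (K n : nat) (e S1 S2 : R) :
  (forall k, 0 <= x k) -> x 0%N <= e ->
  (forall k, (0 < k <= n)%N -> x k <= A k) -> \sum_(1 <= k < n.+1) A k <= S1 ->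
  (forall k, (n < k)%N -> x k <= B k) -> (forall m, \sum_(n.+1 <= k < m) B k <= S2) ->
  \sum_(k < K) x k <= e + S1 + S2.
Proof.
move=> x0 xe xA sA xB sB.
rewrite -(big_mkord xpredT x) (@le_trans _ _ (\sum_(0 <= k < n.+1 + K) x k))//.
  rewrite [leRHS](big_cat_nat (n := K)) ?leq_addl//= lerDl.
  by rewrite big_nat_cond sumr_ge0.
rewrite (big_cat_nat (n := n.+1)) ?leq_addr//= lerD//.
  rewrite big_ltn// lerD// (le_trans _ sA)// ler_sum_nat// => k; rewrite ltnS; exact: xA.
by rewrite (le_trans _ (sB (n.+1 + K)%N))// ler_sum_nat// => k /andP[nk _]; exact: xB.
Qed.

Let tauh : tau / h ^+ 2 = 3 / 4.
Proof. by rewrite /tau mulfK// expf_neq0// gt_eqF. Qed.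

Lemma theta_exp_le1 k : theta ^+ k <= 1.
Proof. by rewrite exprn_ile1// ?theta_le1// ltW// theta_gt0. Qed.

Let coefM k (c : R) : 0 <= c -> tau * theta ^+ k.+1 * c / h ^+ 2 <= 3 / 4 * c.
Proof.
move=> c0; have -> : tau * theta ^+ k.+1 * c / h ^+ 2 = tau / h ^+ 2 * c * theta ^+ k.+1.
  by ring.
by rewrite tauh ler_piMr ?mulr_ge0// theta_exp_le1.
Qed.

Let absM k (c y : R) : `|y| <= c -> `|tau * theta ^+ k.+1 * y| / h ^+ 2 <= tau * theta ^+ k.+1 * c / h ^+ 2.
Proof.
by move=> yc; rewrite normrM (ger0_norm (coef_ge0 k)) ler_wpM2r ?invr_ge0 ?exprn_ge0 ?(ltW h0)// ler_wpM2l.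
Qed.

Let sumA (n : nat) (c : R) : 0 <= c ->
  \sum_(1 <= k < n.+1) 3 / 4 * (c * k%:R `^ (a / 2 - 1)) <= 3 / a * c * n%:R `^ (a / 2).
Proof.
move=> c0; under eq_bigr do rewrite mulrA.
rewrite -mulr_sumr; have h1 : 0 < a / 2 <= 1 by have := a0; have := a1 => ? ?; apply/andP; split; lra.
rewrite (le_trans (ler_wpM2l _ (sum_powR_le n h1)))//; first by rewrite mulr_ge0.
apply: le_of_eq; field; exact: lt0r_neq0.
Qed.

(** One summand for each regime in [resolvent_fdiff2]: k = 0, then k up to h^(-2), then the later
    terms. *)
Definition schauder_cst : R := 2 + 18 / a + 6 / lam.

Lemma resolvent_fdiff2 N xi H K z w : (0 < N)%N -> h = N%:R^-1 -> 0 <= H ->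
  z \in s -> w \in s -> (forall x y, `|xi x - xi y| <= H * `|x - y| `^ a) ->
  forall x, `|fdiff w (fdiff z (resolvent K xi)) x| / h ^+ 2 <= schauder_cst * H.
Proof.
move=> N0 hN H0 zs ws hxi x.
have Np : 0 < N%:R :> R by rewrite ltr0n.
rewrite (resolvent_shiftop _ _ (shiftop_comp (shiftop_fdiff w) (shiftop_fdiff z))).
have ha0 : 0 <= h `^ a by rewrite powR_ge0.
have hle1 : h <= 1 by rewrite hN invf_le1// ler1n.
have ha1 : h `^ a <= 1.
  by have := @ge0_ler_powR R a (ltW a0) h 1; rewrite !nnegrE ler01 ltW// powR1; apply.
have hNa : h `^ a * (N ^ 2)%:R `^ (a / 2) = 1.
  rewrite natrX -powR_mulrn ?(ltW Np)// -powRrM mulrCA mulfV// mulr1.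
  by rewrite -powRM ?(ltW h0) ?(ltW Np)// hN mulVf ?gt_eqF// powR1.
rewrite (@le_trans _ _ (\sum_(k < K) `|tau * theta ^+ k.+1 * fdiff w (fdiff z (iter k heat_step xi)) x| / h ^+ 2))//.
  by rewrite -mulr_suml ler_wpM2r ?invr_ge0 ?exprn_ge0 ?(ltW h0)// ler_norm_sum.
have -> : schauder_cst * H = 2 * H + 18 / a * H + 6 / lam * H by rewrite /schauder_cst; ring.
have C0 : 0 <= H * h `^ a by rewrite mulr_ge0.
(* The cut at k = N^2 = h^(-2) corresponds to a diffusion time of order one. Before it the sum of
   k^(a/2 - 1) is of order N^a and cancels h^a. After it that power is not summable, but h^(a-2)
   k^(a/2 - 1) is at most 1 and the weights tau * theta^(k+1) have sum at most 1 / lam. *)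
apply: (@sum_split3
  (fun k => `|tau * theta ^+ k.+1 * fdiff w (fdiff z (iter k heat_step xi)) x| / h ^+ 2)
  (fun k => 3 / 4 * (6 * (H * h `^ a) * k%:R `^ (a / 2 - 1)))
  (fun k => 6 * H * (tau * theta ^+ k.+1)) K (N ^ 2)%N (2 * H) (18 / a * H) (6 / lam * H)).
- by move=> k; rewrite divr_ge0// exprn_ge0// ltW.
- rewrite (le_trans (absM _ (fdiff_heat0 _ H0 zs hxi _)))//.
  rewrite (le_trans (coefM _ _)) ?mulr_ge0//.
  have : H * h `^ a <= H by rewrite ler_piMr.
  lra.
- move=> k /andP[k0 _].
  rewrite (le_trans (absM _ (fdiff_heat2' H0 k0 zs ws hxi _)))//.
  by rewrite (le_trans (coefM _ _)) -?mulrA// !mulr_ge0 ?powR_ge0.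
- rewrite (le_trans (sumA _ _)) ?mulr_ge0// -!mulrA hNa; lra.
- move=> k kN; have k0 : (0 < k)%N by apply: leq_ltn_trans kN.
  rewrite (le_trans (absM _ (fdiff_heat2' H0 k0 zs ws hxi _)))//.
  rewrite [leRHS]mulrC -[leLHS]mulrA ler_wpM2l// -[leLHS]mulrA ler_wpM2l// -!mulrA ler_piMr//.
  have -> : h `^ a * (k%:R `^ (a / 2 - 1) * h ^- 2) = h `^ (a - 2) * k%:R `^ (a / 2 - 1).
    rewrite [h `^ (a - 2)]powRB; last by rewrite (gt_eqF h0) implybT.
    by rewrite powR_mulrn ?ltW//; ring.
  have -> : h `^ (a - 2) = (N ^ 2)%:R `^ (1 - a / 2).
    rewrite natrX -powR_mulrn ?(ltW Np)// -powRrM.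
    rewrite (_ : 2 * _ = - (a - 2)); last by field.
    by rewrite powRN hN -powR_inv1 ?(ltW Np)// -powRrM mulN1r powRN.
  rewrite -[a / 2 - 1]opprB [in X in _ * X]powRN ler_pdivrMr ?powR_gt0 ?ltr0n// mul1r.
  by rewrite ge0_ler_powR ?nnegrE ?ler_nat ?(ltnW kN)// ?subr_ge0; have := a1; lra.
- move=> m; rewrite -mulr_sumr (_ : 6 / lam * H = 6 * H * lam^-1); last by ring.
  rewrite ler_wpM2l ?mulr_ge0//; case: (leqP (N ^ 2).+1 m) => nm; last first.
    by rewrite big_geq ?(ltnW nm)// invr_ge0 ltW.
  rewrite (le_trans _ (sum_theta_le m))// [leRHS](big_cat_nat (n := (N ^ 2).+1))//= lerDr.
  by rewrite sumr_ge0.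
Qed.

(** Again one summand for each regime. The denominator 1 - a comes from the tail of the sum of
    k^((a-1)/2 - 1), which converges because a < 1. *)
Definition schauder_holder_cst (L : R) : R := 3 + 36 / a + 18 * L / (1 - a).

(* [r] is a lattice vector: at most [L q] steps lead from [x] to [x + r]. *)
Lemma resolvent_fdiff2_holder (L : R) (q : nat) xi H K z w r : (0 < q)%N -> 0 <= L -> 0 <= H ->
  (forall g E, (forall y, y \in s -> forall x, `|fdiff y g x| <= E) ->
     forall x, `|fdiff r g x| <= L * q%:R * E) ->
  z \in s -> w \in s -> (forall x y, `|xi x - xi y| <= H * `|x - y| `^ a) ->
  forall x, `|fdiff r (fdiff w (fdiff z (resolvent K xi))) x| / h ^+ 2
    <= schauder_holder_cst L * H * (q%:R * h) `^ a.
Proof.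
move=> q0 L0 H0 rL zs ws hxi x.
have Q0 : 0 < q%:R :> R by rewrite ltr0n.
rewrite (resolvent_shiftop _ _ (shiftop_comp (shiftop_fdiff r)
  (shiftop_comp (shiftop_fdiff w) (shiftop_fdiff z)))).
have ha0 : 0 <= h `^ a by rewrite powR_ge0.
have C0 : 0 <= H * h `^ a by rewrite mulr_ge0.
rewrite powRM ?(ltW h0) ?(ltW Q0)//.
have q2 : (q ^ 2)%:R `^ (a / 2) = q%:R `^ a :> R.
  by rewrite natrX -powR_mulrn ?(ltW Q0)// -powRrM mulrCA mulfV// mulr1.
have q1 : 1 <= q%:R `^ a :> R by rewrite powR_ge_one// ler1n.
pose X k := `|tau * theta ^+ k.+1 * fdiff r (fdiff w (fdiff z (iter k heat_step xi))) x| / h ^+ 2.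
rewrite (@le_trans _ _ (\sum_(k < K) X k))//.
  by rewrite -mulr_suml ler_wpM2r ?invr_ge0 ?exprn_ge0 ?(ltW h0)// ler_norm_sum.
have -> : schauder_holder_cst L * H * (q%:R `^ a * h `^ a)
  = 3 * (H * h `^ a) * q%:R `^ a + 36 / a * (H * h `^ a) * q%:R `^ a
    + 18 * L / (1 - a) * (H * h `^ a) * q%:R `^ a.
  by rewrite /schauder_holder_cst; ring.
(* The walk needs about q^2 steps to cover the length of [r]. Up to then the difference along [r] is
   bounded by twice the second difference. Later it is spread over a path of at most L q lattice
   steps, and the third differences have a summable decay whose tail beyond q^2 is of order
   q^(a-1). *)
apply: (@sum_split3 X
  (fun k => 3 / 4 * (12 * (H * h `^ a) * k%:R `^ (a / 2 - 1)))
  (fun k => 9 * L * q%:R * (H * h `^ a) * k%:R `^ ((a - 1) / 2 - 1)) K (q ^ 2)%N).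
- by move=> k; rewrite divr_ge0// exprn_ge0// ltW.
- have f3 := fdiff_le r (fdiff_heat0 w H0 zs hxi) x.
  rewrite (le_trans (absM _ f3))// (le_trans (coefM _ _)) ?mulr_ge0//.
  rewrite (_ : 3 / 4 * _ = 3 * (H * h `^ a)); last by field.
  by rewrite ler_peMr ?mulr_ge0.
- move=> k /andP[k0 _].
  have f3 := fdiff_le r (fdiff_heat2' H0 k0 zs ws hxi) x.
  rewrite (le_trans (absM _ f3))// (le_trans (coefM _ _)) ?mulr_ge0 ?powR_ge0//.
  by apply: le_of_eq; ring.
- rewrite (le_trans (sumA _ _)) ?mulr_ge0// q2.
  by apply: le_of_eq; ring.
- move=> k kN; have k0 : (0 < k)%N by apply: leq_ltn_trans kN.
  have f3 := rL _ _ (fun y ys => fdiff_heat3 H0 k0 zs ws ys hxi) x.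
  rewrite (le_trans (absM _ f3))// (le_trans (coefM _ _)) ?mulr_ge0 ?powR_ge0//.
  by apply: le_of_eq; field.
- move=> m; rewrite -mulr_sumr.
  have c0 : 0 < (1 - a) / 2 by rewrite divr_gt0// subr_gt0.
  have q2p : (0 < q ^ 2)%N by rewrite expn_gt0 q0.
  have := sum_powRN_le (q ^ 2).-1 m c0; rewrite prednK//.
  rewrite (_ : - ((1 - a) / 2) = (a - 1) / 2); last by field.
  have -> : (q ^ 2)%:R `^ ((a - 1) / 2) = q%:R `^ (a - 1) :> R.
    rewrite natrX -powR_mulrn ?(ltW Q0)// -powRrM; by congr (_ `^ _); field.
  move=> hs; have D0 : 0 <= 9 * L * q%:R * (H * h `^ a) by rewrite !mulr_ge0.
  rewrite (le_trans (ler_wpM2l D0 hs))//.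
  rewrite -(mulr_powRB1 (ltW Q0) a0); apply: le_of_eq; field.
  by rewrite gt_eqF// subr_gt0.
Qed.

Lemma bavgs_near (s' : seq V) g E : 0 <= E ->
  (forall z, z \in s' -> forall x, `|fdiff z g x| <= E) ->
  forall x, `|bavgs s' g x - g x| <= (size s')%:R * E.
Proof.
move=> E0; elim: s' g => [|z s' IH] g gE x; first by rewrite subrr normr0 mul0r.
have IH' : forall x, `|bavgs s' g x - g x| <= (size s')%:R * E.
  by apply: IH => y ys; apply: gE; rewrite inE ys orbT.
have gz : forall x, `|fdiff z g x| <= E by apply: gE; rewrite mem_head.
rewrite [bavgs _ _]/= [size _]/= -[X in `|X|](subrKA (bavg z g x)) -(natr1 (size s')) mulrDl mul1r.
rewrite (le_trans (ler_normD _ _))// lerD//.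
  have -> : bavg z (bavgs s' g) x - bavg z g x = bavg z (fun y => bavgs s' g y - g y) x.
    by rewrite shiftopB//; exact: shiftop_bavg.
  exact: nonexp_bavg.
have -> : bavg z g x - g x = 4^-1 * (fdiff z g x - fdiff z g (x - z)).
  by rewrite /bavg /avg /fdiff !addrK [x - z + z]subrK; field.
rewrite normrM ger0_norm// mulrC ler_pdivrMr// (le_trans (ler_normB _ _))//.
have := gz x; have := gz (x - z); lra.
Qed.

(** Averaging along [z] adds h^2 / 4 times the second difference quotient based at x - z. Peeling
    off the directions one by one therefore costs only the oscillation [E] of second quotients over
    one lattice step, in place of a bound on higher derivatives. *)
Lemma bavgs_laplacian (s' : seq V) g E : 0 <= E -> {subset s' <= s} ->
  (forall z w, z \in s -> w \in s -> forall x,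
     `|fdiff w (fun y => fdiff z (fdiff z g) y / h ^+ 2) x| <= E) ->
  forall x, `|bavgs s' g x - g x - h ^+ 2 / 4 * \sum_(z <- s') (fdiff z (fdiff z g) x / h ^+ 2)|
     <= h ^+ 2 / 4 * ((size s')%:R * ((size s').+1%:R * E)).
Proof.
move=> E0 + gE; have h2 : 0 < h ^+ 2 by rewrite exprn_gt0.
have h4 : 0 <= h ^+ 2 / 4 by rewrite divr_ge0// ltW.
elim: s' => [|z s' IH] ss x.
  by rewrite big_nil subrr mulr0 subr0 normr0 mul0r mulr0.
have ss' : {subset s' <= s} by move=> y ys; apply: ss; rewrite inE ys orbT.
have zs : z \in s by apply: ss; rewrite mem_head.
rewrite big_cons; set n : R := (size s')%:R.
pose W y := fdiff z (fdiff z g) y / h ^+ 2.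
have bW y : bavg z g y - g y = h ^+ 2 / 4 * W (y + - z).
  rewrite /W /bavg /avg /fdiff !addrK [y - z + z]subrK; field.
  by rewrite lt0r_neq0.
have sW : bavgs s' (fun y => W (y + - z)) x = bavgs s' W (x - z).
  by rewrite (shiftopC _ (shiftop_bavgs s') (shiftop_shift (- z))).
rewrite [bavgs (z :: s') g]/= -(shiftopC _ (shiftop_bavgs s') (shiftop_bavg z)).
have -> : bavgs s' (bavg z g) x = bavgs s' g x + h ^+ 2 / 4 * bavgs s' W (x - z).
  rewrite -sW; have -> : bavg z g = fun y => h ^+ 2 / 4 * W (y + - z) + g y.
    by apply/funext => y; rewrite -bW subrK.
  by rewrite (shiftop_linear _ _ _ (shiftop_bavgs s')) addrC.
rewrite -/(W x); set S := \sum_(_ <- _) _.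
have -> : bavgs s' g x + h ^+ 2 / 4 * bavgs s' W (x - z) - g x - h ^+ 2 / 4 * (W x + S)
  = (bavgs s' g x - g x - h ^+ 2 / 4 * S)
   + h ^+ 2 / 4 * ((bavgs s' W (x - z) - W (x - z)) - (W x - W (x - z))) by ring.
rewrite (le_trans (ler_normD _ _))//.
have i1 := IH ss' x; rewrite -/S in i1.
have i2 : `|bavgs s' W (x - z) - W (x - z)| <= n * E.
  by apply: bavgs_near => // y ys; apply: gE => //; apply: ss'.
have i3 : `|W x - W (x - z)| <= E.
  by have := gE z z zs zs (x - z); rewrite -/W [fdiff z W _]/fdiff subrK.
have n0 : 0 <= n by rewrite /n.
rewrite [size _]/= -(natr1 (size s').+1) -(natr1 (size s')) in i1 *.
rewrite -/n in i1 *.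
rewrite [X in _ + X]normrM (ger0_norm h4).
apply: le_trans (lerD i1 (ler_wpM2l h4 (le_trans (ler_normB _ _) (lerD i2 i3)))) _.
rewrite -mulrDr ler_wpM2l// -subr_ge0.
have -> : (n + 1) * ((n + 1 + 1) * E) - (n * ((n + 1) * E) + (n * E + E)) = (n + 1) * E by ring.
by rewrite mulr_ge0// addr_ge0.
Qed.

(** With B the average over all directions and S the discrete Laplacian, B^3 g - g equals h^2 / 4
    times S + B S + B^2 S, up to three errors from [bavgs_laplacian]. As [tau] is three times h^2 /
    4, the leading term is S. *)
Lemma heat_step_laplacian g E : 0 <= E ->
  (forall z w, z \in s -> w \in s -> forall x,
     `|fdiff w (fun y => fdiff z (fdiff z g) y / h ^+ 2) x| <= E) ->
  forall x, `|(heat_step g x - g x) / tau - \sum_(z <- s) (fdiff z (fdiff z g) x / h ^+ 2)|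
     <= (size s)%:R * ((2 * (size s)%:R + 1) * E).
Proof.
move=> E0 gE x; set n : R := (size s)%:R.
have n0 : 0 <= n by rewrite /n.
have h2 : 0 < h ^+ 2 by rewrite exprn_gt0.
have h4 : 0 <= h ^+ 2 / 4 by rewrite divr_ge0// ltW.
have h4' : 0 < h ^+ 2 / 4 by rewrite divr_gt0.
pose B := bavgs s; pose S y := \sum_(z <- s) (fdiff z (fdiff z g) y / h ^+ 2).
pose D y := B g y - g y - h ^+ 2 / 4 * S y.
have cB : shiftop B := shiftop_bavgs s.
have D1 y : `|D y| <= h ^+ 2 / 4 * (n * ((n + 1) * E)).
  by rewrite /n natr1; exact: bavgs_laplacian.
have SE z : z \in s -> forall y, `|fdiff z S y| <= n * E.
  move=> zs y; rewrite /fdiff /S -sumrB (le_trans (ler_norm_sum _ _ _))//.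
  rewrite (@le_trans _ _ (\sum_(z <- s) E))//; last by rewrite big_const_seq count_predT iter_addr_0 /n mulr_natl.
  rewrite big_seq [leRHS]big_seq; apply: ler_sum => w ws; exact: gE.
have BS y : `|B S y - S y| <= n * (n * E).
  by apply: bavgs_near => //; rewrite mulr_ge0.
have BBS y : `|B (B S) y - B S y| <= n * (n * E).
  have -> : B (B S) y - B S y = B (fun y => B S y - S y) y by rewrite shiftopB.
  exact: nonexp_bavgs.
have BD y : `|B D y| <= h ^+ 2 / 4 * (n * ((n + 1) * E)) by apply: nonexp_bavgs.
have BBD y : `|B (B D) y| <= h ^+ 2 / 4 * (n * ((n + 1) * E)) by apply: nonexp_bavgs.
have eB : B g = fun y => h ^+ 2 / 4 * S y + (1 * g y + D y).
  by apply/funext => y; rewrite /D; ring.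
have eBB : B (B g) = fun y => h ^+ 2 / 4 * B S y + (1 * B g y + B D y).
  by rewrite {1}eB !(shiftop_linear _ _ _ cB).
have eBBB : heat_step g = fun y => h ^+ 2 / 4 * B (B S) y + (1 * B (B g) y + B (B D) y).
  by rewrite /heat_step -/B {1}eBB !(shiftop_linear _ _ _ cB).
have -> : (heat_step g x - g x) / tau - S x
   = (h ^+ 2 / 4 * (2 * (B S x - S x) + (B (B S) x - B S x)) + D x + B D x + B (B D) x) / tau.
  rewrite eBBB eBB eB /tau; field; exact: lt0r_neq0.
rewrite normrM normfV (gtr0_norm tau_gt0) ler_pdivrMr ?tau_gt0//.
rewrite (le_trans (ler_normD _ _))// (le_trans (lerD (le_trans (ler_normD _ _) (lerD (ler_normD _ _) (lexx _))) (lexx _)))//.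
have t1 : `|h ^+ 2 / 4 * (2 * (B S x - S x) + (B (B S) x - B S x))| <= h ^+ 2 / 4 * (3 * (n * (n * E))).
  rewrite normrM (ger0_norm h4) ler_wpM2l// (le_trans (ler_normD _ _))//.
  rewrite normrM (ger0_norm (_ : 0 <= 2))//.
  have := BS x; have := BBS x; lra.
apply: le_trans (lerD (lerD (lerD t1 (D1 x)) (BD x)) (BBD x)) _.
by rewrite /tau; apply: le_of_eq; field.
Qed.

End DiscreteResolvent.

(** * Ultralimits and dyadic lattices *)

Lemma cvg_sum_seq (R : realType) (F : set_system nat) (FF : Filter F) (I : Type)
    (u : I -> nat -> R) (l : I -> R) (s : seq I) : (forall i, u i n @[n --> F] --> l i) ->
  \sum_(i <- s) u i n @[n --> F] --> \sum_(i <- s) l i.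
Proof.
move=> ul; elim: s => [|i s IH].
  under eq_fun do rewrite big_nil.
  by rewrite big_nil; exact: cvg_cst.
under eq_fun do rewrite big_cons.
by rewrite big_cons; apply: cvgD.
Qed.

Section UltraLimit.
Variables (R : realType) (U : set_system nat).
Hypothesis UU : UltraFilter U.
Hypothesis Uoo : \oo `<=` U.
Let PU : ProperFilter U. Proof. exact: ultra_proper. Qed.
Local Existing Instance PU.

(** Along an ultrafilter every cluster point is a limit. One ultrafilter thus gives limits at all
    points of space simultaneously, where subsequences would require a diagonal argument. *)
Lemma ultra_compact_cvg (T : topologicalType) (C : set T) (u : nat -> T) : compact C ->
  (forall n, C (u n)) -> exists l : T, u n @[n --> U] --> l.
Proof.
move=> cC uC.
have [p [_ pc]] : C `&` cluster (u n @[n --> U]) !=set0.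
  apply: (cC (u n @[n --> U])); exact: (filterS (fun n _ => uC n) filterT).
exists p => B nB; have [//|nUB] := in_ultra_setVsetC (u @^-1` B) UU.
by have [x [nx Bx]] := pc (~` B) B nUB nB.
Qed.

Lemma ultra_bounded_cvg (u : nat -> R) (M : R) : (forall n, `|u n| <= M) ->
  exists l : R, u n @[n --> U] --> l.
Proof.
move=> uM; apply: (ultra_compact_cvg (@segment_compact R (- M) M)) => n.
by rewrite /= in_itv/= -ler_norml.
Qed.

Lemma ultra_cvg_le (u : nat -> R) (l B : R) (N : nat) : u n @[n --> U] --> l ->
  (forall n, (N <= n)%N -> u n <= B) -> l <= B.
Proof.
move=> ul uB; apply: (cvgr_to_le ul); apply: Uoo.
by exists N => // n /= Nn; exact: uB.
Qed.

Lemma ultra_cvg_norm_le (u : nat -> R) (l B : R) (N : nat) : u n @[n --> U] --> l ->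
  (forall n, (N <= n)%N -> `|u n| <= B) -> `|l| <= B.
Proof. by move=> ul; apply: ultra_cvg_le; exact: cvg_norm. Qed.

Lemma ultra_cvg_norm_to0 (u b : nat -> R) (l : R) : u n @[n --> U] --> l ->
  b n @[n --> \oo] --> 0 -> (forall n, `|u n| <= b n) -> l = 0.
Proof.
move=> ul b0 ub; apply/eqP; rewrite -normr_le0; apply/ler_addgt0Pr => e e0.
rewrite add0r.
have /cvgrPdist_le /(_ e e0) [N _ bN] := b0.
apply: (@ultra_cvg_norm_le u l e N) => // n Nn.
have := bN n Nn; rewrite /= sub0r normrN => h.
by rewrite (le_trans (ub n))// (le_trans _ h)// ler_norm.
Qed.

End UltraLimit.

Section Dyadic.
Variable R : realType.

Definition mesh (n : nat) : R := 2^-1 ^+ n.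

Lemma mesh_gt0 n : 0 < mesh n. Proof. by rewrite exprn_gt0. Qed.

Lemma meshE n : mesh n = (2 ^ n)%:R^-1. Proof. by rewrite /mesh exprVn natrX. Qed.

Lemma mesh_cvg0 : mesh n @[n --> \oo] --> (0 : R).
Proof. by apply: cvg_expr; rewrite ger0_norm// invf_lt1// ltr1n. Qed.

Lemma mesh_small (e : R) : 0 < e -> exists N, forall n, (N <= n)%N -> mesh n <= e.
Proof.
move=> e0; have /cvgrPdist_le /(_ e e0) [N _ h] := mesh_cvg0.
exists N => n Nn; have := h n Nn; rewrite /= sub0r normrN.
by rewrite ger0_norm// ltW// mesh_gt0.
Qed.

Lemma mesh_mono n p : (n <= p)%N -> mesh n = (2 ^ (p - n))%:R * mesh p.
Proof.
move=> np; rewrite !meshE -{2}(subnKC np) expnD natrM invfM mulrCA mulfV ?mulr1//.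
Qed.

Definition dyad (n : nat) (t : R) : R := (Num.floor (t / mesh n))%:~R * mesh n.

Lemma dyad_near n t : 0 <= t - dyad n t <= mesh n.
Proof.
have m0 := mesh_gt0 n; have /andP[h1 h2] := floor_itv (t / mesh n).
rewrite /dyad; apply/andP; split; first by rewrite subr_ge0 -ler_pdivlMr.
by rewrite lerBlDr -{1}[mesh n]mul1r -mulrDl -ler_pdivrMr// addrC ltW// -intrD1.
Qed.

Lemma dyad_cvg t : dyad n t @[n --> \oo] --> t.
Proof.
apply/cvgrPdist_le => e e0; have [N hN] := mesh_small e0.
exists N => // n /= Nn; have /andP[h1 h2] := dyad_near n t.
by rewrite ger0_norm// (le_trans h2)// hN.
Qed.

Section Normed.
Variable V : normedModType R.
Implicit Types (x y v : V).

Lemma holder_continuous (a H : R) (g : V -> R) : 0 < a -> 0 <= H ->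
  (forall x y, `|g x - g y| <= H * `|x - y| `^ a) -> continuous g.
Proof.
move=> a0 H0 hg x; apply/cvgrPdist_le => e e0.
have H1 : 0 < H + 1 by rewrite ltr_wpDl.
pose e1 := e / (H + 1); have e10 : 0 < e1 by rewrite divr_gt0.
apply/nbhs_normP; exists (e1 `^ a^-1); first exact: powR_gt0.
move=> y /= xy; rewrite (le_trans (hg x y))//.
have h : `|x - y| `^ a <= e1.
  rewrite -[leRHS]powRr1 ?(ltW e10)// -(mulVf (lt0r_neq0 a0)) powRrM.
  by rewrite ge0_ler_powR ?nnegrE ?powR_ge0 ?(ltW a0)// ltW.
rewrite (le_trans (ler_wpM2l H0 h))// /e1 mulrCA ler_piMr ?(ltW e0)//.
by rewrite ler_pdivrMr// mul1r lerDl.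
Qed.

Lemma line_cvg (g : V -> R) x v (s : R) (u : nat -> R) : continuous g -> u n @[n --> \oo] --> s ->
  g (x + u n *: v) @[n --> \oo] --> g (x + s *: v).
Proof.
move=> cg us; apply: continuous_cvg; first exact: cg.
by apply: cvgD; [exact: cvg_cst|apply: cvgZ => //; exact: cvg_cst].
Qed.

Section DyadicTaylor.
Variables (g q : V -> R) (v : V) (C c : R).
Hypotheses (c0 : 0 < c) (C0 : 0 <= C) (cg : continuous g).
Hypothesis taylor : forall n (m : nat) x, let s := m%:R * mesh n in 0 < s ->
  `|g (x + s *: v) - g x - s * q x| <= s * (C * s `^ c).

Let Csmall e : 0 < e -> exists2 s0, 0 < s0 & forall s, 0 <= s <= s0 -> C * s `^ c <= e.
Proof.
move=> e0; have C1 : 0 < C + 1 by rewrite ltr_wpDl.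
pose e1 := e / (C + 1); have e10 : 0 < e1 by rewrite divr_gt0.
exists (e1 `^ c^-1); first exact: powR_gt0.
move=> s /andP[s0 ss].
have h : s `^ c <= e1.
  rewrite -[leRHS]powRr1 ?(ltW e10)// -(mulVf (lt0r_neq0 c0)) powRrM.
  by rewrite ge0_ler_powR ?nnegrE ?powR_ge0 ?(ltW c0).
rewrite (le_trans (ler_wpM2l C0 h))// /e1 mulrCA ler_piMr ?(ltW e0)//.
by rewrite ler_pdivrMr// mul1r lerDl.
Qed.

(** The remainder bound does not depend on the base point, so [q] is a uniform limit of the
    continuous difference quotients of [g] at mesh steps. *)
Lemma dyadic_taylor_continuous : continuous q.
Proof.
move=> x; apply/cvgrPdist_le => e e0.
have e3 : 0 < e / 3 by rewrite divr_gt0.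
have [s0 s00 hs0] := Csmall e3.
have [n /(_ n (leqnn n)) hn] := mesh_small s00.
pose s := 1%:R * mesh n; have sE : s = mesh n by rewrite /s mul1r.
have sp : 0 < s by rewrite sE mesh_gt0.
pose F y := (g (y + s *: v) - g y) / s.
have Fq y : `|F y - q y| <= e / 3.
  have h := @taylor n 1%N y sp; rewrite -/s in h.
  have -> : F y - q y = (g (y + s *: v) - g y - s * q y) / s.
    by rewrite /F; field; exact: lt0r_neq0.
  rewrite normrM normfV (gtr0_norm sp) ler_pdivrMr// (le_trans h)// mulrC ler_pM2r//.
  by rewrite hs0// (ltW sp) sE.
have cF : continuous F.
  move=> y; apply: cvgM; last exact: cvg_cst.
  apply: cvgB; last exact: cg.
  apply: (@continuous_comp _ _ _ (fun y => y + s *: v) g); last exact: cg.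
  by apply: cvgD; [exact: cvg_id|exact: cvg_cst].
have /cvgrPdist_le /(_ _ e3) := cF x.
apply: filterS => y xy.
have -> : q x - q y = (F x - F y) + ((F y - q y) - (F x - q x)) by ring.
rewrite (le_trans (ler_normD _ _))// (le_trans (lerD xy (ler_normB _ _)))//.
have := Fq x; have := Fq y; lra.
Qed.

(** Round [s] down to multiples of ever finer meshes and pass to the limit; continuity of [g]
    carries the bound from dyadic steps to every positive step. *)
Let taylor_pos s x : 0 < s ->
  `|g (x + s *: v) - g x - s * q x| <= s * (C * s `^ c).
Proof.
move=> s0; pose u n := dyad n s.
have us : u n @[n --> \oo] --> s := @dyad_cvg s.
have ule n : u n <= s by have /andP[+ _] := dyad_near n s; rewrite subr_ge0.
have [N hN] := mesh_small (divr_gt0 s0 (ltr0Sn _ 1)).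
have upos n : (N <= n)%N -> 0 < u n.
  move=> Nn; have /andP[_] := dyad_near n s; have := hN n Nn; rewrite -/(u n); lra.
apply: (@cvgr_to_le _ \oo _ _ (fun n => `|g (x + u n *: v) - g x - u n * q x|)).
  apply: cvg_norm; apply: cvgB; last by apply: cvgM => //; exact: cvg_cst.
  apply: cvgB; [exact: line_cvg|exact: cvg_cst].
exists N => // n /= Nn.
have [m mE] : exists m : nat, u n = m%:R * mesh n.
  have := upos n Nn; rewrite /u /dyad pmulr_lgt0 ?mesh_gt0// ltr0z => hf.
  exists `|Num.floor (s / mesh n)|%N; congr (_ * _).
  by rewrite natr_absz ger0_norm// ltW.
have := @taylor n m x; rewrite -mE => /(_ (upos n Nn)) /= h; apply: (le_trans h).
have un0 := ltW (upos n Nn).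
apply: ler_pM => //; first by rewrite mulr_ge0 ?powR_ge0.
by rewrite ler_wpM2l// ge0_ler_powR ?nnegrE ?(ltW c0)// ltW.
Qed.

Lemma dyadic_taylor_derive x : is_derive x (v) g (q x).
Proof.
suff h : h^-1 *: ((g \o shift x) (h *: v) - g x) @[h --> 0^'] --> q x.
  apply: DeriveDef; first by apply/cvg_ex; exists (q x).
  exact: cvg_lim.
apply/cvgrPdist_le => e e0; have e2 : 0 < e / 2 by rewrite divr_gt0.
have [s0 s00 hs0] := Csmall e2.
have cq : q (x + t *: v) @[t --> (0 : R)] --> q x.
  rewrite -[X in _ --> q X]addr0 -[X in _ --> q (_ + X)](scale0r (v)).
  apply: continuous_cvg; first exact: dyadic_taylor_continuous.
  by apply: cvgD; [exact: cvg_cst|apply: cvgZ; [exact: cvg_id|exact: cvg_cst]].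
have /cvgrPdist_le /(_ _ e2) cq' := cq.
rewrite near_withinE; near=> t => t0.
have ts : `|t| <= s0.
  near: t; apply/nbhs_ballP; exists s0 => // y.
  by rewrite -ball_normE /= sub0r normrN; exact: ltW.
have hq : `|q x - q (x + t *: v)| <= e / 2 by near: t.
have hC : C * `|t| `^ c <= e / 2 by rewrite hs0// normr_ge0.
rewrite /= [t *: _ + x]addrC [_ *: _]mulrC.
case: (ltgtP t 0) => [tn|tp|tz]; last by rewrite tz eqxx in t0.
(* For negative t, expand at y = x + t v with the positive step -t, and replace q y by q x by
   continuity of [q]. *)
- pose y := x + t *: v; have hp : 0 < - t by rewrite oppr_gt0.
  have := taylor_pos y hp.
  rewrite {2}/y scaleNr addrK -(ltr0_norm tn) => h.
  have -> : q x - (g y - g x) / t = (q x - q y) - (g x - g y - `|t| * q y) / `|t|.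
    rewrite ltr0_norm//; field; exact: ltr0_neq0.
  rewrite (le_trans (ler_normB _ _))// [leRHS](splitr e) lerD//.
  rewrite normrM normfV normr_id ler_pdivrMr ?normr_gt0 ?ltr0_neq0// (le_trans h)//.
  by rewrite mulrC ler_wpM2r.
- have h := taylor_pos x tp.
  have -> : q x - (g (x + t *: v) - g x) / t
     = - ((g (x + t *: v) - g x - t * q x) / t).
    by field; exact: lt0r_neq0.
  rewrite normrN normrM normfV ler_pdivrMr ?normr_gt0 ?lt0r_neq0//.
  rewrite (gtr0_norm tp) in hC *.
  rewrite (le_trans h)// mulrC ler_wpM2r ?(ltW tp)//; lra.
Unshelve. all: by end_near. Qed.

End DyadicTaylor.

End Normed.

Variable d : nat.
Implicit Types (g q : 'rV[R]_d -> R) (x y r : 'rV[R]_d).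

Definition lattice n r := forall i, exists m : int, r 0 i = m%:~R * mesh n.

Lemma lattice_mono n p r : (n <= p)%N -> lattice n r -> lattice p r.
Proof.
move=> np lr i; have [m ->] := lr i; exists (m * (2 ^ (p - n))%N%:Z).
by rewrite intrM -mulrA -mesh_mono.
Qed.


(** Approximate the increment by lattice vectors. Once the mesh is below its norm, these have at
    most twice that norm, and 2^a <= 2. *)
Lemma lattice_holder (a H : R) g : 0 < a <= 1 -> 0 <= H -> continuous g ->
  (forall n r, lattice n r -> forall x, `|g (x + r) - g x| <= H * `|r| `^ a) ->
  forall x y, `|g x - g y| <= 2 * H * `|x - y| `^ a.
Proof.
move=> /andP[a0 a1] H0 cg hl x y.
have [->|xy] := eqVneq x y; first by rewrite !subrr normr0 mulr_ge0 ?powR_ge0// mulr_ge0.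
pose r := x - y; have r0 : 0 < `|r| by rewrite normr_gt0 subr_eq0.
pose rn n : 'rV[R]_d := \row_j dyad n (r 0 j).
have rnr n : `|rn n - r| <= mesh n.
  apply: norm_le_coord; first exact/ltW/mesh_gt0.
  move=> j; rewrite !mxE distrC; have /andP[h1 h2] := dyad_near n (x 0 j - y 0 j).
  by rewrite ger0_norm.
have [N hN] := mesh_small r0.
have rcv : rn n @[n --> \oo] --> r.
  apply/cvgrPdist_le => e e0; have [N' hN'] := mesh_small e0.
  by exists N' => // n /= Nn; rewrite distrC (le_trans (rnr n))// hN'.
have -> : x = y + r by rewrite subrKC.
rewrite [y + r - y]addrAC subrr add0r.
apply: (@cvgr_to_le _ \oo _ _ (fun n => `|g (y + rn n) - g y|)).
  apply: cvg_norm; apply: cvgB; last exact: cvg_cst.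
  apply: continuous_cvg; first exact: cg.
  by apply: cvgD => //; exact: cvg_cst.
exists N => // n /= Nn.
have ln : lattice n (rn n) by move=> j; rewrite mxE /dyad; eexists.
rewrite (le_trans (hl n _ ln y))// -mulrA mulrCA ler_wpM2l//.
have h2 : `|rn n| <= 2 * `|r|.
  rewrite -[rn n](subrK r) (le_trans (ler_normD _ _))//.
  by have := rnr n; have := hN n Nn; lra.
have h3 : `|rn n| `^ a <= (2 * `|r|) `^ a.
  by rewrite ge0_ler_powR ?nnegrE ?(ltW a0) ?mulr_ge0.
by rewrite (le_trans h3)// powRM// ler_wpM2r ?powR_ge0// ler1_powR// ler1n.
Qed.

End Dyadic.

(** * Schauder theory of [- lap v + lam v = xi] *)

Section LatticePaths.
Variables (R : realType) (V : lmodType R).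
Implicit Types (g : V -> R) (x z : V).

Lemma fdiff_iter_le g z (E : R) k : (forall x, `|fdiff z g x| <= E) ->
  forall x, `|g (x + z *+ k) - g x| <= k%:R * E.
Proof.
move=> gE; elim: k => [|k IH] x; first by rewrite addr0 subrr normr0 mul0r.
rewrite mulrSr addrA -[X in `|X|](subrKA (g (x + z *+ k))) -natr1 mulrDl mul1r [leRHS]addrC.
by rewrite (le_trans (ler_normD _ _))// lerD// gE.
Qed.

(** Discrete Taylor formula: the increment over m steps is the sum of m single differences, each
    within [w] of the first. *)
Lemma fdiff_taylor g z x m (w : R) :
  (forall l, (l < m)%N -> `|fdiff z g (x + z *+ l) - fdiff z g x| <= w) ->
  `|g (x + z *+ m) - g x - m%:R * fdiff z g x| <= m%:R * w.
Proof.
elim: m => [|m IH] h; first by rewrite addr0 subrr !mul0r subrr normr0.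
have e : g (x + z *+ m.+1) = g (x + z *+ m) + fdiff z g (x + z *+ m).
  by rewrite /fdiff mulrSr addrA subrKC.
have -> : g (x + z *+ m.+1) - g x - m.+1%:R * fdiff z g x
  = (g (x + z *+ m) - g x - m%:R * fdiff z g x) + (fdiff z g (x + z *+ m) - fdiff z g x).
  by rewrite e -natr1; ring.
rewrite (le_trans (ler_normD _ _))// -natr1 mulrDl mul1r lerD//; last exact: h.
by apply: IH => l lm; apply: h; exact: ltnW.
Qed.

(* The differences over one period add up to zero. *)
Lemma fdiff_periodic_le g z N (E : R) : (0 < N)%N -> (forall x, g (x + z *+ N) = g x) ->
  (forall x, `|fdiff z (fdiff z g) x| <= E) -> forall x, `|fdiff z g x| <= N%:R * E.
Proof.
move=> N0 gN gE x; have N0' : 0 < N%:R :> R by rewrite ltr0n.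
have E0 : 0 <= E by rewrite (le_trans _ (gE 0)).
have := @fdiff_taylor g z x N (N%:R * E); rewrite gN subrr sub0r normrN normrM.
rewrite ger0_norm// ler_pM2l//; apply => l lN.
by rewrite (le_trans (fdiff_iter_le l gE x))// ler_wpM2r// ler_nat ltnW.
Qed.

End LatticePaths.

Section Grid.
Variables (R : realType) (d : nat).
Implicit Types (g : 'rV[R]_d -> R) (x y z r : 'rV[R]_d).

Definition gstep n (i : 'I_d) : 'rV[R]_d := mesh R n *: evec R i.
Definition gsteps n : seq 'rV[R]_d := [seq gstep n i | i <- enum 'I_d].

Lemma gstep_in n i : gstep n i \in gsteps n.
Proof. by apply: map_f; rewrite mem_enum. Qed.

Lemma gstepsP n z : z \in gsteps n -> exists i, z = gstep n i.
Proof. by move=> /mapP[i _ ->]; exists i. Qed.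

Lemma gsteps_norm n z : z \in gsteps n -> `|z| <= mesh R n.
Proof. by move=> /gstepsP[i ->]; rewrite norm_scale_evec ger0_norm// ltW// mesh_gt0. Qed.

Lemma gstepMn n i k : gstep n i *+ k = (k%:R * mesh R n) *: evec R i.
Proof. by rewrite /gstep scalerMnl mulr_natl. Qed.

Lemma size_gsteps n : size (gsteps n) = d.
Proof. by rewrite size_map size_enum_ord. Qed.

Lemma sum_gsteps n (F : 'rV[R]_d -> R) : \sum_(z <- gsteps n) F z = \sum_(i < d) F (gstep n i).
Proof. by rewrite big_map big_enum. Qed.

(** In the max norm each coordinate of [r] amounts to at most q mesh steps, so d q steps along the
    axes reach x + r. This is the path hypothesis of [resolvent_fdiff2_holder] with L = d. *)
Lemma lattice_path n (q : nat) r : lattice n r -> `|r| <= q%:R * mesh R n ->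
  forall g (E : R), (forall y, y \in gsteps n -> forall x, `|fdiff y g x| <= E) ->
  forall x, `|fdiff r g x| <= d%:R * q%:R * E.
Proof.
move=> lr rq g E gE x; rewrite -mulrA; apply: coord_telescope => i {}x.
have [m mE] := lr i; have h0 := mesh_gt0 R n.
have E0 : 0 <= E by rewrite (le_trans _ (gE _ (gstep_in n i) 0)).
have kq : (`|m|%N%:R : R) <= q%:R.
  rewrite -(ler_pM2r h0) (le_trans _ rq)// (le_trans _ (coord_le_norm r i))//.
  by rewrite mE normrM (gtr0_norm h0) natr_absz intr_norm.
apply: (@le_trans _ _ (`|m|%N%:R * E)); last by rewrite ler_wpM2r.
have gz := fdiff_iter_le `|m|%N (gE _ (gstep_in n i)).
rewrite mE; case: (leP 0 m) => m0.
  have em : `|m|%N%:R = m%:~R :> R by rewrite natr_absz ger0_norm.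
  by have := gz x; rewrite gstepMn em.
have em : `|m|%N%:R = - m%:~R :> R by rewrite natr_absz ltr0_norm// intrN.
have := gz (x + (m%:~R * mesh R n) *: evec R i).
rewrite gstepMn em -addrA -scalerDl mulNr subrr scale0r addr0.
by rewrite distrC.
Qed.

End Grid.

Section SchauderExistence.
Variables (R : realType) (d : nat) (lam a : R).
Hypotheses (lam0 : 0 < lam) (a01 : 0 < a < 1).
Let a0 : 0 < a. Proof. by case/andP: a01. Qed.

Variables (xi : 'rV[R]_d -> R) (M H : R).
Hypotheses (xiper : Defs.periodic xi) (xiM : forall x, `|xi x| <= M) (H0 : 0 <= H).
Hypothesis hxi : forall x y, `|xi x - xi y| <= H * `|x - y| `^ a.

Local Notation h := (mesh R).

Lemma truncation_exists n : exists K, theta (h n) lam ^+ K <= h n.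
Proof.
have t0 : 0 < theta (h n) lam by apply: theta_gt0 => //; exact: mesh_gt0.
have t1 : theta (h n) lam < 1.
  by rewrite invf_lt1 ?ltrDl ?ltr_wpDr// ?mulr_gt0 ?tau_gt0 ?mesh_gt0 ?ltW// mulr_gt0 ?tau_gt0 ?mesh_gt0.
have c : theta (h n) lam ^+ k @[k --> \oo] --> 0.
  by apply: cvg_expr; rewrite gtr0_norm.
have /cvgrPdist_le /(_ _ (mesh_gt0 R n)) [K _ hK] := c.
by exists K; have := hK K (leqnn K); rewrite /= sub0r normrN ger0_norm// exprn_ge0// ltW.
Qed.

Definition truncation n : nat := projT1 (cid (truncation_exists n)).

Definition approx n : 'rV[R]_d -> R :=
  resolvent (gsteps R d n) (h n) lam (truncation n) xi.

Definition approx2 n i j x : R := fdiff (gstep R n j) (fdiff (gstep R n i) (approx n)) x / h n ^+ 2.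
Definition approx1 n i x : R := fdiff (gstep R n i) (approx n) x / h n.

Let C1 := schauder_cst lam a.
Let C2 := 2 * schauder_holder_cst a d%:R.

Let hp n : 0 < h n := mesh_gt0 R n.

Let S0 : 0 <= schauder_holder_cst a d%:R :> R.
Proof.
have /andP[? ?] := a01.
by rewrite !addr_ge0// divr_ge0 ?mulr_ge0// ?subr_ge0 ltW.
Qed.

Let C20 : 0 <= C2. Proof. exact: mulr_ge0. Qed.

Lemma approx2_le n i j x : `|approx2 n i j x| <= C1 * H.
Proof.
rewrite normrM normfV (ger0_norm (exprn_ge0 2 (ltW (hp n)))).
apply: (@resolvent_fdiff2 _ _ (gsteps R d n) (h n) lam a (hp n) lam0 a01 (@gsteps_norm _ _ n) (2 ^ n)%N) => //.
- by rewrite expn_gt0.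
- exact: meshE.
- exact: gstep_in.
- exact: gstep_in.
Qed.

Lemma approx2_holder n i j x r : lattice n r ->
  `|approx2 n i j (x + r) - approx2 n i j x| <= C2 * H * `|r| `^ a.
Proof.
move=> lr; have [->|r0] := eqVneq r 0.
  by rewrite addr0 subrr normr0 !mulr_ge0 ?powR_ge0.
have rh : h n <= `|r|.
  have [i0 ri0] : exists i, r 0 i != 0.
    apply/not_existsP => rz; move/eqP: r0; apply; apply/rowP => k; rewrite mxE.
    by apply/eqP; apply: contrapT => /negP; exact: rz.
  rewrite (le_trans _ (coord_le_norm r i0))//; have [m mE] := lr i0.
  rewrite mE in ri0 *; rewrite normrM (gtr0_norm (hp n)) ler_peMl ?(ltW (hp n))//.
  rewrite -intr_norm ler1z -gtz0_ge1 normr_gt0.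
  by apply: contra_neq ri0 => ->; rewrite mul0r.
(* A nonzero lattice vector has norm at least [h n], so rounding its length up to q steps at most
   doubles it. This is the factor 2 in [C2]. *)
pose q := (Num.trunc (`|r| / h n)).+1.
have /andP[q1 q2] := truncn_itv (divr_ge0 (normr_ge0 r) (ltW (hp n))).
have rq : `|r| <= q%:R * h n by rewrite -ler_pdivrMr// ltW.
have qr : q%:R * h n <= 2 * `|r|.
  rewrite /q -natr1 mulrDl mul1r [2 * _]mulr_natl mulr2n lerD//.
  by rewrite -ler_pdivlMr.
rewrite /approx2 -mulrBl normrM normfV (ger0_norm (exprn_ge0 2 (ltW (hp n)))).
have L0 : 0 <= d%:R :> R by [].
have := @resolvent_fdiff2_holder _ _ (gsteps R d n) (h n) lam a (hp n) lam0 a01 (@gsteps_norm _ _ n)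
  d%:R q xi H (truncation n) (gstep R n i) (gstep R n j) r (ltn0Sn _) L0 H0 (lattice_path lr rq)
  (gstep_in R n i) (gstep_in R n j) hxi x.
move=> le; apply: (le_trans le).
have -> : C2 * H * `|r| `^ a = schauder_holder_cst a d%:R * H * (2 * `|r| `^ a).
  by rewrite /C2; ring.
rewrite ler_wpM2l ?mulr_ge0//.
have p : (q%:R * h n) `^ a <= (2 * `|r|) `^ a.
  by rewrite ge0_ler_powR ?nnegrE ?(ltW a0)// mulr_ge0// ltW.
rewrite (le_trans p)// powRM// ler_wpM2r ?powR_ge0// ler1_powR ?ler1n//.
by apply: ltW; case/andP: a01.
Qed.

Lemma approx_periodic n : Defs.periodic (approx n).
Proof.
move=> i x; rewrite /approx /resolvent; apply: eq_bigr => k _.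
congr (_ * _).
have := shiftop_shiftC (evec R i) xi (shiftop_iter k (shiftop_heat_step (gsteps R d n))).
move=> /(congr1 (fun f => f x)) <-.
by congr (iter _ _ _ _); apply/funext => y; exact: xiper.
Qed.

Lemma mesh1 n : (2 ^ n)%:R * h n = 1.
Proof. by rewrite meshE mulfV// pnatr_eq0 expn_eq0. Qed.

(** A period consists of 2^n steps of length 2^(-n), so the bound on second quotients passes to
    first quotients with the same constant. *)
Lemma approx1_le n i x : `|approx1 n i x| <= C1 * H.
Proof.
rewrite /approx1 normrM normfV (gtr0_norm (hp n)) ler_pdivrMr//.
have per y : approx n (y + gstep R n i *+ 2 ^ n) = approx n y.
  by rewrite gstepMn mesh1 scale1r approx_periodic.
have b y : `|fdiff (gstep R n i) (fdiff (gstep R n i) (approx n)) y| <= C1 * H * h n ^+ 2.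
  rewrite -ler_pdivrMr ?exprn_gt0//.
  by have := approx2_le n i i y; rewrite normrM normfV (ger0_norm (exprn_ge0 2 (ltW (hp n)))).
have N0 : (0 < 2 ^ n)%N by rewrite expn_gt0.
rewrite (le_trans (fdiff_periodic_le N0 per b x))// mulrCA ler_wpM2l//.
  by rewrite (le_trans _ (approx2_le n i i 0)).
by rewrite expr2 mulrA mesh1 mul1r.
Qed.

Lemma approx_le n x : `|approx n x| <= M / lam.
Proof. exact: (resolvent_le (gsteps R d n) (hp n) lam0). Qed.

Lemma approx_holder n x y : `|approx n x - approx n y| <= H / lam * `|x - y| `^ a.
Proof. exact: (resolvent_holder (gsteps R d n) (hp n) lam0). Qed.

(** The first summand is the truncated tail of the Neumann series, the second the consistency error
    of [heat_step_laplacian], where C2 H h^a bounds the oscillation of second quotients over one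
    step. *)
Definition defect n : R := h n * M + d%:R * ((2 * d%:R + 1) * (C2 * H * h n `^ a)).

Lemma approx_equation n x :
  `|lam * approx n x - \sum_(i < d) approx2 n i i x - xi x| <= defect n.
Proof.
have t0 : 0 < tau (h n) by apply: tau_gt0.
have e1 := resolvent_eq (gsteps R d n) (hp n) lam0 (truncation n) xiM x.
rewrite -/(approx n) in e1.
have C0 : 0 <= C2 * H * h n `^ a by rewrite !mulr_ge0 ?powR_ge0.
have e2 : `|(heat_step (gsteps R d n) (approx n) x - approx n x) / tau (h n)
    - \sum_(i < d) approx2 n i i x| <= d%:R * ((2 * d%:R + 1) * (C2 * H * h n `^ a)).
  have := @heat_step_laplacian _ _ (gsteps R d n) _ (hp n) (approx n) _ C0 _ x.
  rewrite sum_gsteps size_gsteps; apply => z w /gstepsP[i ->] /gstepsP[j ->] y.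
  have lj : lattice n (gstep R n j).
    move=> k; exists (k == j)%:Z; rewrite !mxE eqxx /= mulrC; by case: (k == j).
  have := approx2_holder i i y lj.
  by rewrite norm_scale_evec (gtr0_norm (hp n)).
pose A := lam * tau (h n) * approx n x -
  (heat_step (gsteps R d n) (approx n) x - approx n x) - tau (h n) * xi x.
rewrite -/A in e1.
set S := \sum_(i < d) _ in e2 *; set Q := heat_step _ _ x in A e1 e2.
have -> : lam * approx n x - S - xi x = A / tau (h n) + ((Q - approx n x) / tau (h n) - S).
  by rewrite /A; field; exact: lt0r_neq0.
rewrite (le_trans (ler_normD _ _))// lerD//.
rewrite normrM normfV (gtr0_norm t0) ler_pdivrMr// (le_trans e1)// mulrC ler_wpM2r ?(ltW t0)//.
have M0 : 0 <= M by rewrite (le_trans _ (xiM 0)).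
rewrite ler_wpM2r//; exact: (projT2 (cid (truncation_exists n))).
Qed.

Lemma defect_cvg0 : defect n @[n --> \oo] --> 0.
Proof.
have ha : h n `^ a @[n --> \oo] --> 0.
  apply/cvgrPdist_le => e e0.
  have [N hN] := @mesh_small R (e `^ a^-1) (powR_gt0 _ e0).
  exists N => // n /= Nn; rewrite sub0r normrN ger0_norm ?powR_ge0//.
  rewrite -[leRHS]powRr1 ?(ltW e0)// -(mulVf (lt0r_neq0 a0)) powRrM.
  by rewrite ge0_ler_powR ?nnegrE ?powR_ge0 ?(ltW a0) ?(ltW (hp n)) ?hN.
have -> : 0 = 0 * M + d%:R * ((2 * d%:R + 1) * (C2 * H * 0)) by rewrite !(mul0r, mulr0) addr0.
apply: cvgD; first by apply: cvgM; [exact: mesh_cvg0|exact: cvg_cst].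
apply: cvgM; first exact: cvg_cst.
apply: cvgM; first exact: cvg_cst.
by apply: cvgM; first exact: cvg_cst.
Qed.

(** A multiple of the mesh [n] is a multiple of every finer mesh [N], so the step [s] can stay fixed
    while [N] grows. *)
Lemma approx_taylor (N n m : nat) i x : (n <= N)%N -> forall s, s = m%:R * h n ->
  `|approx N (x + s *: evec R i) - approx N x - s * approx1 N i x| <= s * (C1 * H * s).
Proof.
move=> nN s es; pose m' := (m * 2 ^ (N - n))%N.
have sE : s = m'%:R * h N by rewrite es (mesh_mono R nN) natrM mulrA.
have CH0 : 0 <= C1 * H by rewrite (le_trans _ (approx2_le N i i 0)).
rewrite [in X in X - s * _]sE -gstepMn.
have -> : s * approx1 N i x = m'%:R * fdiff (gstep R N i) (approx N) x.
  by rewrite sE /approx1; field; exact: lt0r_neq0.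
have -> : s * (C1 * H * s) = m'%:R * (h N * (C1 * H * s)) by rewrite {1}sE; ring.
apply: fdiff_taylor => l lm.
have b y : `|fdiff (gstep R N i) (fdiff (gstep R N i) (approx N)) y| <= C1 * H * h N ^+ 2.
  rewrite -ler_pdivrMr ?exprn_gt0//.
  by have := approx2_le N i i y; rewrite normrM normfV (ger0_norm (exprn_ge0 2 (ltW (hp N)))).
rewrite (le_trans (fdiff_iter_le l b x))// sE.
have -> : h N * (C1 * H * (m'%:R * h N)) = m'%:R * (C1 * H * h N ^+ 2) by ring.
by rewrite ler_wpM2r ?ler_nat ?(ltnW lm)// mulr_ge0 ?sqr_ge0.
Qed.

Lemma approx1_taylor (N n m : nat) i j x : (n <= N)%N -> forall s, s = m%:R * h n ->
  `|approx1 N i (x + s *: evec R j) - approx1 N i x - s * approx2 N i j x|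
    <= s * (C2 * H * s `^ a).
Proof.
move=> nN s es; pose m' := (m * 2 ^ (N - n))%N.
have sE : s = m'%:R * h N by rewrite es (mesh_mono R nN) natrM mulrA.
rewrite [in X in X - s * _]sE -gstepMn.
have hN0 := lt0r_neq0 (hp N).
have e y : fdiff (gstep R N j) (approx1 N i) y = h N * approx2 N i j y.
  by rewrite /approx2; set G := fdiff (gstep R N i) (approx N); rewrite /approx1 -/G /fdiff; field.
have -> : s * approx2 N i j x = m'%:R * fdiff (gstep R N j) (approx1 N i) x.
  by rewrite e sE; ring.
have -> : s * (C2 * H * s `^ a) = m'%:R * (h N * (C2 * H * s `^ a)) by rewrite {1}sE; ring.
apply: fdiff_taylor => l lm.
rewrite !e -mulrBr normrM (gtr0_norm (hp N)) ler_wpM2l ?(ltW (hp N))//.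
have ll : lattice N (gstep R N j *+ l).
  move=> k; exists (l%:Z * (k == j)%:Z).
  by rewrite gstepMn !mxE eqxx /=; case: (k == j); rewrite ?mulr1 ?mulr0 ?mul0r.
rewrite (le_trans (approx2_holder i j x ll))// ler_wpM2l ?mulr_ge0//.
rewrite ge0_ler_powR ?nnegrE ?(ltW a0)//; first by rewrite sE mulr_ge0// ltW.
rewrite gstepMn norm_scale_evec ger0_norm ?mulr_ge0 ?(ltW (hp N))// sE ler_wpM2r ?(ltW (hp N))//.
by rewrite ler_nat ltnW.
Qed.

Lemma resolvent_exists : exists v : 'rV[R]_d -> R,
  [/\ C2per v, forall x, - lap v x + lam * v x = xi x,
    forall x, `|v x| <= M / lam,
    (forall i x, `|pd i v x| <= C1 * H) /\ (forall i j x, `|pd j (pd i v) x| <= C1 * H)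
    & forall i j x y, `|pd j (pd i v) x - pd j (pd i v) y| <= 2 * C2 * H * `|x - y| `^ a].
Proof.
have [U [UU Uoo]] := @ultraFilterLemma nat \oo _.
have PU : ProperFilter U by exact: ultra_proper.
have CH0 : 0 <= C2 * H by rewrite mulr_ge0.
have cle := @ultra_cvg_norm_le R U UU Uoo.
(* The limits of the functions and of their first and second quotients are taken pointwise and
   independently. They become related through the Taylor bounds [vt] and [pt], which survive the
   limit. *)
have [v vP] : {v : 'rV[R]_d -> R & forall x, approx n x @[n --> U] --> v x}.
  apply: (@choice _ _ (fun x l => approx n x @[n --> U] --> l)) => x.
  by apply: (ultra_bounded_cvg UU (M := M / lam)) => n; exact: approx_le.
have [p pP] : {p : 'I_d * 'rV[R]_d -> R & forall z, approx1 n z.1 z.2 @[n --> U] --> p z}.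
  apply: (@choice _ _ (fun z l => approx1 n z.1 z.2 @[n --> U] --> l)) => z.
  by apply: (ultra_bounded_cvg UU (M := C1 * H)) => n; exact: approx1_le.
have [w wP] : {w : 'I_d * 'I_d * 'rV[R]_d -> R &
     forall z, approx2 n z.1.1 z.1.2 z.2 @[n --> U] --> w z}.
  apply: (@choice _ _ (fun z l => approx2 n z.1.1 z.1.2 z.2 @[n --> U] --> l)) => z.
  by apply: (ultra_bounded_cvg UU (M := C1 * H)) => n; exact: approx2_le.
have vh x y : `|v x - v y| <= H / lam * `|x - y| `^ a.
  apply: (cle (fun n => approx n x - approx n y) _ _ 0%N) => //.
    exact: cvgB.
  by move=> n _; exact: approx_holder.
have vc : continuous v by apply: (holder_continuous a0 _ vh); rewrite divr_ge0// ltW.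
have vt i n m x : let s := m%:R * h n in 0 < s ->
   `|v (x + s *: evec R i) - v x - s * p (i, x)| <= s * (C1 * H * s `^ 1).
  move=> s s0; rewrite powRr1 ?(ltW s0)//.
  apply: (cle (fun N => approx N (x + s *: evec R i) - approx N x - s * approx1 N i x) _ _ n) => //.
    apply: cvgB; first exact: cvgB.
    by apply: cvgM; [exact: cvg_cst|exact: (pP (i, x))].
  by move=> N nN; exact: (approx_taylor i x nN).
(* The sign is read off a bound on [approx2], which needs an index; where it is used, a direction
   [i] is at hand. *)
have C1H0 : d != 0%N -> 0 <= C1 * H.
  rewrite -lt0n => d0; have i0 : 'I_d := Ordinal d0.
  by rewrite (le_trans _ (approx2_le 0 i0 i0 0)).
have vd i x : is_derive x (evec R i) v (p (i, x)).
  apply: (@dyadic_taylor_derive _ _ v (fun x => p (i, x)) (evec R i) (C1 * H) 1) => //.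
    by apply: C1H0; rewrite -lt0n (leq_ltn_trans _ (ltn_ord i)).
  by move=> n m y; exact: vt.
have pc i : continuous (fun x => p (i, x)).
  apply: (@dyadic_taylor_continuous _ _ v (fun x => p (i, x)) (evec R i) (C1 * H) 1) => //.
    by apply: C1H0; rewrite -lt0n (leq_ltn_trans _ (ltn_ord i)).
  by move=> n m y; exact: vt.
have pt i j n m x : let s := m%:R * h n in 0 < s ->
   `|p (i, x + s *: evec R j) - p (i, x) - s * w (i, j, x)| <= s * (C2 * H * s `^ a).
  move=> s s0; apply: (cle (fun N => approx1 N i (x + s *: evec R j) - approx1 N i x - s * approx2 N i j x) _ _ n) => //.
    apply: cvgB; first by apply: cvgB; [exact: (pP (i, _))|exact: (pP (i, x))].
    by apply: cvgM; [exact: cvg_cst|exact: (wP (i, j, x))].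
  by move=> N nN; exact: (approx1_taylor i j x nN).
have pdv i : pd i v = fun x => p (i, x) by apply/funext => x; exact: (@derive_val _ _ _ _ _ _ _ (vd i x)).
have pd' i j x : is_derive x (evec R j) (pd i v) (w (i, j, x)).
  rewrite pdv; apply: (@dyadic_taylor_derive _ _ (fun x => p (i, x)) (fun x => w (i, j, x)) (evec R j) (C2 * H) a) => //.
  by move=> n m y; exact: pt.
have wc i j : continuous (fun x => w (i, j, x)).
  apply: (@dyadic_taylor_continuous _ _ (fun x => p (i, x)) (fun x => w (i, j, x)) (evec R j) (C2 * H) a) => //.
  by move=> n m y; exact: pt.
have pdpd i j : pd j (pd i v) = fun x => w (i, j, x).
  by apply/funext => x; exact: (@derive_val _ _ _ _ _ _ _ (pd' i j x)).
exists v; split.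
- split; last first.
    move=> i x; apply/eqP; rewrite -subr_eq0 -normr_le0.
    apply: (cle (fun n => approx n (x + evec R i) - approx n x) _ _ 0%N).
      exact: cvgB.
    by move=> n _; rewrite approx_periodic subrr normr0.
  split=> //; split; first by move=> i x; case: (vd i x).
  split; first by move=> i; rewrite pdv.
  split; first by move=> i j x; case: (pd' i j x).
  by move=> i j; rewrite pdpd.
- move=> x; apply/eqP; rewrite -subr_eq0; apply/eqP.
  apply: (@ultra_cvg_norm_to0 _ U UU Uoo (fun n => lam * approx n x - \sum_(i < d) approx2 n i i x - xi x) defect).
  + have -> : - lap v x + lam * v x - xi x = lam * v x - \sum_(i < d) w (i, i, x) - xi x.
      have -> : lap v x = \sum_(i < d) w (i, i, x) by apply: eq_bigr => i _; rewrite pdpd.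
      by ring.
    apply: cvgB; last exact: cvg_cst.
    apply: cvgB; first by apply: cvgM => //; exact: cvg_cst.
    by apply: (@cvg_sum_seq _ U _ _ (fun i n => approx2 n i i x)) => i; exact: (wP (i, i, x)).
  + exact: defect_cvg0.
  + by move=> n; exact: approx_equation.
- by move=> x; apply: (cle _ _ _ 0%N (vP x)) => n _; exact: approx_le.
- split=> [i x|i j x].
    by rewrite pdv; apply: (cle _ _ _ 0%N (pP (i, x))) => n _; exact: approx1_le.
  by rewrite pdpd; apply: (cle _ _ _ 0%N (wP (i, j, x))) => n _; exact: approx2_le.
- move=> i j x y; rewrite pdpd -mulrA.
  have a1 : 0 < a <= 1 by case/andP: a01 => -> /ltW ->.
  rewrite mulrA -[2 * C2 * H]mulrA.
  apply: (@lattice_holder _ _ a (C2 * H) (fun x => w (i, j, x)) a1 CH0 (wc i j)).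
  move=> n r lr z.
  apply: (cle (fun N => approx2 N i j (z + r) - approx2 N i j z) _ _ n).
    by apply: cvgB; [exact: (wP (i, j, _))|exact: (wP (i, j, z))].
  by move=> N nN; apply: approx2_holder; exact: lattice_mono lr.
Qed.

End SchauderExistence.

(** * Calculus of periodic functions *)

Section ContinuousOps.
Variables (R : realType) (T : topologicalType).
Implicit Types p q : T -> R.

Lemma continuous_norm p : continuous p -> continuous (fun x => `|p x|).
Proof. by move=> cp x; apply: cvg_norm; exact: cp. Qed.

Lemma continuous_affine (c : R) p q : continuous p -> continuous q ->
  continuous (fun y => c * p y + q y).
Proof.
by move=> cp cq x; apply: cvgD; [apply: cvgM; [exact: cvg_cst|exact: cp]|exact: cq].
Qed.

End ContinuousOps.

Section PeriodicFunctions.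
Variables (R : realType) (d : nat).
Implicit Types (g : 'rV[R]_d -> R) (x y r : 'rV[R]_d).

Lemma periodic_int g x r : Defs.periodic g -> (forall i, exists m : int, r 0 i = m%:~R) ->
  g (x + r) = g x.
Proof.
move=> pg rz; apply/eqP; rewrite -subr_eq0 -normr_le0 -[leRHS](mulr0 d%:R).
apply: coord_telescope => i y; have [m ->] := rz i.
suff -> : g (y + m%:~R *: evec R i) = g y by rewrite subrr normr0.
have hn (k : nat) z : g (z + k%:R *: evec R i) = g z.
  elim: k z => [|k IH] z; first by rewrite scale0r addr0.
  by rewrite -natr1 scalerDl scale1r addrA pg IH.
case: m => k; first exact: hn.
by rewrite NegzE mulrNz scaleNr -[in RHS](subrK (k.+1%:R *: evec R i) y) hn.
Qed.

Definition unit_cube : set 'rV[R]_d := [set v | forall i, `[0, 1]%classic (v ord0 i)].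

Lemma compact_unit_cube : compact unit_cube.
Proof. exact: (rV_compact (fun=> @segment_compact R 0 1)). Qed.

Lemma periodic_reduce x : exists2 y, unit_cube y & forall g, Defs.periodic g -> g x = g y.
Proof.
pose r : 'rV[R]_d := \row_i (Num.floor (x 0 i))%:~R.
exists (x - r).
  move=> i /=; rewrite in_itv/= !mxE.
  have /andP[h1 h2] := floor_itv (x 0 i).
  by rewrite subr_ge0 h1/= lerBlDr addrC -intrD1 ltW.
move=> g pg; rewrite -[in LHS](subrK r x); apply: periodic_int => // i.
by exists (Num.floor (x 0 i)); rewrite mxE.
Qed.

Lemma periodic_max g : continuous g -> Defs.periodic g -> exists x0, forall x, g x <= g x0.
Proof.
move=> cg pg.
have u0 : unit_cube 0 by move=> i; rewrite /= mxE in_itv/= lexx ler01.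
have [c _ hc] := @EVT_max_rV R d g unit_cube (ex_intro _ _ u0) compact_unit_cube
  (continuous_subspaceT cg).
exists c => x; have [y yc ->] := periodic_reduce x => //.
by apply: hc; rewrite inE.
Qed.

Lemma periodic_bounded g : continuous g -> Defs.periodic g -> exists M, forall x, `|g x| <= M.
Proof.
move=> cg pg; have [x0 h] : exists x0, forall x, `|g x| <= `|g x0|.
  apply: (@periodic_max (fun x => `|g x|)).
    exact: continuous_norm.
  by move=> i x; rewrite pg.
by exists `|g x0|.
Qed.

End PeriodicFunctions.

Section Calculus.
Variables (R : realType) (d : nat).
Implicit Types (g h : 'rV[R]_d -> R) (x y r : 'rV[R]_d) (a c H K : R).

Lemma derivable_affine g h c x v : derivable g x v -> derivable h x v ->
  is_derive x v (fun y => c * g y + h y) (c * 'D_v g x + 'D_v h x).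
Proof.
move=> /derivableP dg /derivableP dh.
have : is_derive x v (c \*: g + h) (c *: 'D_v g x + 'D_v h x) by apply: is_deriveD.
by [].
Qed.

Lemma derivable_mul g h x v : derivable g x v -> derivable h x v ->
  is_derive x v (fun y => g y * h y) (g x * 'D_v h x + h x * 'D_v g x).
Proof.
move=> /derivableP dg /derivableP dh.
have : is_derive x v (g * h) (g x *: 'D_v h x + h x *: 'D_v g x) by apply: is_deriveM.
by [].
Qed.

Lemma pd_affine g h c i : (forall x, derivable g x (evec R i)) -> (forall x, derivable h x (evec R i)) ->
  pd i (fun y => c * g y + h y) = (fun y => c * pd i g y + pd i h y).
Proof.
move=> dg dh; apply/funext => x.
exact: (@derive_val _ _ _ _ _ _ _ (derivable_affine c (dg x) (dh x))).
Qed.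

Lemma C2_affine g h c : C2 g -> C2 h -> C2 (fun y => c * g y + h y).
Proof.
move=> [cg [dg [cdg [ddg cddg]]]] [ch [dh [cdh [ddh cddh]]]].
split; first exact: continuous_affine.
split; first by move=> i x; case: (derivable_affine c (dg i x) (dh i x)).
have e i := pd_affine c (dg i) (dh i).
split; first by move=> i; rewrite e; exact: continuous_affine.
split; first by move=> i j x; rewrite e; case: (derivable_affine c (ddg i j x) (ddh i j x)).
by move=> i j; rewrite e (pd_affine c (ddg i j) (ddh i j)); exact: continuous_affine.
Qed.

Lemma pd2_affine g h c i j : C2 g -> C2 h ->
  pd j (pd i (fun y => c * g y + h y)) = (fun y => c * pd j (pd i g) y + pd j (pd i h) y).
Proof.
move=> [_ [dg [_ [ddg _]]]] [_ [dh [_ [ddh _]]]].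
by rewrite (pd_affine c (dg i) (dh i)) (pd_affine c (ddg i j) (ddh i j)).
Qed.

Lemma pd1_affine g h c i : C2 g -> C2 h ->
  pd i (fun y => c * g y + h y) = (fun y => c * pd i g y + pd i h y).
Proof. by move=> [_ [dg _]] [_ [dh _]]; exact: pd_affine. Qed.

Lemma C2per_affine g h c : C2per g -> C2per h -> C2per (fun y => c * g y + h y).
Proof.
move=> [cg pg] [ch ph]; split; first exact: C2_affine.
by move=> i x; rewrite pg ph.
Qed.

Lemma pd_periodic g i : Defs.periodic g -> Defs.periodic (pd i g).
Proof.
move=> pg j x; rewrite /pd /derive.
have e : g \o shift (x + evec R j) = g \o shift x.
  by apply/funext => y /=; rewrite addrA pg.
by rewrite e pg.
Qed.

Lemma lap_affine g h c x : C2 g -> C2 h ->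
  lap (fun y => c * g y + h y) x = c * lap g x + lap h x.
Proof.
move=> cg ch; rewrite /lap mulr_sumr -big_split; apply: eq_bigr => i _.
by rewrite pd2_affine.
Qed.

Lemma div_mul_gradE g h x : C2 g -> C2 h ->
  div_mul_grad g h x = dot_grad g h x + g x * lap h x.
Proof.
move=> [_ [dg _]] [_ [dh [_ [ddh _]]]].
rewrite /div_mul_grad /dot_grad /lap mulr_sumr -big_split; apply: eq_bigr => i _.
rewrite [LHS](@derive_val _ _ _ _ _ _ _ (derivable_mul (dg i x) (ddh i i x))).
by rewrite addrC mulrC.
Qed.

Lemma dot_gradC g h x : dot_grad g h x = dot_grad h g x.
Proof. by apply: eq_bigr => i _; rewrite mulrC. Qed.

Lemma dot_grad_affine g h k c x : C2 h -> C2 k ->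
  dot_grad g (fun y => c * h y + k y) x = c * dot_grad g h x + dot_grad g k x.
Proof.
move=> ch ck; rewrite /dot_grad mulr_sumr -big_split; apply: eq_bigr => i _.
rewrite (pd1_affine c i ch ck) /=; ring.
Qed.

Lemma C2_mvt g x i (s t : R) : C2 g -> s <= t ->
  exists2 c : R, s <= c <= t & g (x + t *: evec R i) - g (x + s *: evec R i) = pd i g (x + c *: evec R i) * (t - s).
Proof.
move=> [_ [dg _]] st.
have dp (z : R) := is_derive_line (dg i (x + z *: evec R i)).
have cp : {within `[s, t], continuous (fun z : R => g (x + z *: evec R i))}.
  apply: continuous_subspaceT => z.
  by apply: differentiable_continuous; apply/derivable1_diffP; case: (dp z).
have [c cs ->] := MVT_segment st (fun z _ => dp z) cp.
by exists c => //; move: cs; rewrite in_itv.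
Qed.

(** If the second derivative D at the maximum were positive, the first derivative, zero there, would
    be at least s D / 2 at a small distance s along the axis, and [g] would increase. *)
Lemma max_pd2_le0 g x0 i : C2 g -> (forall x, g x <= g x0) -> pd i (pd i g) x0 <= 0.
Proof.
move=> cg2 gmax; have [cg [dg [cdg [ddg cddg]]]] := cg2.
rewrite leNgt; apply/negP => D0; set D := pd i (pd i g) x0 in D0.
have p0 : pd i g x0 = 0.
  have dp (z : R) := is_derive_line (dg i (x0 + z *: evec R i)).
  have : is_derive (0 : R) 1 (fun z : R => g (x0 + z *: evec R i)) 0.
    apply: (@derive1_at_max _ _ (-1) 1) => //.
    + by rewrite in_itv/= ltrN10 ltr01.
    + by move=> t _; rewrite scale0r addr0.
  move=> /(@derive_val _ _ _ _ _ _ _) <-.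
  by rewrite (@derive_val _ _ _ _ _ _ _ (dp 0)) scale0r addr0.
have /cvgrPdist_le /(_ (D / 2) (divr_gt0 D0 (ltr0Sn _ 1))) := cddg i i x0.
move=> /nbhs_ballP[e /= e0 he].
pose t := e / 2; have t0 : 0 < t by rewrite divr_gt0.
have te : t < e by rewrite /t; lra.
have pos s : 0 <= s <= t -> s * (D / 2) <= pd i g (x0 + s *: evec R i).
  move=> /andP[s0 st].
  have : `|pd i g (x0 + s *: evec R i) - pd i g x0 - s * D| <= D / 2 * `|s|.
    apply: line_taylor; first exact: ddg.
    move=> z zs; rewrite distrC; apply: he; rewrite -ball_normE /= opprD addNKr normrN norm_scale_evec.
    by rewrite (le_lt_trans zs)// ger0_norm// (le_lt_trans st).
  rewrite p0 subr0 (ger0_norm s0).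
  rewrite ler_norml => /andP[+ _]; lra.
(* The mean value point in the first half may be the endpoint 0, where the derivative vanishes;
   strict growth comes from the second half. *)
have t2 : t / 2 <= t by lra.
have [c1 /andP[c10 c11] e1] := @C2_mvt g x0 i 0 (t / 2) cg2 (divr_ge0 (ltW t0) (ltW (ltr0Sn _ 1))).
have [c2 /andP[c20 c21] e2] := @C2_mvt g x0 i (t / 2) t cg2 t2.
have h1 : 0 <= pd i g (x0 + c1 *: evec R i).
  by rewrite (le_trans _ (pos c1 _)) ?mulr_ge0 ?divr_ge0 ?(ltW D0)// c10/= (le_trans c11).
have h2 : 0 < pd i g (x0 + c2 *: evec R i).
  have c2p : 0 < c2 by rewrite (lt_le_trans _ c20)// divr_gt0.
  by rewrite (lt_le_trans _ (pos c2 _)) ?mulr_gt0 ?divr_gt0// (ltW c2p).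
have := gmax (x0 + t *: evec R i); apply/negP; rewrite -ltNge -subr_gt0.
rewrite scale0r addr0 in e1.
rewrite -(subrKA (g (x0 + (t / 2) *: evec R i))) e2 e1 subr0.
rewrite ltr_wpDr//; first by rewrite mulr_ge0// divr_ge0// ltW.
by rewrite mulr_gt0// subr_gt0; lra.
Qed.

(** Maximum principle: at a maximum point the Laplacian is nonpositive, and the equation bounds lam
    w by it. *)
Lemma elliptic_le0 (lam : R) w : 0 < lam -> C2per w -> (forall x, - lap w x + lam * w x = 0) ->
  forall x, w x <= 0.
Proof.
move=> lam0 [cw pw] ew x; have [x0 hx0] := periodic_max (proj1 cw) pw.
rewrite (le_trans (hx0 x))// -(pmulr_rle0 _ lam0).
have -> : lam * w x0 = lap w x0 by have := ew x0; lra.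
by rewrite /lap sumr_le0// => i _; exact: max_pd2_le0.
Qed.

Lemma elliptic_unique (lam : R) (xi v w : 'rV[R]_d -> R) : 0 < lam -> C2per v -> C2per w ->
  (forall x, - lap v x + lam * v x = xi x) -> (forall x, - lap w x + lam * w x = xi x) -> v = w.
Proof.
move=> lam0 cv cw ev ew.
suff h (p q : 'rV[R]_d -> R) : C2per p -> C2per q -> (forall x, - lap p x + lam * p x = xi x) ->
    (forall x, - lap q x + lam * q x = xi x) -> forall x, q x <= p x.
  by apply/funext => x; apply/eqP; rewrite eq_le !h.
move=> cp cq ep eq x; have c := C2per_affine (-1) cp cq.
have := elliptic_le0 lam0 c _ x; rewrite mulN1r addrC subr_le0; apply => y.
rewrite lap_affine; [|exact: (proj1 cp)|exact: (proj1 cq)].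
by move: (ep y) (eq y); move: (lap p y) (lap q y) (p y) (q y) (xi y) => *; lra.
Qed.

End Calculus.

(** * Hoelder bounds *)

Section HolderBounds.
Variables (R : realType) (d : nat) (a : R).
Hypothesis a01 : 0 < a < 1.
Let a0 : 0 < a. Proof. by case/andP: a01. Qed.
Let a1 : a < 1. Proof. by case/andP: a01. Qed.
Implicit Types (g h : 'rV[R]_d -> R) (x y r : 'rV[R]_d) (c H K A B : R).

(** Estimates run on explicit bounds, because [sup] returns a default value on unbounded sets. The
    norm [c2a_norm] is reached only at the end, through [c2a_norm_le] and [C2a_le_norm]. *)
Definition c0a_le g H :=
  (forall x, `|g x| <= H) /\ (forall x y, `|g x - g y| <= H * `|x - y| `^ a).

Definition c2a_le g H :=
  [/\ forall x, `|g x| <= H, forall i x, `|pd i g x| <= H,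
      forall i j x, `|pd j (pd i g) x| <= H &
      forall i j x y, `|pd j (pd i g) x - pd j (pd i g) y| <= H * `|x - y| `^ a].

Lemma c0a_le_ge0 g H : c0a_le g H -> 0 <= H.
Proof. by move=> [h _]; rewrite (le_trans _ (h 0)). Qed.

Lemma c2a_le_ge0 g H : c2a_le g H -> 0 <= H.
Proof. by move=> [h _ _ _]; rewrite (le_trans _ (h 0)). Qed.

Lemma c0a_le_mono g H K : H <= K -> c0a_le g H -> c0a_le g K.
Proof.
move=> HK [h1 h2]; split=> [x|x y]; first exact: le_trans HK.
by rewrite (le_trans (h2 x y))// ler_wpM2r// powR_ge0.
Qed.

Lemma c2a_le_mono g H K : H <= K -> c2a_le g H -> c2a_le g K.
Proof.
move=> HK [h1 h2 h3 h4]; split=> *; rewrite ?(le_trans _ HK)//.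
by rewrite (le_trans (h4 _ _ _ _))// ler_wpM2r ?powR_ge0.
Qed.

Lemma sub_affineE g h : (fun x => g x - h x) = (fun x => -1 * h x + g x).
Proof. by apply/funext => x; rewrite mulN1r addrC. Qed.

Lemma c0a_leD g h H K : c0a_le g H -> c0a_le h K -> c0a_le (fun x => g x + h x) (H + K).
Proof.
move=> [g1 g2] [h1 h2]; split=> [x|x y].
  by rewrite (le_trans (ler_normD _ _))// lerD.
rewrite opprD addrACA mulrDl (le_trans (ler_normD _ _))//; exact: lerD.
Qed.

Lemma c0a_leZ c g H : c0a_le g H -> c0a_le (fun x => c * g x) (`|c| * H).
Proof.
move=> [g1 g2]; split=> [x|x y]; first by rewrite normrM ler_wpM2l.
by rewrite -mulrBr normrM -mulrA ler_wpM2l.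
Qed.

Lemma c0a_leN g H : c0a_le g H -> c0a_le (fun x => - g x) H.
Proof.
move=> [g1 g2]; split=> [x|x y]; first by rewrite normrN.
by rewrite -opprD normrN.
Qed.

Lemma c0a_leB g h H K : c0a_le g H -> c0a_le h K -> c0a_le (fun x => g x - h x) (H + K).
Proof. by move=> gH hK; apply: c0a_leD => //; exact: c0a_leN. Qed.

Lemma c0a_leM g h H K : c0a_le g H -> c0a_le h K -> c0a_le (fun x => g x * h x) (2 * (H * K)).
Proof.
move=> gH hK; have H0 := c0a_le_ge0 gH; have K0 := c0a_le_ge0 hK.
move: gH hK => [g1 g2] [h1 h2]; split=> [x|x y].
  rewrite normrM (@le_trans _ _ (H * K))//; first exact: ler_pM.
  by rewrite ler_peMl ?mulr_ge0// ler1n.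
have -> : g x * h x - g y * h y = g x * (h x - h y) + (g x - g y) * h y by ring.
rewrite (le_trans (ler_normD _ _))// !normrM.
have -> : 2 * (H * K) * `|x - y| `^ a = H * (K * `|x - y| `^ a) + H * `|x - y| `^ a * K by ring.
by rewrite lerD// ler_pM.
Qed.

Lemma c0a_le_sum (I : Type) (s : seq I) (F : I -> 'rV[R]_d -> R) H :
  (forall i, c0a_le (F i) H) -> c0a_le (fun x => \sum_(i <- s) F i x) ((size s)%:R * H).
Proof.
move=> hF; elim: s => [|i s [IH1 IH2]].
  by split=> [x|x y]; rewrite !big_nil ?subrr normr0 mul0r ?mul0r.
have [F1 F2] := hF i.
split=> [x|x y]; rewrite !big_cons /= -(natr1 (size s)) mulrDl mul1r addrC.
  by rewrite [leRHS]addrC (le_trans (ler_normD _ _))// addrC lerD.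
rewrite addrC opprD addrACA mulrDl addrC (le_trans (ler_normD _ _))//; exact: lerD.
Qed.

Lemma c0a_le_sum_ord (F : 'I_d -> 'rV[R]_d -> R) H :
  (forall i, c0a_le (F i) H) -> c0a_le (fun x => \sum_(i < d) F i x) (d%:R * H).
Proof.
move=> hF; have := c0a_le_sum (index_enum 'I_d) hF.
by rewrite {2}[index_enum _]unlock -enumT size_enum_ord.
Qed.

(** At distance r <= 1 the Lipschitz bound suffices as r <= r^a; beyond, r^a >= 1 and the
    oscillation is at most 2 A. *)
Lemma c0a_le_lipschitz g A B : (forall x, `|g x| <= A) ->
  (forall x y, `|g x - g y| <= B * `|x - y|) -> 0 <= B -> c0a_le g (2 * A + B).
Proof.
move=> gA gB B0; have A0 : 0 <= A by rewrite (le_trans _ (gA 0)).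
split=> [x|x y]; first by rewrite (le_trans (gA x))//; lra.
case: (leP `|x - y| 1) => r1.
  rewrite (le_trans (gB x y))// ler_pM//; first by lra.
  by apply: powR_ge_id => //; rewrite r1 normr_ge0.
have p1 : 1 <= `|x - y| `^ a by rewrite powR_ge_one// ltW.
rewrite (@le_trans _ _ (2 * A))//.
  by rewrite (le_trans (ler_normB _ _))// mulr_natl mulr2n lerD.
rewrite (@le_trans _ _ (2 * A + B))//; first by lra.
by rewrite ler_peMr//; lra.
Qed.

Lemma c0a_le_interpolation g A B K : 0 < A -> 0 < B -> (forall x, `|g x| <= A) ->
  (forall x y, `|g x - g y| <= B * `|x - y|) -> A <= K -> 2 * (A `^ (1 - a) * B `^ a) <= K ->
  c0a_le g K.
Proof.
move=> A0 B0 gA gB AK iK; split=> [x|x y]; first exact: le_trans AK.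
have A2 : 0 < 2 * A by rewrite mulr_gt0.
have g2 : `|g x - g y| <= 2 * A.
  by rewrite (le_trans (ler_normB _ _))// mulr_natl mulr2n lerD.
rewrite (le_trans (powR_interpolation a01 A2 B0 (normr_ge0 _) g2 (gB x y)))//.
rewrite ler_wpM2r ?powR_ge0// (le_trans _ iK)// mulrA ler_wpM2r ?powR_ge0//.
by rewrite powRM ?(ltW A0)// ler_wpM2r ?powR_ge0// ler1_powR// ?ler1n//; have := a0; lra.
Qed.

(** A function with derivatives bounded by K has sup norm at most K and Lipschitz constant at most d
    K; [c0a_le_lipschitz] turns this into (2 + d) K. *)
Definition cdim : R := 2 + d%:R.

Lemma cdim_ge1 : 1 <= cdim.
Proof. by rewrite /cdim; have : 0 <= d%:R :> R by []; lra. Qed.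

Section C2aConsequences.
Variables (g : 'rV[R]_d -> R) (K : R).
Hypotheses (cg : C2 g) (gK : c2a_le g K).

Let K0 : 0 <= K := c2a_le_ge0 gK.
Let mono : K <= cdim * K. Proof. by rewrite ler_peMl// cdim_ge1. Qed.
Let dK : 0 <= d%:R * K. Proof. by rewrite mulr_ge0. Qed.

Lemma c2a_lipschitz0 x y : `|g x - g y| <= d%:R * K * `|x - y|.
Proof.
by apply: gradient_lipschitz => //; [exact: (proj1 (proj2 cg))|case: gK].
Qed.

Lemma c2a_lipschitz1 i x y : `|pd i g x - pd i g y| <= d%:R * K * `|x - y|.
Proof.
have [_ [_ [_ [ddg _]]]] := cg; have [_ _ h _] := gK.
by apply: gradient_lipschitz.
Qed.

Lemma c2a_c0a : c0a_le g (cdim * K).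
Proof.
have -> : cdim * K = 2 * K + d%:R * K by rewrite /cdim; ring.
by apply: c0a_le_lipschitz => //; [case: gK|exact: c2a_lipschitz0].
Qed.

Lemma c2a_c0a_pd i : c0a_le (pd i g) (cdim * K).
Proof.
have -> : cdim * K = 2 * K + d%:R * K by rewrite /cdim; ring.
by apply: c0a_le_lipschitz => //; [case: gK|exact: c2a_lipschitz1].
Qed.

Lemma c2a_c0a_pd2 i j : c0a_le (pd j (pd i g)) (cdim * K).
Proof. by apply: (c0a_le_mono mono); case: gK. Qed.

Lemma c2a_c0a_lap : c0a_le (lap g) (d%:R * (cdim * K)).
Proof. by apply: c0a_le_sum_ord => i; exact: c2a_c0a_pd2. Qed.

End C2aConsequences.

Lemma c0a_dot_grad g h K L : C2 g -> c2a_le g K -> C2 h -> c2a_le h L ->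
  c0a_le (dot_grad g h) (d%:R * (2 * (cdim * K * (cdim * L)))).
Proof.
move=> cg gK ch hL; apply: c0a_le_sum_ord => i.
by apply: c0a_leM; exact: c2a_c0a_pd.
Qed.

Lemma c0a_div_mul_grad g h K L : C2 g -> c2a_le g K -> C2 h -> c2a_le h L ->
  c0a_le (div_mul_grad g h) (4 * d%:R * (cdim * K * (cdim * L))).
Proof.
move=> cg gK ch hL.
have -> : div_mul_grad g h = fun x => dot_grad g h x + g x * lap h x.
  by apply/funext => x; exact: div_mul_gradE.
have -> : 4 * d%:R * (cdim * K * (cdim * L))
  = d%:R * (2 * (cdim * K * (cdim * L))) + 2 * (cdim * K * (d%:R * (cdim * L))) by ring.
apply: c0a_leD; first exact: c0a_dot_grad.
by apply: c0a_leM; [exact: c2a_c0a|exact: c2a_c0a_lap].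
Qed.

Lemma supnorm_le g H : (forall x, `|g x| <= H) -> supnorm g <= H.
Proof.
move=> gH; apply: ge_sup; first by exists `|g 0|, 0.
by move=> _ [x _ <-].
Qed.

Lemma le_supnorm g H x : (forall x, `|g x| <= H) -> `|g x| <= supnorm g.
Proof. by move=> gH; apply: ub_le_sup; [exists H => _ [y _ <-]|exists x]. Qed.

Lemma holder_semi_le g H : 0 <= H -> (forall x y, `|g x - g y| <= H * `|x - y| `^ a) ->
  holder_semi a g <= H.
Proof.
move=> H0 gH; rewrite /holder_semi; set E := [set _ | _].
have ubE : ubound E H.
  move=> _ [x [y [xy ->]]]; rewrite ler_pdivrMr; first exact: gH.
  by rewrite powR_gt0// normr_gt0 subr_eq0.
have [->|/set0P E0] := eqVneq E set0; first by rewrite sup0.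
exact: ge_sup.
Qed.

Lemma le_holder_semi g H x y : 0 <= H -> (forall x y, `|g x - g y| <= H * `|x - y| `^ a) ->
  `|g x - g y| <= holder_semi a g * `|x - y| `^ a.
Proof.
move=> H0 gH; have [->|xy] := eqVneq x y; first by rewrite !subrr !normr0 powR0 ?mulr0 ?gt_eqF.
have p0 : 0 < `|x - y| `^ a by rewrite powR_gt0// normr_gt0 subr_eq0.
rewrite -ler_pdivrMr//; apply: ub_le_sup; last by exists x, y.
exists H => _ [z [w [zw ->]]]; rewrite ler_pdivrMr; first exact: gH.
by rewrite powR_gt0// normr_gt0 subr_eq0.
Qed.

Lemma holder_semi_ge0 g : 0 <= holder_semi a g.
Proof.
rewrite /holder_semi; set E := [set _ | _].
case: (pselect (has_sup E)) => [[[r Er] ub]|nh]; last by rewrite sup_out.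
rewrite (@le_trans _ _ r)//; last exact: ub_le_sup.
by case: Er => x [y [_ ->]]; rewrite divr_ge0// powR_ge0.
Qed.

Lemma supnorm_ge0 g : 0 <= supnorm g.
Proof.
rewrite /supnorm; set E := [set _ | _ in _].
case: (pselect (has_sup E)) => [[[r Er] ub]|nh]; last by rewrite sup_out.
rewrite (@le_trans _ _ r)//; last exact: ub_le_sup.
by case: Er => x _ <-.
Qed.

(** Number of terms in [c2a_norm]: the function, d first derivatives, d^2 second derivatives and d^2
    Hoelder seminorms. *)
Definition cnorm : R := 1 + d%:R + 2 * d%:R ^+ 2.

Lemma c2a_norm_le g H : c2a_le g H -> c2a_norm a g <= cnorm * H.
Proof.
move=> gH; have H0 := c2a_le_ge0 gH; move: gH => [h1 h2 h3 h4].
have sumH (F : 'I_d -> R) B : (forall i, F i <= B) -> \sum_(i < d) F i <= d%:R * B.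
  move=> hF; rewrite (@le_trans _ _ (\sum_(i < d) B)) ?ler_sum//.
  by rewrite sumr_const card_ord mulr_natl.
have -> : cnorm * H = H + d%:R * H + d%:R * (d%:R * H) + d%:R * (d%:R * H) by rewrite /cnorm; ring.
rewrite /c2a_norm; apply: lerD; first apply: lerD; first apply: lerD.
- exact: supnorm_le.
- by apply: (sumH) => i; exact: supnorm_le.
- by apply: (sumH) => i; apply: (sumH) => j; exact: supnorm_le.
- by apply: (sumH) => i; apply: (sumH) => j; exact: holder_semi_le.
Qed.

Lemma c2a_norm_ge0 g : 0 <= c2a_norm a g.
Proof.
rewrite /c2a_norm !addr_ge0 ?supnorm_ge0//.
- by apply: sumr_ge0 => i _; exact: supnorm_ge0.
- by apply: sumr_ge0 => i _; apply: sumr_ge0 => j _; exact: supnorm_ge0.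
- by apply: sumr_ge0 => i _; apply: sumr_ge0 => j _; exact: holder_semi_ge0.
Qed.

Lemma C2a_bounded g : C2a a g -> exists K, c2a_le g K.
Proof.
move=> [[cg pg] hg]; have [c0 [_ [c1 [_ c2]]]] := cg.
have [K0 h0] := periodic_bounded c0 pg.
have /choice[K1 h1] i : exists K, forall x, `|pd i g x| <= K.
  by apply: periodic_bounded; [exact: c1|exact: pd_periodic].
have /choice[K2 h2] (ij : 'I_d * 'I_d) : exists K, forall x, `|pd ij.2 (pd ij.1 g) x| <= K.
  by apply: periodic_bounded; [exact: c2|do 2 apply: pd_periodic].
have /choice[K3 h3] (ij : 'I_d * 'I_d) := hg ij.1 ij.2.
pose B := `|K0| + \sum_i `|K1 i| + \sum_i `|K2 i| + \sum_i `|K3 i|.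
have S (I : finType) (F : I -> R) i : `|F i| <= \sum_i `|F i|.
  by rewrite (bigD1 i)//= lerDl sumr_ge0.
have s1 : 0 <= \sum_i `|K1 i| by apply: sumr_ge0.
have s2 : 0 <= \sum_i `|K2 i| by apply: sumr_ge0.
have s3 : 0 <= \sum_i `|K3 i| by apply: sumr_ge0.
have n0 := normr_ge0 K0.
exists B; split.
- move=> x; rewrite (le_trans (h0 x))// (le_trans (ler_norm _))// /B; lra.
- move=> i x; rewrite (le_trans (h1 i x))// (le_trans (ler_norm _))// (le_trans (S _ _ i))// /B; lra.
- move=> i j x; rewrite (le_trans (h2 (i, j) x))// (le_trans (ler_norm _))// (le_trans (S _ _ (i, j)))// /B; lra.
- move=> i j x y; have [->|xy] := eqVneq x y.
    by rewrite !subrr !normr0 powR0 ?mulr0 ?gt_eqF.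
  rewrite (le_trans (h3 (i, j) x y xy))// ler_wpM2r ?powR_ge0//.
  rewrite (le_trans (ler_norm _))// (le_trans (S _ _ (i, j)))// /B; lra.
Qed.

(** Periodicity and continuity make each supremum in [c2a_norm] that of a bounded set, hence a true
    upper bound. *)
Lemma C2a_le_norm g : C2a a g -> c2a_le g (c2a_norm a g).
Proof.
move=> cg; have [K gK] := C2a_bounded cg; have K0 := c2a_le_ge0 gK.
move: gK => [h1 h2 h3 h4].
have s0 := supnorm_ge0 g.
have s1 : 0 <= \sum_(i < d) supnorm (pd i g) by apply: sumr_ge0 => i _; exact: supnorm_ge0.
have s2 : 0 <= \sum_(i < d) \sum_(j < d) supnorm (pd j (pd i g)).
  by apply: sumr_ge0 => i _; apply: sumr_ge0 => j _; exact: supnorm_ge0.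
have s3 : 0 <= \sum_(i < d) \sum_(j < d) holder_semi a (pd j (pd i g)).
  by apply: sumr_ge0 => i _; apply: sumr_ge0 => j _; exact: holder_semi_ge0.
have S (F : 'I_d -> R) i : (forall i, 0 <= F i) -> F i <= \sum_i F i.
  by move=> F0; rewrite (bigD1 i)//= lerDl sumr_ge0.
have S2 (F : 'I_d -> 'I_d -> R) i j : (forall i j, 0 <= F i j) -> F i j <= \sum_i \sum_j F i j.
  move=> F0; rewrite (le_trans (S (F i) j _))//.
  by apply: (S (fun i => \sum_j F i j)) => k; exact: sumr_ge0.
rewrite /c2a_norm; split.
- move=> x; rewrite (le_trans (le_supnorm x h1))//; lra.
- move=> i x; have := S (fun i => supnorm (pd i g)) i (fun i => supnorm_ge0 _).
  have := le_supnorm x (h2 i); lra.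
- move=> i j x; have := S2 (fun i j => supnorm (pd j (pd i g))) i j (fun i j => supnorm_ge0 _).
  have := le_supnorm x (h3 i j); lra.
- move=> i j x y; rewrite (le_trans (le_holder_semi x y K0 (h4 i j)))// ler_wpM2r ?powR_ge0//.
  have := S2 (fun i j => holder_semi a (pd j (pd i g))) i j (fun i j => holder_semi_ge0 _); lra.
Qed.

Lemma C2a_affine g h c : C2a a g -> C2a a h -> C2a a (fun x => c * g x + h x).
Proof.
move=> [cg hg] [ch hh]; split; first exact: C2per_affine.
move=> i j; have [M1 h1] := hg i j; have [M2 h2] := hh i j.
exists (`|c| * M1 + M2) => x y xy; rewrite (pd2_affine c i j (proj1 cg) (proj1 ch)).
rewrite opprD addrACA -mulrBr (le_trans (ler_normD _ _))// normrM mulrDl -mulrA lerD ?h2//.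
by rewrite ler_wpM2l ?h1.
Qed.

Lemma c2a_le_affine g h c H K : C2 g -> C2 h -> c2a_le g H -> c2a_le h K ->
  c2a_le (fun x => c * g x + h x) (`|c| * H + K).
Proof.
move=> cg ch [g1 g2 g3 g4] [h1 h2 h3 h4].
have L (p q p' q' : R) : `|p| <= p' -> `|q| <= q' -> `|c * p + q| <= `|c| * p' + q'.
  by move=> pp qq; rewrite (le_trans (ler_normD _ _))// lerD// normrM ler_wpM2l.
split.
- by move=> x; exact: L.
- by move=> i x; rewrite (pd1_affine c i cg ch); exact: L.
- by move=> i j x; rewrite (pd2_affine c i j cg ch); exact: L.
- move=> i j x y; rewrite (pd2_affine c i j cg ch) opprD addrACA -mulrBr mulrDl -mulrA.
  exact: L.
Qed.

Lemma c2a_norm_affine g h c : C2a a g -> C2a a h ->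
  c2a_norm a (fun x => c * g x + h x) <= `|c| * c2a_norm a g + c2a_norm a h.
Proof.
move=> Cg Ch; have [K gK] := C2a_bounded Cg; have [L hL] := C2a_bounded Ch.
have K0 := c2a_le_ge0 gK; have L0 := c2a_le_ge0 hL.
have cg := proj1 (proj1 Cg); have ch := proj1 (proj1 Ch).
move: gK hL => [g1 g2 g3 g4] [h1 h2 h3 h4].
have B (p q : 'rV[R]_d -> R) M N : (forall x, `|p x| <= M) -> (forall x, `|q x| <= N) ->
    supnorm (fun x => c * p x + q x) <= `|c| * supnorm p + supnorm q.
  move=> pM qN; apply: supnorm_le => x; rewrite (le_trans (ler_normD _ _))// normrM.
  by rewrite lerD ?(le_supnorm x qN)// ler_wpM2l// (le_supnorm x pM).
have B2 (p q : 'rV[R]_d -> R) : (forall x y, `|p x - p y| <= K * `|x - y| `^ a) ->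
    (forall x y, `|q x - q y| <= L * `|x - y| `^ a) ->
    holder_semi a (fun x => c * p x + q x) <= `|c| * holder_semi a p + holder_semi a q.
  move=> pM qN; apply: holder_semi_le => [|x y].
    by rewrite addr_ge0 ?mulr_ge0 ?holder_semi_ge0.
  rewrite opprD addrACA -mulrBr mulrDl -mulrA (le_trans (ler_normD _ _))// normrM.
  by rewrite lerD ?(le_holder_semi x y L0 qN)// ler_wpM2l// (le_holder_semi x y K0 pM).
have add4 (k x1 x2 x3 x4 y1 y2 y3 y4 : R) : k * (x1 + x2 + x3 + x4) + (y1 + y2 + y3 + y4)
  = (k * x1 + y1) + (k * x2 + y2) + (k * x3 + y3) + (k * x4 + y4) by ring.
rewrite /c2a_norm add4; apply: lerD; first apply: lerD; first apply: lerD.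
- exact: (B _ _ K L).
- rewrite mulr_sumr -big_split; apply: ler_sum => i _.
  rewrite (pd1_affine c i cg ch); exact: (B _ _ K L).
- rewrite mulr_sumr -big_split; apply: ler_sum => i _; rewrite mulr_sumr -big_split.
  apply: ler_sum => j _; rewrite (pd2_affine c i j cg ch); exact: (B _ _ K L).
- rewrite mulr_sumr -big_split; apply: ler_sum => i _; rewrite mulr_sumr -big_split.
  apply: ler_sum => j _; rewrite (pd2_affine c i j cg ch); exact: B2.
Qed.

Lemma C2a_of_le g H : C2per g -> c2a_le g H -> C2a a g.
Proof. by move=> cg [_ _ _ gH]; split=> // i j; exists H => x y _; exact: gH. Qed.

Lemma C2a0 : C2a a (fun _ : 'rV[R]_d => 0).
Proof.
have e i : pd i (fun _ : 'rV[R]_d => 0) = (fun _ : 'rV[R]_d => 0).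
  by apply/funext => x; exact: derive_cst.
have c0 : continuous (fun _ : 'rV[R]_d => 0 : R) by exact: cst_continuous.
have d0 i x : derivable (fun _ : 'rV[R]_d => 0 : R) x (evec R i) by exact: derivable_cst.
split; last by move=> i j; exists 0 => x y _; rewrite !e subrr normr0 mul0r.
split; last by [].
split; [exact: c0|split; [by move=> i x; exact: d0|split=> [i|]]]; first by rewrite e.
by split=> [i j x|i j]; rewrite !e; [exact: d0|exact: c0].
Qed.

End HolderBounds.

(** * Riesz theory of compact perturbations of the identity *)

Section RieszSchauder.
Variables (R : realType) (V : lmodType R) (P : V -> Prop) (N : V -> R) (K : V -> V) (B : R).
Implicit Types (c e : R) (x y z w v : V).
Hypothesis P0 : P 0.
Hypothesis Paff : forall c x y, P x -> P y -> P (c *: x + y).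
Hypothesis N_ge0 : forall x, 0 <= N x.
Hypothesis N0 : N 0 = 0.
Hypothesis Naff : forall c x y, P x -> P y -> N (c *: x + y) <= `|c| * N x + N y.
Hypothesis N_eq0 : forall x, P x -> N x = 0 -> x = 0.
Hypothesis PK : forall x, P x -> P (K x).
Hypothesis Kaff : forall c x y, P x -> P y -> K (c *: x + y) = c *: K x + K y.
Hypothesis KB : forall x, P x -> N (K x) <= B * N x.
Hypothesis Kcompact : forall u : nat -> V, (forall n, P (u n)) -> (forall n, N (u n) <= 1) ->
  exists2 y, P y & forall e, 0 < e -> forall n0, exists2 n, (n0 <= n)%N & N (K (u n) - y) <= e.
Hypothesis Kinj : forall x, P x -> x = K x -> x = 0.

Let PD x y : P x -> P y -> P (x + y).
Proof. by move=> px py; have := Paff 1 px py; rewrite scale1r. Qed.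
Let PZ c x : P x -> P (c *: x).
Proof. by move=> px; have := Paff c px P0; rewrite addr0. Qed.
Let PB x y : P x -> P y -> P (x - y).
Proof. by move=> px py; rewrite -scaleN1r addrC; exact: Paff. Qed.
Let ND x y : P x -> P y -> N (x + y) <= N x + N y.
Proof. by move=> px py; have := Naff 1 px py; rewrite scale1r normr1 mul1r. Qed.
Let NZ c x : P x -> N (c *: x) = `|c| * N x.
Proof.
have le k z : P z -> N (k *: z) <= `|k| * N z.
  by move=> pz; have := Naff k pz P0; rewrite addr0 N0 addr0.
move=> px; apply/eqP; rewrite eq_le le//=.
have [->|c0] := eqVneq c 0; first by rewrite normr0 mul0r.
have := le c^-1 _ (PZ c px); rewrite scalerA mulVf// scale1r normfV.
by rewrite ler_pdivlMl ?normr_gt0.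
Qed.
Let NB x y : P x -> P y -> N (x - y) <= N x + N y.
Proof.
by move=> px py; rewrite addrC -scaleN1r (le_trans (Naff _ py px))// normrN1 mul1r addrC.
Qed.
Let NC x y : P x -> P y -> N (x - y) = N (y - x).
Proof.
move=> px py; have -> : x - y = (-1) *: (y - x) by rewrite scaleN1r opprB.
by rewrite NZ ?normrN1 ?mul1r//; exact: PB.
Qed.

Let A x := x - K x.

Let PA x : P x -> P (A x). Proof. by move=> px; apply: PB => //; exact: PK. Qed.
Let Aaff c x y : P x -> P y -> A (c *: x + y) = c *: A x + A y.
Proof.
by move=> px py; rewrite /A Kaff// scalerBr opprD addrACA.
Qed.
Let AB x y : P x -> P y -> A (x - y) = A x - A y.
Proof.
move=> px py; rewrite addrC -scaleN1r Aaff// scaleN1r addrC; by [].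
Qed.
Let AZ c x : P x -> A (c *: x) = c *: A x.
Proof.
move=> px; have A0 : A 0 = 0.
  by have := AB P0 P0; rewrite !subrr.
by have := Aaff c px P0; rewrite A0 !addr0.
Qed.
Let NA x : P x -> N (A x) <= (1 + B) * N x.
Proof.
move=> px; rewrite (le_trans (NB px (PK px)))// mulrDl mul1r lerD2l; exact: KB.
Qed.
Let Aker x : P x -> A x = 0 -> x = 0.
Proof. by move=> px /subr0_eq; exact: Kinj. Qed.

Let B0 : 0 <= 1 + `|B|. Proof. by rewrite addr_ge0. Qed.
Let NA' x : P x -> N (A x) <= (1 + `|B|) * N x.
Proof. by move=> px; rewrite (le_trans (NA px))// ler_wpM2r// lerD2l ler_norm. Qed.

Let small x : P x -> (forall e, 0 < e -> N x <= e) -> x = 0.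
Proof.
move=> px h; apply: N_eq0 => //; apply/eqP; rewrite eq_le N_ge0 andbT.
by apply/ler_addgt0Pr => e e0; rewrite add0r; exact: h.
Qed.

(** Compactness supplies the limit point: u n is A (u n) plus K (u n), the first part tends to [w],
    and the second clusters after rescaling by [b] to the unit ball. The cluster point solves A x =
    w by continuity of A. *)
Lemma fredholm_cluster (u : nat -> V) w (b : R) : (forall n, P (u n)) -> P w -> 0 < b ->
  (forall n, N (u n) <= b) -> (forall n, N (A (u n) - w) <= n.+1%:R^-1) ->
  exists x, [/\ P x, A x = w & forall e, 0 < e -> exists n, N (u n - x) <= e].
Proof.
move=> pu pw b0 ub uw.
have b1 n : N (b^-1 *: u n) <= 1.
  by rewrite NZ// normfV (gtr0_norm b0) ler_pdivrMl// mulr1.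
have [y py hy] := Kcompact (fun n => PZ b^-1 (pu n)) b1.
pose x := w + b *: y; have px : P x by apply: PD => //; exact: PZ.
have cl e n0 : 0 < e -> exists2 n, (n0 <= n)%N & N (u n - x) <= e.
  move=> e0; have eb : 0 < e / 2 / b by rewrite !divr_gt0.
  have [n1 _ hn1] := near_infty_natSinv_lt (PosNum (divr_gt0 e0 (ltr0Sn R 1))).
  have [n nn hn] := hy _ eb (maxn n0 n1).
  exists n; first by rewrite (leq_trans _ nn)// leq_maxl.
  have eK : K (b^-1 *: u n) = b^-1 *: K (u n).
    have K0 : K 0 = 0.
      have := Kaff 1 P0 P0; rewrite scaler0 scale1r addr0 => K00.
      by apply: (addrI (K 0)); rewrite -K00 addr0.
    by have := Kaff b^-1 (pu n) P0; rewrite K0 !addr0.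

  rewrite eK in hn.
  have e2 : u n - x = (A (u n) - w) + b *: (b^-1 *: K (u n) - y).
    rewrite scalerBr scalerA mulfV ?gt_eqF// scale1r /A /x opprD.
    by rewrite addrA [u n - K (u n) - w]addrAC subrKA.
  have pk : P (b^-1 *: K (u n) - y) by apply: PB => //; apply: PZ; exact: PK.
  have pa : P (A (u n) - w) by apply: PB => //; exact: PA.
  rewrite e2 (le_trans (ND pa (PZ b pk)))// NZ// (gtr0_norm b0).
  rewrite [e]splitr lerD//; last by rewrite -ler_pdivlMl// mulrC.
  rewrite (le_trans (uw n))// ltW//; have := hn1 n; apply.
  by rewrite /= (leq_trans _ nn)// leq_maxr.
exists x; split => //; last by move=> e e0; have [n _ h] := cl e 0%N e0; exists n.
apply/eqP; rewrite -subr_eq0; apply/eqP; apply: small; first by apply: PB => //; exact: PA.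
move=> e e0; have B1 : 0 < 1 + `|B| by rewrite ltr_wpDr.
have [n1 _ hn1] := near_infty_natSinv_lt (PosNum (divr_gt0 e0 (ltr0Sn R 1))).
have [n nn hn] := cl (e / 2 / (1 + `|B|)) n1 (divr_gt0 (divr_gt0 e0 (ltr0Sn R 1)) B1).
have -> : A x - w = (A (u n) - w) - A (u n - x).
  by rewrite AB// opprB [RHS]addrC subrKA.
have pu' : P (u n - x) by exact: PB.
rewrite (le_trans (NB _ (PA pu')))//; first by apply: PB => //; exact: PA.
rewrite [e]splitr lerD//.
  by rewrite (le_trans (uw n))// ltW//; exact: hn1.
by rewrite (le_trans (NA' pu'))// -ler_pdivlMl// mulrC.
Qed.

(** Otherwise unit vectors with A (u n) tending to 0 would cluster at an element of the kernel, that
    is at 0. *)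
Lemma fredholm_bounded_below : exists2 c, 0 < c & forall x, P x -> N x <= c * N (A x).
Proof.
apply: contrapT => nc.
have /choice[u hu] n : exists x, [/\ P x, N x = 1 & N (A x) <= n.+1%:R^-1].
  apply: contrapT => nx; apply: nc; exists n.+1%:R => // x px.
  rewrite leNgt; apply/negP => lt; apply: nx.
  have nx0 : 0 < N x by rewrite (le_lt_trans _ lt)// mulr_ge0.
  exists ((N x)^-1 *: x); split; first exact: PZ.
    by rewrite NZ// normfV (gtr0_norm nx0) mulVf// gt_eqF.
  rewrite AZ// NZ ?normfV ?(gtr0_norm nx0); last exact: PA.
  by rewrite ler_pdivrMl// ler_pdivlMr// mulrC ltW.
have pu n : P (u n) by case: (hu n).
have u1 n : N (u n) <= 1 by case: (hu n) => _ ->.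
have ua n : N (A (u n) - 0) <= n.+1%:R^-1 by rewrite subr0; case: (hu n).
have [x [px /(Aker px) x0 hx]] := fredholm_cluster pu P0 ltr01 u1 ua.
have [n] := hx 2^-1 ltac:(by []).
by rewrite x0 subr0; case: (hu n) => _ -> _; rewrite leNgt invf_lt1// ltr1n.
Qed.

Let rng n w := exists2 x, P x & w = iter n A x.

Let PiterA n x : P x -> P (iter n A x).
Proof. by move=> px; elim: n => //= n IH; exact: PA. Qed.

Let iterAaff n c x y : P x -> P y -> iter n A (c *: x + y) = c *: iter n A x + iter n A y.
Proof.
move=> px py; elim: n => //= n ->; rewrite Aaff//; exact: PiterA.
Qed.

Let rng_aff n c v w : rng n v -> rng n w -> rng n (c *: v + w).
Proof.
move=> [x px ->] [y py ->]; exists (c *: x + y); first exact: Paff.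
by rewrite iterAaff.
Qed.

Let rngP n w : rng n w -> P w.
Proof. by move=> [x px ->]; exact: PiterA. Qed.

Let rng_leq n m w : (n <= m)%N -> rng m w -> rng n w.
Proof.
move=> nm [x px ->]; exists (iter (m - n) A x); first exact: PiterA.
by rewrite -iterD subnKC.
Qed.

Let rngA n w : rng n w -> rng n.+1 (A w).
Proof. by move=> [x px ->]; exists x. Qed.

(** Induction on n: approximations A (u k) of [w] have bounded preimages by
    [fredholm_bounded_below]; a cluster point of the preimages lies in the previous range, which is
    closed. *)
Let rng_closed n w : P w -> (forall e, 0 < e -> exists2 v, rng n v & N (w - v) <= e) -> rng n w.
Proof.
have [c c0 hc] := fredholm_bounded_below.
elim: n w => [|n IH] w pw hw; first by exists w.
have /choice[u hu] k : exists v, rng n v /\ N (A v - w) <= k.+1%:R^-1.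
  have [_ [x px ->] h] := hw _ (ltac:(by rewrite invr_gt0) : 0 < k.+1%:R^-1 :> R).
  exists (iter n A x); split; first by exists x.
  by rewrite NC//; exact: (PiterA n.+1 px).
have pu k : P (u k) by apply: (@rngP n); case: (hu k).
have b0 : 0 < c * (N w + 1) by rewrite mulr_gt0// ltr_wpDl.
have ub k : N (u k) <= c * (N w + 1).
  rewrite (le_trans (hc _ (pu k)))// ler_wpM2l ?(ltW c0)//.
  have -> : A (u k) = w + (A (u k) - w) by rewrite subrKC.
  have pa : P (A (u k) - w) by apply: PB => //; exact: PA.
  rewrite (le_trans (ND pw pa))// lerD2l; have [_ h] := hu k.
  by rewrite (le_trans h)// invf_le1// ler1n.
have [x [px Axw hx]] := fredholm_cluster pu pw b0 ub (fun k => (hu k).2).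
rewrite -Axw; apply: rngA; apply: IH => // e e0; have [k hk] := hx e e0.
exists (u k); first by case: (hu k).
by rewrite NC.
Qed.

Lemma fredholm_surjective y : P y -> exists2 x, P x & A x = y.
Proof.
move=> py; apply: contrapT => ny.
have [c c0 hc] := fredholm_bounded_below.
have Ainj v w : P v -> P w -> A v = A w -> v = w.
  move=> pv pw e; apply/eqP; rewrite -subr_eq0; apply/eqP; apply: Aker; first exact: PB.
  by rewrite AB// e subrr.
have iterinj n v w : P v -> P w -> iter n A v = iter n A w -> v = w.
  elim: n => //= n IH pv pw /Ainj h; apply: IH => //; apply: h; exact: PiterA.
(* Riesz's lemma: almost orthogonal unit vectors along the strictly decreasing chain of ranges *)
have /choice[w hw] n : exists w, [/\ rng n w, N w <= 1 & forall v, rng n.+1 v -> 2^-1 <= N (w - v)].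
  pose z := iter n A y; have pz : P z by exact: PiterA.
  (* A^n y = A^(n+1) x would give y = A x by injectivity of A^n. *)
  have nz : ~ rng n.+1 z.
    move=> [x px]; rewrite iterSr => e; apply: ny; exists x => //.
    by apply/esym/(iterinj n) => //; exact: PA.
  pose E := [set N (z - v) | v in rng n.+1].
  have r0 : rng n.+1 0.
    exists 0 => //; elim: (n.+1) => //= k <-.
    by have := AB P0 P0; rewrite !subrr.
  have E0 : E !=set0 by exists (N (z - 0)), 0.
  have lbE : has_lbound E by exists 0 => _ [v _ <-].
  (* Closedness of the range makes the distance from [z] positive; a point within twice that
     distance then yields the constant 1/2 after normalization. *)
  have dpos : 0 < inf E.
    rewrite lt_neqAle; apply/andP; split; last by apply: lb_le_inf => // _ [v _ <-].
    apply/eqP => i0; apply: nz; apply: rng_closed => // e e0.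
    have [_ [v rv <-] lt] : exists2 r, E r & r < e by have := inf_adherent e0 (conj E0 lbE); rewrite -i0 add0r.
    by exists v => //; exact: ltW.
  have [_ [v0 rv0 <-] lt] : exists2 r, E r & r < 2 * inf E.
    by have := inf_adherent dpos (conj E0 lbE); rewrite mulr_natl mulr2n.
  have pv0 := rngP rv0; set k := N (z - v0) in lt.
  have k0 : 0 < k by rewrite (lt_le_trans dpos)//; apply: ge_inf => //; exists v0.
  have rz : rng n z by exists y.
  exists (k^-1 *: (z - v0)); split.
  - rewrite scalerBr -scaleNr addrC; apply: rng_aff; first exact: rng_leq (leqnSn n) rv0.
    have r0' := rng_leq (leqnSn n) r0.
    by have := rng_aff k^-1 rz r0'; rewrite addr0.
  - by rewrite NZ ?normfV ?(gtr0_norm k0) ?mulVf ?gt_eqF//; exact: PB.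
  - move=> v rv; have pv := rngP rv.
    have -> : k^-1 *: (z - v0) - v = k^-1 *: (z - (k *: v + v0)).
      by rewrite !scalerBr scalerDr scalerA mulVf ?gt_eqF// scale1r opprD addrA addrAC.
    rewrite NZ; last by apply: PB => //; exact: Paff.
    rewrite normfV (gtr0_norm k0) ler_pdivlMl//.
    rewrite (@le_trans _ _ (inf E))//; last by apply: ge_inf => //; exists (k *: v + v0) => //; exact: rng_aff.
    by rewrite ler_pdivrMr// mulrC ltW.
have pw n : P (w n) by have [/rngP] := hw n.
have w1 n : N (w n) <= 1 by case: (hw n).
have [p pp hp] := Kcompact pw w1.
(* Two images within 1/5 of the cluster point are within 2/5 of each other, below the separation
   1/2. *)
have e5 : 0 < 5^-1 :> R by rewrite invr_gt0.
have [n1 _ h1] := hp _ e5 0%N; have [n2 n12 h2] := hp _ e5 n1.+1.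
have [_ _ far] := hw n1.
(* With this vector v, K (w n1) - K (w n2) equals w n1 - v, to which the separation [far]
   applies. *)
have rv : rng n1.+1 (A (w n1) + w n2 - A (w n2)).
  have r1 : rng n1.+1 (A (w n1)) by apply: rngA; case: (hw n1).
  have r2 : rng n1.+1 (w n2) by apply: (rng_leq n12); case: (hw n2).
  have r3 : rng n1.+1 (A (w n2)).
    by apply: (rng_leq (leqW n12)); apply: rngA; case: (hw n2).
  rewrite addrC -scaleN1r; apply: rng_aff => //.
  by have := rng_aff 1 r1 r2; rewrite scale1r.
have := far _ rv.
have -> : w n1 - (A (w n1) + w n2 - A (w n2)) = (K (w n1) - p) - (K (w n2) - p).
  rewrite -[A _ + _ - _]addrA [w n2 - A (w n2)]subKr opprD addrA [w n1 - A (w n1)]subKr.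
  by rewrite [in RHS]opprB subrKA.
have p1 : P (K (w n1) - p) by apply: PB => //; exact: PK.
have p2 : P (K (w n2) - p) by apply: PB => //; exact: PK.
have := NB p1 p2; lra.
Qed.

End RieszSchauder.

(** * The linearized system *)

Section SolutionOperator.
Variables (R : realType) (d : nat) (lam a : R).
Hypotheses (lam0 : 0 < lam) (a01 : 0 < a < 1).
Implicit Types (g h v w xi : 'rV[R]_d -> R) (K : R).

Definition Tsol_cst : R :=
  lam^-1 + schauder_cst lam a + 4 * schauder_holder_cst a (d%:R : R).

Let S0 : 0 <= schauder_cst lam a.
Proof. by have /andP[? ?] := a01; rewrite /schauder_cst !addr_ge0// divr_ge0// ltW. Qed.

Let S1 : 0 <= schauder_holder_cst a (d%:R : R).
Proof.
have /andP[? ?] := a01.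
by rewrite /schauder_holder_cst !addr_ge0// divr_ge0 ?mulr_ge0// ?subr_ge0 ltW.
Qed.

Lemma Tsol_cst_ge0 : 0 <= Tsol_cst.
Proof. by rewrite /Tsol_cst addr_ge0 ?mulr_ge0// addr_ge0// invr_ge0 ltW. Qed.

(** The lattice limit is one solution; by uniqueness it is the one selected by [xget], which thus
    inherits the Schauder bounds. *)
Lemma Tsol_spec xi K : Defs.periodic xi -> c0a_le a xi K ->
  [/\ C2a a (Tsol lam xi), forall x, - lap (Tsol lam xi) x + lam * Tsol lam xi x = xi x
    & c2a_le a (Tsol lam xi) (Tsol_cst * K)].
Proof.
move=> pxi xiK; have K0 := c0a_le_ge0 xiK; have [xi1 xi2] := xiK.
have [v [cv ev b0 [b1 b2] b3]] := resolvent_exists lam0 a01 pxi xi1 K0 xi2.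
have [cT eT] : [set v | C2per v /\ forall x, - lap v x + lam * v x = xi x] (Tsol lam xi).
  by apply: xgetPex; exists v.
have -> : Tsol lam xi = v := elliptic_unique lam0 cT cv eT ev.
have le1 : lam^-1 * K <= Tsol_cst * K.
  by rewrite ler_wpM2r// /Tsol_cst -addrA lerDl addr_ge0// mulr_ge0.
have le2 : schauder_cst lam a * K <= Tsol_cst * K.
  by rewrite ler_wpM2r// /Tsol_cst addrAC lerDr addr_ge0 ?mulr_ge0// invr_ge0 ltW.
have le3 : 2 * (2 * schauder_holder_cst a (d%:R : R)) * K <= Tsol_cst * K.
  by rewrite ler_wpM2r// mulrA -natrM lerDr addr_ge0// invr_ge0 ltW.
have vK : c2a_le a v (Tsol_cst * K).
  split=> [x|i x|i j x|i j x y].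
  - by rewrite (le_trans (b0 x))// mulrC.
  - by rewrite (le_trans (b1 i x)).
  - by rewrite (le_trans (b2 i j x)).
  - by rewrite (le_trans (b3 i j x y))// ler_wpM2r// powR_ge0.
by split=> //; exact: C2a_of_le vK.
Qed.

Lemma Tsol_eq xi v : C2per v -> (forall x, - lap v x + lam * v x = xi x) -> Tsol lam xi = v.
Proof.
move=> cv ev.
have [cT eT] : [set v | C2per v /\ forall x, - lap v x + lam * v x = xi x] (Tsol lam xi).
  by apply: xgetPex; exists v.
exact: elliptic_unique lam0 cT cv eT ev.
Qed.

Lemma Tsol_affine c xi eta K L : Defs.periodic xi -> c0a_le a xi K ->
  Defs.periodic eta -> c0a_le a eta L ->
  Tsol lam (fun x => c * xi x + eta x) = (fun x => c * Tsol lam xi x + Tsol lam eta x).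
Proof.
move=> p1 b1 p2 b2; have [[c1 _] e1 _] := Tsol_spec p1 b1; have [[c2 _] e2 _] := Tsol_spec p2 b2.
apply: Tsol_eq; first exact: C2per_affine.
move=> x; rewrite (lap_affine c x (proj1 c1) (proj1 c2)) -(e1 x) -(e2 x).
by move: (lap (Tsol lam xi) x) (lap (Tsol lam eta) x) (Tsol lam xi x) (Tsol lam eta x) => *; ring.
Qed.

End SolutionOperator.

Section PeriodicClosure.
Variables (R : realType) (d : nat).
Implicit Types (g h : 'rV[R]_d -> R).

Lemma periodic_op2 (op : R -> R -> R) g h : Defs.periodic g -> Defs.periodic h ->
  Defs.periodic (fun x => op (g x) (h x)).
Proof. by move=> pg ph i x; rewrite pg ph. Qed.

Lemma periodic_sum (F : 'I_d -> 'rV[R]_d -> R) : (forall i, Defs.periodic (F i)) ->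
  Defs.periodic (fun x => \sum_(i < d) F i x).
Proof. by move=> pF j x; apply: eq_bigr => i _; rewrite pF. Qed.

Lemma lap_periodic g : Defs.periodic g -> Defs.periodic (lap g).
Proof. by move=> pg; apply: periodic_sum => i; do 2 apply: pd_periodic. Qed.

Lemma dot_grad_periodic g h : Defs.periodic g -> Defs.periodic h -> Defs.periodic (dot_grad g h).
Proof.
move=> pg ph; apply: periodic_sum => i.
by apply: (periodic_op2 *%R); exact: pd_periodic.
Qed.

Lemma div_mul_grad_periodic g h : Defs.periodic g -> Defs.periodic h ->
  Defs.periodic (div_mul_grad g h).
Proof.
move=> pg ph; apply: periodic_sum => i; apply: pd_periodic.
by apply: (periodic_op2 *%R) => //; exact: pd_periodic.
Qed.

End PeriodicClosure.

(** * Arzela-Ascoli in Hoelder norms along an ultrafilter *)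

Section UltraAscoli.
Variables (R : realType) (d : nat) (a : R) (U : set_system nat).
Hypotheses (a01 : 0 < a < 1) (UU : UltraFilter U) (Uoo : \oo `<=` U).
Let PU : ProperFilter U. Proof. exact: ultra_proper. Qed.
Local Existing Instance PU.

(** The sup bound enters with a positive power 1 - a, so a small [A] outweighs any fixed Lipschitz
    bound [B]; the summand 1 in the denominator keeps it positive when B^a vanishes. *)
Lemma small_interpolation (B e : R) : 0 < e ->
  exists2 A, 0 < A & A <= e /\ 2 * (A `^ (1 - a) * B `^ a) <= e.
Proof.
move=> e0; have /andP[a0 a1] := a01.
have b0 : 0 <= B `^ a by exact: powR_ge0.
have b1 : 0 < 2 * B `^ a + 1 by rewrite ltr_wpDl// mulr_ge0.
pose t := (e / (2 * B `^ a + 1)) `^ (1 - a)^-1.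
have t0 : 0 < t by rewrite powR_gt0// divr_gt0.
exists (Num.min e t); first by rewrite lt_min e0.
split; first by rewrite ge_min lexx.
have m0 : 0 <= Num.min e t by rewrite le_min !ltW.
have ta : t `^ (1 - a) = e / (2 * B `^ a + 1).
  by rewrite -powRrM mulVf ?powRr1 ?divr_ge0 ?ltW// gt_eqF// subr_gt0.
have le : Num.min e t `^ (1 - a) <= e / (2 * B `^ a + 1).
  by rewrite -ta ge0_ler_powR ?nnegrE ?subr_ge0 ?(ltW a1) ?(ltW t0)// ge_min lexx orbT.
rewrite mulrCA (le_trans (ler_wpM2r _ le)) ?mulr_ge0//.
by rewrite mulrAC ler_pdivrMr// ler_pM2l// lerDl.
Qed.

(** Pointwise limits along [U] are uniform: if not, points of the unit cube where the gap exceeds e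
    converge along [U], and equicontinuity contradicts convergence at their limit. Interpolation
    with the common Lipschitz bound upgrades uniform to Hoelder convergence. *)
Lemma ultra_ascoli (g : nat -> 'rV[R]_d -> R) (B : R) :
  (forall n, Defs.periodic (g n)) -> (forall n x, `|g n x| <= B) ->
  (forall n x y, `|g n x - g n y| <= B * `|x - y|) ->
  exists l : 'rV[R]_d -> R, [/\ Defs.periodic l, forall x, `|l x| <= B,
    forall x y, `|l x - l y| <= B * `|x - y| &
    forall e, 0 < e -> U [set n | c0a_le a (fun x => g n x - l x) e]].
Proof.
move=> pg gB gL; have cle := @ultra_cvg_norm_le R U UU Uoo.
have B0 : 0 <= B by rewrite (le_trans _ (gB 0%N 0)).
have [l lP] : {l : 'rV[R]_d -> R & forall x, g n x @[n --> U] --> l x}.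
  apply: (@choice _ _ (fun x l => g n x @[n --> U] --> l)) => x.
  by apply: (ultra_bounded_cvg UU (M := B)) => n.
have lper : Defs.periodic l.
  move=> i x; apply/eqP; rewrite -subr_eq0 -normr_le0.
  apply: (cle (fun n => g n (x + evec R i) - g n x) _ _ 0%N); first exact: cvgB.
  by move=> n _; rewrite pg subrr normr0.
have lB x : `|l x| <= B by apply: (cle _ _ _ 0%N (lP x)).
have lL x y : `|l x - l y| <= B * `|x - y|.
  by apply: (cle (fun n => g n x - g n y) _ _ 0%N) => //; exact: cvgB.
have unif e : 0 < e -> U [set n | forall x, `|g n x - l x| <= e].
  move=> e0; have [//|nU] := in_ultra_setVsetC [set n | forall x, `|g n x - l x| <= e] UU.
  exfalso.
  have /choice[z zP] n : exists z, @unit_cube R d z /\ ((exists x, e < `|g n x - l x|) -> e < `|g n z - l z|).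
    case: (pselect (exists x, e < `|g n x - l x|)) => [[x hx]|nx].
      have [y yc hy] := periodic_reduce x; exists y; split=> // _.
      by rewrite -(hy _ (pg n)) -(hy _ lper).
    exists 0; split=> //; move=> i; by rewrite /= mxE in_itv/= lexx ler01.
  have [p pP] := ultra_compact_cvg UU (@compact_unit_cube R d) (fun n => (zP n).1).
  pose dl := e / 4 / (B + 1); have B1 : 0 < B + 1 by rewrite ltr_wpDl.
  have dl0 : 0 < dl by rewrite !divr_gt0.
  have /cvgrPdist_le /(_ _ dl0) u1 := pP.
  have e3 : 0 < e / 3 by rewrite divr_gt0.
  have /cvgrPdist_le /(_ _ e3) u2 := lP p.
  have [n [[n1 n2] n3]] := filter_ex (filterI (filterI u1 u2) nU).
  have ex : exists x, e < `|g n x - l x|.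
    by apply: contrapT => nx; apply: n3 => x; rewrite leNgt; apply/negP => h; apply: nx; exists x.
  have := (zP n).2 ex; apply/negP; rewrite -leNgt.
  have -> : g n (z n) - l (z n) = (g n (z n) - g n p) + (g n p - l p) + (l p - l (z n)) by ring.
  have bd : B * dl <= e / 4.
    by rewrite /dl mulrCA ler_piMr ?(ltW (divr_gt0 e0 _))// ler_pdivrMr// mul1r lerDl.
  have q1 : `|g n (z n) - g n p| <= e / 4.
    rewrite (le_trans (gL n _ _))// (le_trans _ bd)// ler_wpM2l// distrC; exact: n1.
  have q2 : `|l p - l (z n)| <= e / 4.
    by rewrite (le_trans (lL _ _))// (le_trans _ bd)// ler_wpM2l//; exact: n1.
  have q3 : `|g n p - l p| <= e / 3 by rewrite distrC; exact: n2.
  rewrite (le_trans (ler_normD _ _))// (le_trans (lerD (ler_normD _ _) (lexx _)))//; lra.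
exists l; split=> // e e0.
have [A A0 [Ae Ai]] := small_interpolation (2 * B + 1) e0.
have := unif A A0; apply: filterS => n hn.
have C0 : 0 < 2 * B + 1 by rewrite ltr_wpDl// mulr_ge0.
apply: (c0a_le_interpolation a01 A0 C0 hn _ Ae Ai) => x y.
have -> : g n x - l x - (g n y - l y) = (g n x - g n y) - (l x - l y) by ring.
rewrite (le_trans (ler_normB _ _))// (le_trans (lerD (gL n x y) (lL x y)))//.
by rewrite -mulrDl ler_wpM2r//; lra.
Qed.

End UltraAscoli.

(** * The linearized system as a compact perturbation of the identity *)

Section LinearizedSystem.
Variables (R : realType) (d : nat) (lam a : R).
Hypotheses (lam0 : 0 < lam) (a01 : 0 < a < 1).
Local Notation F := ('rV[R]_d -> R).
Implicit Types (w mu xi zeta : F) (p q : 'I_d -> F).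

Variables (phi v rho : F).

(** The coefficient [phi], later [slope f rho], is left free, so that one linear theory serves both
    at (u, m) and at every iterate. *)
Definition lin1 w mu : F := fun x => - lap w x + dot_grad v w x + lam * w x - phi x * mu x.
Definition lin2 w mu : F :=
  fun x => - lap mu x - div_mul_grad mu v x + lam * mu x - div_mul_grad rho w x.

Hypotheses (pphi : Defs.periodic phi) (Cv : C2a a v) (Crho : C2a a rho).
Variable M : R.
Hypothesis phiM : c0a_le a phi M.
Hypotheses (vM : forall i, c0a_le a (pd i v) M) (lapM : c0a_le a (lap v) M).
Hypotheses (rhoM : c0a_le a rho M) (drhoM : forall i, c0a_le a (pd i rho) M).

Let M0 : 0 <= M := c0a_le_ge0 phiM.
Let cv : C2 v := proj1 (proj1 Cv).
Let crho : C2 rho := proj1 (proj1 Crho).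
Let pv : Defs.periodic v := proj2 (proj1 Cv).
Let prho : Defs.periodic rho := proj2 (proj1 Crho).

(* First-order terms as functions of the 1-jets [(w, p)] and [(mu, q)]; in the second one
   [rho * lap w] has been eliminated by means of the first equation. *)
Definition jet1 w p mu q : F := fun x => phi x * mu x - \sum_(i < d) pd i v x * p i x.
Definition jet2 w p mu q : F := fun x =>
  \sum_(i < d) q i x * pd i v x + mu x * lap v x + \sum_(i < d) pd i rho x * p i x
  + rho x * (lam * w x - jet1 w p mu q x).

Definition jet_cst1 : R := 2 * M + d%:R * (2 * M).
Definition jet_cst2 : R :=
  d%:R * (2 * M) + 2 * M + d%:R * (2 * M) + 2 * (M * (lam + jet_cst1)).

Lemma jet_cst1_ge0 : 0 <= jet_cst1.
Proof. by rewrite addr_ge0// !mulr_ge0. Qed.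

Lemma jet_cst2_ge0 : 0 <= jet_cst2.
Proof.
have h := jet_cst1_ge0.
by rewrite /jet_cst2 !addr_ge0// !mulr_ge0// addr_ge0// ltW.
Qed.

Lemma jet1_c0a w p mu q H : c0a_le a mu H -> (forall i, c0a_le a (p i) H) ->
  c0a_le a (jet1 w p mu q) (jet_cst1 * H).
Proof.
move=> muH pH; have -> : jet_cst1 * H = 2 * (M * H) + d%:R * (2 * (M * H)).
  by rewrite /jet_cst1; ring.
apply: c0a_leB; first exact: c0a_leM.
by apply: c0a_le_sum_ord => i; exact: c0a_leM.
Qed.

Lemma jet2_c0a w p mu q H : c0a_le a w H -> c0a_le a mu H -> (forall i, c0a_le a (p i) H) ->
  (forall i, c0a_le a (q i) H) -> c0a_le a (jet2 w p mu q) (jet_cst2 * H).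
Proof.
move=> wH muH pH qH.
have -> : jet_cst2 * H = d%:R * (2 * (H * M)) + 2 * (H * M) + d%:R * (2 * (M * H))
   + 2 * (M * (`|lam| * H + jet_cst1 * H)).
  by rewrite (gtr0_norm lam0) /jet_cst2; ring.
apply: c0a_leD; first apply: c0a_leD; first apply: c0a_leD.
- by apply: c0a_le_sum_ord => i; exact: c0a_leM.
- exact: c0a_leM.
- by apply: c0a_le_sum_ord => i; exact: c0a_leM.
- apply: c0a_leM => //; apply: c0a_leB; first exact: c0a_leZ.
  exact: jet1_c0a.
Qed.

Lemma jet1_affine c w p mu q w' p' mu' q' x :
  jet1 (fun x => c * w x + w' x) (fun i x => c * p i x + p' i x)
       (fun x => c * mu x + mu' x) (fun i x => c * q i x + q' i x) x
  = c * jet1 w p mu q x + jet1 w' p' mu' q' x.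
Proof.
rewrite /jet1.
have -> : \sum_(i < d) pd i v x * (c * p i x + p' i x)
   = c * (\sum_(i < d) pd i v x * p i x) + \sum_(i < d) pd i v x * p' i x.
  by rewrite mulr_sumr -big_split; apply: eq_bigr => i _ /=; ring.
ring.
Qed.

Lemma jet2_affine c w p mu q w' p' mu' q' x :
  jet2 (fun x => c * w x + w' x) (fun i x => c * p i x + p' i x)
       (fun x => c * mu x + mu' x) (fun i x => c * q i x + q' i x) x
  = c * jet2 w p mu q x + jet2 w' p' mu' q' x.
Proof.
rewrite /jet2 jet1_affine.
have -> : \sum_(i < d) (c * q i x + q' i x) * pd i v x
   = c * (\sum_(i < d) q i x * pd i v x) + \sum_(i < d) q' i x * pd i v x.
  by rewrite mulr_sumr -big_split; apply: eq_bigr => i _ /=; ring.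
have -> : \sum_(i < d) pd i rho x * (c * p i x + p' i x)
   = c * (\sum_(i < d) pd i rho x * p i x) + \sum_(i < d) pd i rho x * p' i x.
  by rewrite mulr_sumr -big_split; apply: eq_bigr => i _ /=; ring.
ring.
Qed.

Lemma jet1_periodic w p mu q : Defs.periodic mu -> (forall i, Defs.periodic (p i)) ->
  Defs.periodic (jet1 w p mu q).
Proof.
move=> pm pp j x; rewrite /jet1 pphi pm; congr (_ - _); apply: eq_bigr => i _.
by rewrite pp (pd_periodic i pv).
Qed.

Lemma jet2_periodic w p mu q : Defs.periodic w -> Defs.periodic mu -> (forall i, Defs.periodic (p i)) ->
  (forall i, Defs.periodic (q i)) -> Defs.periodic (jet2 w p mu q).
Proof.
move=> pw pm pp pq j x; rewrite /jet2 pw pm prho (jet1_periodic w q pm pp) (lap_periodic pv).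
have -> : \sum_(i < d) q i (x + evec R j) * pd i v (x + evec R j) = \sum_(i < d) q i x * pd i v x.
  by apply: eq_bigr => i _; rewrite pq (pd_periodic i pv).
have -> : \sum_(i < d) pd i rho (x + evec R j) * p i (x + evec R j) = \sum_(i < d) pd i rho x * p i x.
  by apply: eq_bigr => i _; rewrite pp (pd_periodic i prho).
by [].
Qed.

Definition low1 w mu : F := jet1 w (fun i => pd i w) mu (fun i => pd i mu).
Definition low2 w mu : F := jet2 w (fun i => pd i w) mu (fun i => pd i mu).

Lemma lin1E w mu x : lin1 w mu x = - lap w x + lam * w x - low1 w mu x.
Proof. rewrite /lin1 /low1 /jet1 /dot_grad; ring. Qed.

(** Subtracting rho times the first equation cancels rho times the Laplacian of w; what remains is
    elliptic in mu with terms of order at most one in both unknowns. *)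
Lemma lin2E w mu x : C2 w -> C2 mu ->
  lin2 w mu x = - lap mu x + lam * mu x - low2 w mu x + rho x * lin1 w mu x.
Proof.
move=> cw cm; rewrite lin1E /lin2 (div_mul_gradE x cm cv) (div_mul_gradE x crho cw).
have -> : low2 w mu x = dot_grad mu v x + mu x * lap v x + dot_grad rho w x
  + rho x * (lam * w x - low1 w mu x) by [].
move: (dot_grad mu v x) (dot_grad rho w x) (low1 w mu x) (lap w x) (lap mu x) (lap v x).
move=> *; ring.
Qed.

Lemma low1_c0a w mu K : C2 w -> C2 mu -> c2a_le a w K -> c2a_le a mu K ->
  c0a_le a (low1 w mu) (jet_cst1 * (cdim R d * K)).
Proof.
move=> cw cm wK mK; apply: jet1_c0a; first exact: (c2a_c0a a01).
by move=> i; exact: (c2a_c0a_pd a01).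
Qed.

Lemma low2_c0a w mu K : C2 w -> C2 mu -> c2a_le a w K -> c2a_le a mu K ->
  c0a_le a (low2 w mu) (jet_cst2 * (cdim R d * K)).
Proof.
move=> cw cm wK mK; apply: jet2_c0a; [exact: (c2a_c0a a01)|exact: (c2a_c0a a01)| |];
 by move=> i; exact: (c2a_c0a_pd a01).
Qed.

Lemma low_periodic w mu : Defs.periodic w -> Defs.periodic mu ->
  Defs.periodic (low1 w mu) /\ Defs.periodic (low2 w mu).
Proof.
move=> pw pm; split.
  by apply: jet1_periodic => // i; exact: pd_periodic.
by apply: jet2_periodic => // i; exact: pd_periodic.
Qed.

(** The function space is a predicate on pairs of arbitrary functions, in the form expected by the
    Riesz theory; [N] behaves as a norm only on [P]. *)
Let P (z : F * F) := C2a a z.1 /\ C2a a z.2.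
Let N (z : F * F) := c2a_norm a z.1 + c2a_norm a z.2.
Let K (z : F * F) : F * F := (Tsol lam (low1 z.1 z.2), Tsol lam (low2 z.1 z.2)).

Let P0 : P 0. Proof. by split; exact: C2a0. Qed.

Let fstE c (x y : F * F) : (c *: x + y).1 = fun z => c * x.1 z + y.1 z.
Proof. by []. Qed.

Let sndE c (x y : F * F) : (c *: x + y).2 = fun z => c * x.2 z + y.2 z.
Proof. by []. Qed.

Let Paff c x y : P x -> P y -> P (c *: x + y).
Proof. by move=> [x1 x2] [y1 y2]; split; rewrite ?fstE ?sndE; apply: C2a_affine. Qed.

Let N_ge0 x : 0 <= N x. Proof. by rewrite /N; apply: addr_ge0; exact: c2a_norm_ge0. Qed.

Let Nle z H : c2a_le a z.1 H -> c2a_le a z.2 H -> N z <= 2 * cnorm R d * H.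
Proof.
move=> h1 h2; rewrite -mulrA mulr_natl mulr2n /N; apply: lerD; exact: c2a_norm_le.
Qed.

Let leN z : P z -> c2a_le a z.1 (N z) /\ c2a_le a z.2 (N z).
Proof.
move=> [z1 z2]; split.
  by apply: (c2a_le_mono _ (C2a_le_norm a01 z1)); rewrite lerDl c2a_norm_ge0.
by apply: (c2a_le_mono _ (C2a_le_norm a01 z2)); rewrite lerDr c2a_norm_ge0.
Qed.

Let N0 : N 0 = 0.
Proof.
apply/eqP; rewrite eq_le N_ge0 andbT.
have c0 : c2a_le a (fun _ : 'rV[R]_d => 0 : R) 0.
  have e i : pd i (fun _ : 'rV[R]_d => 0) = (fun _ : 'rV[R]_d => 0 : R).
    by apply/funext => x; exact: derive_cst.
  by split=> *; rewrite ?e ?subrr normr0 ?mul0r.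
by have := @Nle (0 : F * F) 0 c0 c0; rewrite mulr0.
Qed.

Let Naff c x y : P x -> P y -> N (c *: x + y) <= `|c| * N x + N y.
Proof.
have gen (A1 A2 k C1 C2 D1 D2 : R) :
  A1 <= k * C1 + D1 -> A2 <= k * C2 + D2 -> A1 + A2 <= k * (C1 + C2) + (D1 + D2) by lra.
move=> [x1 x2] [y1 y2]; rewrite /N fstE sndE.
exact: gen (c2a_norm_affine a01 c x1 y1) (c2a_norm_affine a01 c x2 y2).
Qed.

Let N_eq0 x : P x -> N x = 0 -> x = 0.
Proof.
have h (r : R) (g : F) : r = 0 -> c2a_le a g r -> g = 0.
  by move=> -> [h1 _ _ _]; apply/funext => z; apply/eqP; rewrite -normr_le0.
move=> px n0; have [l1 l2] := leN px.
rewrite (surjective_pairing x); congr (_, _); [exact: h n0 l1|exact: h n0 l2].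
Qed.

Let lowP x : P x -> [/\ Defs.periodic (low1 x.1 x.2), Defs.periodic (low2 x.1 x.2),
  c0a_le a (low1 x.1 x.2) (jet_cst1 * (cdim R d * N x)) &
  c0a_le a (low2 x.1 x.2) (jet_cst2 * (cdim R d * N x))].
Proof.
move=> px; have [h1 h2] := leN px; case: px => [[[c1 p1] _] [[c2 p2] _]].
have [l1 l2] := low_periodic p1 p2; split=> //; [exact: low1_c0a|exact: low2_c0a].
Qed.

Let PK x : P x -> P (K x).
Proof.
move=> /lowP[p1 p2 b1 b2].
by split; [have [] := Tsol_spec lam0 a01 p1 b1|have [] := Tsol_spec lam0 a01 p2 b2].
Qed.

Let Kaff c x y : P x -> P y -> K (c *: x + y) = c *: K x + K y.
Proof.
move=> px py; have [p1 p2 b1 b2] := lowP px; have [p1' p2' b1' b2'] := lowP py.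
case: px py => [[[c1 _] _] [[c2 _] _]] [[[c1' _] _] [[c2' _] _]].
have pe1 : (fun i => pd i (c *: x + y).1) = fun i z => c * pd i x.1 z + pd i y.1 z.
  by apply/funext => i; rewrite fstE; exact: pd1_affine.
have pe2 : (fun i => pd i (c *: x + y).2) = fun i z => c * pd i x.2 z + pd i y.2 z.
  by apply/funext => i; rewrite sndE; exact: pd1_affine.
have e1 : low1 (c *: x + y).1 (c *: x + y).2 = fun z => c * low1 x.1 x.2 z + low1 y.1 y.2 z.
  apply/funext => z; rewrite /low1 pe1 pe2 fstE sndE; exact: jet1_affine.
have e2 : low2 (c *: x + y).1 (c *: x + y).2 = fun z => c * low2 x.1 x.2 z + low2 y.1 y.2 z.
  apply/funext => z; rewrite /low2 pe1 pe2 fstE sndE; exact: jet2_affine.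
by rewrite /K e1 e2 (Tsol_affine lam0 a01 c p1 b1 p1' b1') (Tsol_affine lam0 a01 c p2 b2 p2' b2').
Qed.

Let CT0 := Tsol_cst_ge0 d lam0 a01.

Let TN xi zeta H : Defs.periodic xi -> Defs.periodic zeta -> c0a_le a xi H -> c0a_le a zeta H ->
  N (Tsol lam xi, Tsol lam zeta) <= 2 * cnorm R d * (Tsol_cst d lam a * H).
Proof.
move=> p1 p2 b1 b2; have [_ _ h1] := Tsol_spec lam0 a01 p1 b1.
have [_ _ h2] := Tsol_spec lam0 a01 p2 b2.
exact: (@Nle (Tsol lam xi, Tsol lam zeta) _ h1 h2).
Qed.

Definition lin_cst : R := 2 * cnorm R d * (Tsol_cst d lam a * ((jet_cst1 + jet_cst2) * cdim R d)).

Let mono12 H : 0 <= H -> jet_cst1 * H <= (jet_cst1 + jet_cst2) * H /\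
  jet_cst2 * H <= (jet_cst1 + jet_cst2) * H.
Proof.
have j1 := jet_cst1_ge0; have j2 := jet_cst2_ge0.
by move=> H0; rewrite !ler_wpM2r ?lerDl ?lerDr.
Qed.

Let KB x : P x -> N (K x) <= lin_cst * N x.
Proof.
move=> px; have [p1 p2 b1 b2] := lowP px.
have d0 : 0 <= cdim R d * N x by rewrite mulr_ge0// (le_trans ler01)// cdim_ge1.
have [m1 m2] := mono12 d0.
have := TN p1 p2 (c0a_le_mono m1 b1) (c0a_le_mono m2 b2).
by rewrite /lin_cst !mulrA.
Qed.

(** [K] sees only 1-jets. Those of a bounded sequence in C^{2,a} are bounded and equi-Lipschitz,
    hence converge in C^{0,a} along an ultrafilter, and [Tsol] carries this convergence back to
    C^{2,a}. *)
Let Kcompact (u : nat -> F * F) : (forall n, P (u n)) -> (forall n, N (u n) <= 1) ->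
  exists2 y, P y & forall e, 0 < e -> forall n0, exists2 n, (n0 <= n)%N & N (K (u n) - y) <= e.
Proof.
move=> pu u1.
have [U [UU Uoo]] := @ultraFilterLemma nat \oo _.
have PU : ProperFilter U by exact: ultra_proper.
have b n : c2a_le a (u n).1 1 /\ c2a_le a (u n).2 1.
  have [h k] := leN (pu n).
  by split; [exact: c2a_le_mono (u1 n) h|exact: c2a_le_mono (u1 n) k].
pose B : R := 1 + d%:R.
have B1 : 1 <= B by rewrite lerDl.
have Bd : d%:R * 1 <= B by rewrite mulr1 lerDr.
have asc (g : nat -> F) : (forall n, Defs.periodic (g n)) -> (forall n x, `|g n x| <= 1) ->
    (forall n x y, `|g n x - g n y| <= d%:R * 1 * `|x - y|) ->
    exists l : F, Defs.periodic l /\ exists2 H, c0a_le a l H &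
     (forall e, 0 < e -> U [set n | c0a_le a (fun x => g n x - l x) e]).
  move=> pg g1 gL; have [||n x y|l [pl lB lL lU]] := @ultra_ascoli R d a U a01 UU Uoo g B.
  - exact: pg.
  - by move=> n x; rewrite (le_trans (g1 n x)).
  - by rewrite (le_trans (gL n x y))// ler_wpM2r.
  exists l; split=> //; exists (2 * B + B) => //; apply: (c0a_le_lipschitz a01) => //.
  by rewrite (le_trans ler01).
have as0 (g : nat -> F) (Cg : forall n, C2a a (g n)) (g1 : forall n, c2a_le a (g n) 1) :=
  asc g (fun n => proj2 (proj1 (Cg n))) (fun n x => let: And4 h _ _ _ := g1 n in h x)
    (fun n => c2a_lipschitz0 (proj1 (proj1 (Cg n))) (g1 n)).
have as1 (g : nat -> F) i (Cg : forall n, C2a a (g n)) (g1 : forall n, c2a_le a (g n) 1) :=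
  asc (fun n => pd i (g n)) (fun n => pd_periodic i (proj2 (proj1 (Cg n))))
    (fun n x => let: And4 _ h _ _ := g1 n in h i x)
    (fun n => c2a_lipschitz1 (proj1 (proj1 (Cg n))) (g1 n) i).
have C1 n := (pu n).1; have C2' n := (pu n).2.
have [w [pw [Hw wH wU]]] := as0 _ C1 (fun n => (b n).1).
have [m [pm [Hm mH mU]]] := as0 _ C2' (fun n => (b n).2).
(* The limits [p i] are not shown to be derivatives of [w]. Since [jet1] and [jet2] take them as
   independent arguments, the cluster point can be written down all the same. *)
have /choice[p pP] i := as1 _ i C1 (fun n => (b n).1).
have /choice[q qP] i := as1 _ i C2' (fun n => (b n).2).
have /choice[Hp HpP] i : exists H, c0a_le a (p i) H by have [_ [H h _]] := pP i; exists H.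
have /choice[Hq HqP] i : exists H, c0a_le a (q i) H by have [_ [H h _]] := qP i; exists H.
pose H := Hw + Hm + \sum_i Hp i + \sum_i Hq i.
have Hw0 := c0a_le_ge0 wH; have Hm0 := c0a_le_ge0 mH.
have Hp0 i := c0a_le_ge0 (HpP i); have Hq0 i := c0a_le_ge0 (HqP i).
have sp : 0 <= \sum_i Hp i by exact: sumr_ge0.
have sq : 0 <= \sum_i Hq i by exact: sumr_ge0.
have HE i : Hp i <= \sum_i Hp i by rewrite (bigD1 i)//= lerDl sumr_ge0.
have HE' i : Hq i <= \sum_i Hq i by rewrite (bigD1 i)//= lerDl sumr_ge0.
have wH' : c0a_le a w H by apply: c0a_le_mono wH; rewrite /H; lra.
have mH' : c0a_le a m H by apply: c0a_le_mono mH; rewrite /H; lra.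
have pH' i : c0a_le a (p i) H by apply: c0a_le_mono (HpP i); have := HE i; rewrite /H; lra.
have qH' i : c0a_le a (q i) H by apply: c0a_le_mono (HqP i); have := HE' i; rewrite /H; lra.
have b1 := jet1_c0a w q mH' pH'; have b2 := jet2_c0a wH' mH' pH' qH'.
have pp i : Defs.periodic (p i) by case: (pP i).
have pq i : Defs.periodic (q i) by case: (qP i).
have q1 : Defs.periodic (jet1 w p m q) by exact: jet1_periodic.
have q2 : Defs.periodic (jet2 w p m q) by exact: jet2_periodic.
exists (Tsol lam (jet1 w p m q), Tsol lam (jet2 w p m q)).
  by split; [have [] := Tsol_spec lam0 a01 q1 b1|have [] := Tsol_spec lam0 a01 q2 b2].
move=> e e0 n0.
pose Q := 2 * cnorm R d * (Tsol_cst d lam a * (jet_cst1 + jet_cst2)).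
have Q0 : 0 <= Q.
  rewrite /Q mulr_ge0//; first by rewrite mulr_ge0// /cnorm !addr_ge0// mulr_ge0// exprn_ge0.
  by rewrite mulr_ge0// addr_ge0// ?jet_cst1_ge0 ?jet_cst2_ge0.
have Q1 : 0 < Q + 1 by rewrite ltr_wpDl.
pose e1 := e / (Q + 1); have e10 : 0 < e1 by rewrite divr_gt0.
have pU : U [set n | forall i, c0a_le a (fun x => pd i (u n).1 x - p i x) e1].
  by apply: filter_forall => i; have [_ [_ _ h]] := pP i; exact: h.
have qU : U [set n | forall i, c0a_le a (fun x => pd i (u n).2 x - q i x) e1].
  by apply: filter_forall => i; have [_ [_ _ h]] := qP i; exact: h.
have nU : U [set n | (n0 <= n)%N] by apply: Uoo; exists n0.
have [n [[[[hw hm] hp] hq] hn]] := filter_ex (filterI (filterI (filterI (filterI (wU _ e10) (mU _ e10)) pU) qU) nU).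
exists n => //.
have {}hw : c0a_le a (fun x => -1 * w x + (u n).1 x) e1 by rewrite -sub_affineE.
have {}hm : c0a_le a (fun x => -1 * m x + (u n).2 x) e1 by rewrite -sub_affineE.
have {}hp i : c0a_le a (fun x => -1 * p i x + pd i (u n).1 x) e1 by rewrite -sub_affineE.
have {}hq i : c0a_le a (fun x => -1 * q i x + pd i (u n).2 x) e1 by rewrite -sub_affineE.
have d1 : c0a_le a (fun x => -1 * jet1 w p m q x + low1 (u n).1 (u n).2 x) (jet_cst1 * e1).
  have := jet1_c0a (fun x => -1 * w x + (u n).1 x) (fun i x => -1 * q i x + pd i (u n).2 x) hm hp.
  by congr (c0a_le _ _ _); apply/funext => x; exact: jet1_affine.
have d2 : c0a_le a (fun x => -1 * jet2 w p m q x + low2 (u n).1 (u n).2 x) (jet_cst2 * e1).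
  have := jet2_c0a hw hm hp hq.
  by congr (c0a_le _ _ _); apply/funext => x; exact: jet2_affine.
have [l1 l2 k1 k2] := lowP (pu n).
have r1 : Defs.periodic (fun x => -1 * jet1 w p m q x + low1 (u n).1 (u n).2 x).
  by move=> i x; rewrite q1 l1.
have r2 : Defs.periodic (fun x => -1 * jet2 w p m q x + low2 (u n).1 (u n).2 x).
  by move=> i x; rewrite q2 l2.
have [m1 m2] := mono12 (ltW e10).
have := TN r1 r2 (c0a_le_mono m1 d1) (c0a_le_mono m2 d2).
rewrite (Tsol_affine lam0 a01 (-1) q1 b1 l1 k1) (Tsol_affine lam0 a01 (-1) q2 b2 l2 k2).
have -> : K (u n) - (Tsol lam (jet1 w p m q), Tsol lam (jet2 w p m q))
  = (fun x => -1 * Tsol lam (jet1 w p m q) x + Tsol lam (low1 (u n).1 (u n).2) x,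
     fun x => -1 * Tsol lam (jet2 w p m q) x + Tsol lam (low2 (u n).1 (u n).2) x).
  by congr (_, _); rewrite -sub_affineE.
have -> : 2 * cnorm R d * (Tsol_cst d lam a * ((jet_cst1 + jet_cst2) * e1)) = Q * e1.
  by rewrite /Q; ring.
move=> h; apply: (le_trans h).
by rewrite /e1 mulrCA ler_piMr ?(ltW e0)// ler_pdivrMr// mul1r lerDl.
Qed.

Hypothesis lin_inj : forall w mu, C2a a w -> C2a a mu ->
  (forall x, lin1 w mu x = 0) -> (forall x, lin2 w mu x = 0) ->
  w = (fun=> 0) /\ mu = (fun=> 0).

Let Kinj x : P x -> x = K x -> x = 0.
Proof.
move=> px e; have [l1 l2 k1 k2] := lowP px.
have [_ e1 _] := Tsol_spec lam0 a01 l1 k1; have [_ e2 _] := Tsol_spec lam0 a01 l2 k2.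
have f1 : Tsol lam (low1 x.1 x.2) = x.1 by rewrite {3}e.
have f2 : Tsol lam (low2 x.1 x.2) = x.2 by rewrite {3}e.
rewrite f1 in e1; rewrite f2 in e2.
case: px => p1 p2.
have z1 z : lin1 x.1 x.2 z = 0 by rewrite lin1E e1 subrr.
have z2 z : lin2 x.1 x.2 z = 0.
  by rewrite (lin2E z (proj1 (proj1 p1)) (proj1 (proj1 p2))) z1 e2 subrr mulr0 addr0.
have [x1 x2] := lin_inj p1 p2 z1 z2.
by rewrite (surjective_pairing x) x1 x2.
Qed.

Let rhs2 xi zeta : F := fun x => zeta x - rho x * xi x.

Let rhs2_c0a xi zeta H : c0a_le a xi H -> c0a_le a zeta H -> c0a_le a (rhs2 xi zeta) ((1 + 2 * M) * H).
Proof.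
move=> h1 h2; have -> : (1 + 2 * M) * H = H + 2 * (M * H) by ring.
by apply: c0a_leB => //; exact: c0a_leM.
Qed.

Let rhs1_c0a xi H : c0a_le a xi H -> c0a_le a xi ((1 + 2 * M) * H).
Proof.
move=> h; apply: (c0a_le_mono _ h); apply: ler_peMl; first exact: c0a_le_ge0 h.
by rewrite lerDl mulr_ge0.
Qed.

(** Applying [Tsol] to the reduced system gives the identity minus [K]; the second right-hand side
    becomes zeta - rho xi because of the elimination in [lin2E]. *)
Let lin_fixpoint w mu xi zeta : C2a a w -> C2a a mu -> Defs.periodic xi -> Defs.periodic zeta ->
  forall H, c0a_le a xi H -> c0a_le a zeta H ->
  ((forall x, lin1 w mu x = xi x) /\ (forall x, lin2 w mu x = zeta x)) <->
  (w, mu) - K (w, mu) = (Tsol lam xi, Tsol lam (rhs2 xi zeta)).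
Proof.
move=> Cw Cm pxi pze H xH zH.
have pr : Defs.periodic (rhs2 xi zeta) by move=> i x; rewrite /rhs2 pze prho pxi.
have rH := rhs2_c0a xH zH.
have [l1 l2 k1 k2] := @lowP (w, mu) (conj Cw Cm).
rewrite /= in l1 l2 k1 k2.
have cw : C2 w := proj1 (proj1 Cw); have cm : C2 mu := proj1 (proj1 Cm).
have [_ eT1 _] := Tsol_spec lam0 a01 pxi xH; have [_ eT2 _] := Tsol_spec lam0 a01 pr rH.
have t1 := Tsol_affine lam0 a01 1 l1 k1 pxi xH.
have t2 := Tsol_affine lam0 a01 1 l2 k2 pr rH.
have p1 : Defs.periodic (fun x => 1 * low1 w mu x + xi x) by move=> i x; rewrite l1 pxi.
have p2 : Defs.periodic (fun x => 1 * low2 w mu x + rhs2 xi zeta x) by move=> i x; rewrite l2 pr.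
have [_ s1 _] := Tsol_spec lam0 a01 p1 (c0a_leD (c0a_leZ 1 k1) xH).
have [_ s2 _] := Tsol_spec lam0 a01 p2 (c0a_leD (c0a_leZ 1 k2) rH).
split.
- move=> [h1 h2].
  have f1 : Tsol lam (fun x => 1 * low1 w mu x + xi x) = w.
    by apply: (Tsol_eq lam0 (proj1 Cw)) => x; rewrite -h1 lin1E; ring.
  have f2 : Tsol lam (fun x => 1 * low2 w mu x + rhs2 xi zeta x) = mu.
    by apply: (Tsol_eq lam0 (proj1 Cm)) => x; rewrite /rhs2 -h1 -h2 (lin2E x cw cm); ring.
  rewrite t1 in f1; rewrite t2 in f2.
  have g1 : w - Tsol lam (low1 w mu) = Tsol lam xi.
    by apply/funext => x; have := congr1 (fun g => g x) f1; rewrite !fctE; lra.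
  have g2 : mu - Tsol lam (low2 w mu) = Tsol lam (rhs2 xi zeta).
    by apply/funext => x; have := congr1 (fun g => g x) f2; rewrite !fctE; lra.
  by rewrite -g1 -g2.
- move=> e.
  have f1 : w = Tsol lam (fun x => 1 * low1 w mu x + xi x).
    have e1 : w - Tsol lam (low1 w mu) = Tsol lam xi := congr1 fst e.
    by rewrite t1; apply/funext => x; have := congr1 (fun g => g x) e1; rewrite !fctE; lra.
  have f2 : mu = Tsol lam (fun x => 1 * low2 w mu x + rhs2 xi zeta x).
    have e2 : mu - Tsol lam (low2 w mu) = Tsol lam (rhs2 xi zeta) := congr1 snd e.
    by rewrite t2; apply/funext => x; have := congr1 (fun g => g x) e2; rewrite !fctE; lra.
  rewrite -f1 in s1; rewrite -f2 in s2.
  have h1 x : lin1 w mu x = xi x by rewrite lin1E s1; ring.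
  by split=> // x; rewrite (lin2E x cw cm) s2 h1 /rhs2; ring.
Qed.

Theorem linear_solvable xi zeta H : Defs.periodic xi -> Defs.periodic zeta ->
  c0a_le a xi H -> c0a_le a zeta H ->
  exists w mu, [/\ C2a a w, C2a a mu, forall x, lin1 w mu x = xi x & forall x, lin2 w mu x = zeta x].
Proof.
move=> pxi pze xH zH.
have pr : Defs.periodic (rhs2 xi zeta) by move=> i x; rewrite /rhs2 pze prho pxi.
have Py : P (Tsol lam xi, Tsol lam (rhs2 xi zeta)).
  split; first by have [] := Tsol_spec lam0 a01 pxi xH.
  by have [] := Tsol_spec lam0 a01 pr (rhs2_c0a xH zH).
have [[w mu] [Cw Cm] e] :=
  fredholm_surjective P0 Paff N_ge0 N0 Naff N_eq0 PK Kaff KB Kcompact Kinj Py.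
have [_ h] := lin_fixpoint Cw Cm pxi pze xH zH.
have [h1 h2] := h e; exists w, mu; split; [exact: Cw|exact: Cm|exact: h1|exact: h2].
Qed.

Theorem linear_estimate : exists2 C, 0 < C & forall w mu xi zeta H, C2a a w -> C2a a mu ->
  Defs.periodic xi -> Defs.periodic zeta -> c0a_le a xi H -> c0a_le a zeta H ->
  (forall x, lin1 w mu x = xi x) -> (forall x, lin2 w mu x = zeta x) ->
  c2a_norm a w + c2a_norm a mu <= C * H.
Proof.
have [c c0 hc] := fredholm_bounded_below P0 Paff N_ge0 N0 Naff N_eq0 PK Kaff KB Kcompact Kinj.
pose C := c * (2 * cnorm R d * (Tsol_cst d lam a * (1 + 2 * M))).
exists (C + 1) => [|w mu xi zeta H Cw Cm pxi pze xH zH h1 h2].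
  rewrite ltr_wpDl// /C mulr_ge0 ?(ltW c0)// mulr_ge0//.
    by rewrite mulr_ge0// /cnorm !addr_ge0// mulr_ge0// exprn_ge0.
  by rewrite mulr_ge0// addr_ge0// mulr_ge0.
have pr : Defs.periodic (rhs2 xi zeta) by move=> i x; rewrite /rhs2 pze prho pxi.
have [h _] := lin_fixpoint Cw Cm pxi pze xH zH.
have e := h (conj h1 h2).
have b := hc (w, mu) (conj Cw Cm).
rewrite -[(w, mu) - _]/((w, mu) - K (w, mu)) e in b.
have t := TN pxi pr (rhs1_c0a xH) (rhs2_c0a xH zH).
apply: (le_trans b); rewrite (le_trans (ler_wpM2l (ltW c0) t))//.
have H0 := c0a_le_ge0 xH.
apply: (@le_trans _ _ (C * H)); last by rewrite mulrDl mul1r lerDl.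
by rewrite /C; apply: le_of_eq; ring.
Qed.

End LinearizedSystem.

(** * Taylor remainder of the nonlinearity *)

Section ScalarNonlinearity.
Variables (R : realType).
Implicit Types (x y b h : R).

Lemma mvt_real (g dg : R -> R) : (forall s : R, is_derive s 1 g (dg s)) ->
  forall x y, exists2 c, Num.min x y <= c <= Num.max x y & g x - g y = dg c * (x - y).
Proof.
move=> Dg x y.
have cp A : {within A, continuous g}.
  apply: continuous_subspaceT => z.
  by apply: differentiable_continuous; apply/derivable1_diffP; case: (Dg z).
case: (leP x y) => xy.
  have [c cs e] := MVT_segment xy (fun z _ => Dg z) (cp _).
  exists c; first by move: cs; rewrite in_itv.
  by rewrite -[LHS]opprB e -mulrN opprB.
have [c cs e] := MVT_segment (ltW xy) (fun z _ => Dg z) (cp _).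
by exists c => //; move: cs; rewrite in_itv.
Qed.

Lemma between_norm_le (K x y c : R) : `|x| <= K -> `|y| <= K ->
  Num.min x y <= c <= Num.max x y -> `|c| <= K.
Proof.
rewrite !ler_norml => /andP[x1 x2] /andP[y1 y2] /andP[c1 c2]; apply/andP; split.
  by rewrite (le_trans _ c1)// le_min x1.
by rewrite (le_trans c2)// ge_max x2.
Qed.

Lemma between_dist_le (x y c z K : R) : `|x - z| <= K -> `|y - z| <= K ->
  Num.min x y <= c <= Num.max x y -> `|c - z| <= K.
Proof.
move=> xz yz cxy; apply: (between_norm_le xz yz).
by rewrite -addr_minl -addr_maxl !lerD2r.
Qed.

Variable f : R -> R.
Hypothesis hf : C1b_C2 f.

Let df (s : R) : is_derive s 1 f ((derive1 f) s).
Proof.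
have [d1 _] := hf; rewrite derive1E; exact/derivableP/d1.
Qed.

Let ddf (s : R) : is_derive s 1 (derive1 f) ((derive1n 2 f) s).
Proof.
have [_ [_ [_ [_ [d2 _]]]]] := hf; rewrite derive1nS derive1n1 derive1E; exact/derivableP/d2.
Qed.

Lemma nonlinearity_bounds : exists2 M1, 0 <= M1 &
  [/\ forall x, `|f x| <= M1, forall x, `|(derive1 f) x| <= M1 & forall x y, `|f x - f y| <= M1 * `|x - y|].
Proof.
have [_ [_ [[A hA] [[B hB] _]]]] := hf; have A0 := normr_ge0 A; have B0 := normr_ge0 B.
have fB x : `|(derive1 f) x| <= `|A| + `|B| by rewrite (le_trans (hB x))// (le_trans (ler_norm B))// lerDr.
exists (`|A| + `|B|); first exact: addr_ge0.
split=> [x|//|x y]; first by rewrite (le_trans (hA x))// (le_trans (ler_norm A))// lerDl.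
by have [c _ ->] := mvt_real df x y; rewrite normrM ler_wpM2r.
Qed.

(** The continuous second derivative is bounded on the compact interval. A negative radius is set
    apart: the claim is then vacuous, and the interval is empty. *)
Lemma derive_lipschitz (K : R) : exists2 L, 0 <= L & forall x y, `|x| <= K -> `|y| <= K ->
  `|(derive1 f) x - (derive1 f) y| <= L * `|x - y| /\ `|(derive1n 2 f) x| <= L.
Proof.
have [_ [_ [_ [_ [_ cf2]]]]] := hf.
case: (ltP K 0) => K0.
  by exists 0 => // x y xK; have := le_lt_trans (le_trans (normr_ge0 _) xK) K0; rewrite ltxx.
have KK : - K <= K by rewrite (le_trans _ K0)// oppr_le0.
have cn : {within `[- K, K], continuous (fun x => `|(derive1n 2 f) x|)}.
  by apply: continuous_subspaceT; exact: continuous_norm.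
have [c _ hc] := EVT_max KK cn.
exists `|(derive1n 2 f) c|; first exact: normr_ge0.
move=> x y xK yK.
have b z : `|z| <= K -> `|(derive1n 2 f) z| <= `|(derive1n 2 f) c|.
  by rewrite ler_norml => zK; apply: hc; rewrite in_itv.
split; last exact: b.
have [z zxy ->] := mvt_real ddf x y; rewrite normrM.
apply: ler_wpM2r; first exact: normr_ge0.
apply: b; exact: between_norm_le xK yK zxy.
Qed.

Definition taylor_rem b h : R := f (b + h) - f b - (derive1 f) b * h.

Section Remainder.
Variables (K L : R).
Hypothesis L0 : 0 <= L.
Hypothesis hL : forall x y, `|x| <= K + 1 -> `|y| <= K + 1 ->
  `|(derive1 f) x - (derive1 f) y| <= L * `|x - y| /\ `|(derive1n 2 f) x| <= L.

Let inK b h eta : `|b| <= K -> `|h| <= eta -> eta <= 1 -> `|b + h| <= K + 1.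
Proof.
by move=> bK he e1; rewrite (le_trans (ler_normD _ _))// lerD// (le_trans he).
Qed.

Let inK0 b : `|b| <= K -> `|b| <= K + 1.
Proof. by move=> bK; rewrite (le_trans bK)// lerDl. Qed.

Lemma taylor_rem_le b h eta : `|b| <= K -> `|h| <= eta -> eta <= 1 ->
  `|taylor_rem b h| <= L * eta ^+ 2.
Proof.
move=> bK he e1; have e0 : 0 <= eta by rewrite (le_trans _ he).
have [c cb e] := mvt_real df (b + h) b.
rewrite /taylor_rem e addrAC subrr add0r -mulrBl normrM expr2 mulrA.
have cd : `|c - b| <= eta.
  by apply: (between_dist_le _ _ cb); rewrite ?subrr ?normr0// addrAC subrr add0r.
have cK : `|c| <= K + 1 by apply: (between_norm_le _ _ cb); [exact: inK he e1|exact: inK0].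
apply: ler_pM => //; have [h1 _] := hL cK (inK0 bK).
by rewrite (le_trans h1)// ler_wpM2l.
Qed.

(** Vary [h] first, then the base point. The derivative of the remainder in the base point is the
    quantity bounded by [S]: of order eta for a continuous second derivative, of order eta^2 for a
    locally Lipschitz one. This separates the two convergence rates. *)
Lemma taylor_rem_lipschitz b h b' h' eta S : `|b| <= K -> `|b'| <= K ->
  `|h| <= eta -> `|h'| <= eta -> eta <= 1 ->
  (forall s, `|s| <= K -> `|(derive1 f) (s + h') - (derive1 f) s - (derive1n 2 f) s * h'| <= S) ->
  `|taylor_rem b h - taylor_rem b' h'| <= L * eta * `|h - h'| + S * `|b - b'|.
Proof.
move=> bK bK' he he' e1 hS; have e0 : 0 <= eta by rewrite (le_trans _ he).
have -> : taylor_rem b h - taylor_rem b' h'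
  = (taylor_rem b h - taylor_rem b h') + (taylor_rem b h' - taylor_rem b' h') by ring.
rewrite (le_trans (ler_normD _ _))// lerD//.
  have [c cb e] := mvt_real df (b + h) (b + h').
  have -> : taylor_rem b h - taylor_rem b h' = ((derive1 f) c - (derive1 f) b) * (h - h').
    have -> : taylor_rem b h - taylor_rem b h' = (f (b + h) - f (b + h')) - (derive1 f) b * (h - h').
      by rewrite /taylor_rem; ring.
    by rewrite e; ring.
  have cd : `|c - b| <= eta by apply: (between_dist_le _ _ cb); rewrite addrAC subrr add0r.
  have cK : `|c| <= K + 1 by apply: (between_norm_le _ _ cb); exact: inK e1.
  rewrite normrM ler_wpM2r//; have [h1 _] := hL cK (inK0 bK).
  by rewrite (le_trans h1)// ler_wpM2l.
pose dg s := (derive1 f) (s + h') - (derive1 f) s - (derive1n 2 f) s * h'.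
have Dg (s : R) : is_derive s 1 (fun b => taylor_rem b h') (dg s).
  have d1 : is_derive s 1 (fun b => f (b + h')) ((derive1 f) (s + h')).
    have i1 : is_derive s 1 (fun b : R => b + h') (1 : R).
      by have := @is_deriveD _ _ _ (@id R) (cst h') s 1 1 0 (is_derive_id _ _) (is_derive_cst _ _ _); rewrite addr0.
    have := @is_derive1_comp _ f (fun b => b + h') s _ _ (df (s + h')) i1.
    by rewrite /= mulr1.
  have d3 : is_derive s 1 (fun b => (derive1 f) b * h') ((derive1n 2 f) s * h').
    have := @is_deriveM _ _ (derive1 f) (cst h') s 1 _ _ (ddf s) (is_derive_cst _ _ _).
    by rewrite /= scaler0 add0r [_ *: _]mulrC.
  exact: (is_deriveB (is_deriveB d1 (df s)) d3).
have [c cb ->] := mvt_real Dg b b'.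
rewrite normrM ler_wpM2r// hS//; exact: between_norm_le cb.
Qed.

Lemma taylor_slope_le s h eta : `|s| <= K -> `|h| <= eta -> eta <= 1 ->
  `|(derive1 f) (s + h) - (derive1 f) s - (derive1n 2 f) s * h| <= 2 * L * eta.
Proof.
move=> sK he e1; have [h1 _] := hL (inK sK he e1) (inK0 sK).
have [_ h2] := hL (inK0 sK) (inK0 sK).
rewrite addrAC subrr add0r in h1.
rewrite (le_trans (ler_normB _ _))// -mulrA mulr_natl mulr2n lerD//.
  by rewrite (le_trans h1)// ler_wpM2l.
by rewrite normrM ler_pM.
Qed.

Lemma taylor_slope_le2 L2 s h eta : 0 <= L2 ->
  (forall x y, `|x| <= K + 1 -> `|y| <= K + 1 -> `|(derive1n 2 f) x - (derive1n 2 f) y| <= L2 * `|x - y|) ->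
  `|s| <= K -> `|h| <= eta -> eta <= 1 ->
  `|(derive1 f) (s + h) - (derive1 f) s - (derive1n 2 f) s * h| <= L2 * eta ^+ 2.
Proof.
move=> L20 hL2 sK he e1; have e0 : 0 <= eta by rewrite (le_trans _ he).
have [c cb e] := mvt_real ddf (s + h) s.
rewrite e addrAC subrr add0r -mulrBl normrM expr2 mulrA.
have cd : `|c - s| <= eta.
  by apply: (between_dist_le _ _ cb); rewrite ?subrr ?normr0// addrAC subrr add0r.
have cK : `|c| <= K + 1 by apply: (between_norm_le _ _ cb); [exact: inK he e1|exact: inK0].
apply: ler_pM => //; rewrite (le_trans (hL2 _ _ cK (inK0 sK)))//.
by rewrite ler_wpM2l.
Qed.

End Remainder.

End ScalarNonlinearity.

(** * Newton's method *)

Section Differences.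
Variables (R : realType) (d : nat) (a : R).
Implicit Types (g h k : 'rV[R]_d -> R).

Lemma C2_sub g h : C2 g -> C2 h -> C2 (fun x => g x - h x).
Proof. by move=> cg ch; rewrite sub_affineE; exact: C2_affine. Qed.

Lemma C2a_sub g h : C2a a g -> C2a a h -> C2a a (fun x => g x - h x).
Proof. by move=> cg ch; rewrite sub_affineE; exact: C2a_affine. Qed.

Lemma lap_sub g h x : C2 g -> C2 h -> lap (fun x => g x - h x) x = lap g x - lap h x.
Proof. by move=> cg ch; rewrite sub_affineE (lap_affine (-1) x ch cg) mulN1r addrC. Qed.

Lemma dot_grad_subr g h k x : C2 g -> C2 h ->
  dot_grad k (fun x => g x - h x) x = dot_grad k g x - dot_grad k h x.
Proof. by move=> cg ch; rewrite sub_affineE (dot_grad_affine k (-1) x ch cg) mulN1r addrC. Qed.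

Lemma dot_grad_subl g h k x : C2 g -> C2 h ->
  dot_grad (fun x => g x - h x) k x = dot_grad g k x - dot_grad h k x.
Proof. by move=> cg ch; rewrite dot_gradC dot_grad_subr// ![dot_grad k _ _]dot_gradC. Qed.

Lemma div_mul_grad_subr g h k x : C2 g -> C2 h -> C2 k ->
  div_mul_grad k (fun x => g x - h x) x = div_mul_grad k g x - div_mul_grad k h x.
Proof.
move=> cg ch ck; rewrite (div_mul_gradE x ck (C2_sub cg ch)) (div_mul_gradE x ck cg) (div_mul_gradE x ck ch).
rewrite dot_grad_subr// lap_sub//.
move: (dot_grad k g x) (dot_grad k h x) (lap g x) (lap h x) => *; ring.
Qed.

Lemma div_mul_grad_subl g h k x : C2 g -> C2 h -> C2 k ->
  div_mul_grad (fun x => g x - h x) k x = div_mul_grad g k x - div_mul_grad h k x.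
Proof.
move=> cg ch ck; rewrite (div_mul_gradE x (C2_sub cg ch) ck) (div_mul_gradE x cg ck) (div_mul_gradE x ch ck).
rewrite dot_grad_subl//.
move: (dot_grad g k x) (dot_grad h k x) (lap k x) => *; ring.
Qed.


End Differences.

Section NewtonStep.
Variables (R : realType) (d : nat) (lam a : R) (m0 : 'rV[R]_d -> R) (f : R -> R).
Hypotheses (lam0 : 0 < lam) (a01 : 0 < a < 1) (Cm0 : C0a a m0) (hf : C1b_C2 f).
Local Notation F := ('rV[R]_d -> R).
Local Notation cd := (cdim R d).

Let a0 : 0 < a. Proof. by case/andP: a01. Qed.
Let a1 : a < 1. Proof. by case/andP: a01. Qed.

Definition newton_step (U M U' M' : F) :=
  let du := fun x => U' x - U x in
  let dm := fun x => M' x - M x in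
  (forall x, U' x + Tsol lam (fun y => G1 f U M y + dG1 f U M du dm y) x = 0) /\
  (forall x, M' x + Tsol lam (fun y => G2 lam m0 U M y + dG2 U M du dm y) x = 0).

Definition slope (M : F) : F := fun x => derive1 f (M x).

Lemma compose_lipschitz (M : F) (K : R) x y : C2 M -> c2a_le a M K ->
  `|M x - M y| <= d%:R * K * `|x - y|.
Proof. by move=> cM MK; exact: c2a_lipschitz0 cM MK x y. Qed.

Lemma slope_c0a (M : F) : C2a a M -> Defs.periodic (slope M) /\ exists H, c0a_le a (slope M) H.
Proof.
move=> CM; have cM := proj1 (proj1 CM); have MK := C2a_le_norm a01 CM.
set K := c2a_norm a M in MK.
split; first by move=> i x; rewrite /slope (proj2 (proj1 CM)).
have [M1 M10 [_ h1 _]] := nonlinearity_bounds hf.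
have [L L0 hL] := derive_lipschitz hf K.
exists (2 * M1 + L * (d%:R * K)); apply: (c0a_le_lipschitz a01) => [x|x y|].
- exact: h1.
- have [MB _ _ _] := MK; have [h _] := hL (M x) (M y) (MB x) (MB y).
  by rewrite (le_trans h)// -mulrA ler_wpM2l//; exact: compose_lipschitz.
- by rewrite mulr_ge0// mulr_ge0//; exact: c2a_le_ge0 MK.
Qed.

Lemma nonlinearity_c0a (M : F) : C2a a M ->
  Defs.periodic (fun x => f (M x)) /\ exists H, c0a_le a (fun x => f (M x)) H.
Proof.
move=> CM; have cM := proj1 (proj1 CM); have MK := C2a_le_norm a01 CM.
set K := c2a_norm a M in MK.
split; first by move=> i x; rewrite (proj2 (proj1 CM)).
have [M1 M10 [h0 _ h1]] := nonlinearity_bounds hf.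
exists (2 * M1 + M1 * (d%:R * K)); apply: (c0a_le_lipschitz a01) => [x|x y|].
- exact: h0.
- by rewrite (le_trans (h1 _ _))// -mulrA ler_wpM2l//; exact: compose_lipschitz.
- by rewrite mulr_ge0// mulr_ge0//; exact: c2a_le_ge0 MK.
Qed.

Lemma C0a_c0a_le (g : F) : C0a a g -> Defs.periodic g /\ exists H, c0a_le a g H.
Proof.
move=> [pg [_ [[A hA] [B hB]]]]; split=> //; exists (`|A| + `|B|); split=> [x|x y].
  by rewrite (le_trans (hA x))// (le_trans (ler_norm A))// lerDl.
have [->|xy] := eqVneq x y; first by rewrite subrr normr0 mulr_ge0 ?powR_ge0// addr_ge0.
by rewrite (le_trans (hB x y xy))// ler_wpM2r ?powR_ge0// (le_trans (ler_norm B))// lerDr.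
Qed.

Variables (u m : F).
Hypotheses (Cu : C2a a u) (Cm : C2a a m) (mfg : MFG_solution lam m0 f u m).

Let cu : C2 u := proj1 (proj1 Cu).
Let cm : C2 m := proj1 (proj1 Cm).

Let mfg1 x : - lap u x + 2^-1 * dot_grad u u x + lam * u x = f (m x).
Proof. by have [_ [_ [h _]]] := mfg. Qed.
Let mfg2 x : - lap m x - div_mul_grad m u x + lam * m x = lam * m0 x.
Proof. by have [_ [_ [_ h]]] := mfg. Qed.

(** With [err2], the remainder of [G] expanded at the iterate (U, M) and evaluated at the solution
    (u, m). *)
Definition err1 (U M : F) : F := fun x =>
  2^-1 * dot_grad (fun x => U x - u x) (fun x => U x - u x) x - taylor_rem f (M x) (m x - M x).
Definition err2 (U M : F) : F := fun x =>
  - div_mul_grad (fun x => M x - m x) (fun x => U x - u x) x.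

Section Step.
Variables (U M : F).
Hypotheses (CU : C2a a U) (CM : C2a a M).
Let cU : C2 U := proj1 (proj1 CU).
Let cM : C2 M := proj1 (proj1 CM).
Let pU : Defs.periodic U := proj2 (proj1 CU).
Let pM : Defs.periodic M := proj2 (proj1 CM).

Lemma c0a_dot_grad_ex (g h : F) : C2a a g -> C2a a h ->
  Defs.periodic (dot_grad g h) /\ exists H, c0a_le a (dot_grad g h) H.
Proof.
move=> Cg Ch; split; first exact: dot_grad_periodic (proj2 (proj1 Cg)) (proj2 (proj1 Ch)).
eexists; exact: (c0a_dot_grad a01 (proj1 (proj1 Cg)) (C2a_le_norm a01 Cg) (proj1 (proj1 Ch)) (C2a_le_norm a01 Ch)).
Qed.

Lemma c0a_div_mul_grad_ex (g h : F) : C2a a g -> C2a a h ->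
  Defs.periodic (div_mul_grad g h) /\ exists H, c0a_le a (div_mul_grad g h) H.
Proof.
move=> Cg Ch; split; first exact: div_mul_grad_periodic (proj2 (proj1 Cg)) (proj2 (proj1 Ch)).
eexists; exact: (c0a_div_mul_grad a01 (proj1 (proj1 Cg)) (C2a_le_norm a01 Cg) (proj1 (proj1 Ch)) (C2a_le_norm a01 Ch)).
Qed.

Lemma newton_rhs1 (w mu : F) : C2a a w -> C2a a mu ->
  Defs.periodic (fun y => G1 f U M y + dG1 f U M w mu y) /\
  exists H, c0a_le a (fun y => G1 f U M y + dG1 f U M w mu y) H.
Proof.
move=> Cw Cmu; have [p1 [H1 h1]] := c0a_dot_grad_ex CU CU.
have [p2 [H2 h2]] := c0a_dot_grad_ex CU Cw.
have [p3 [H3 h3]] := nonlinearity_c0a CM; have [p4 [H4 h4]] := slope_c0a CM.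
have h5 := c2a_c0a a01 (proj1 (proj1 Cmu)) (C2a_le_norm a01 Cmu).
split.
  move=> i x; rewrite /G1 /dG1 p1 p2 pM (proj2 (proj1 Cmu)).
  by [].
eexists; apply: c0a_leD; first by apply: c0a_leB; [exact: (c0a_leZ 2^-1 h1)|exact: h3].
apply: c0a_leB; [exact: h2|exact: (c0a_leM h4 h5)].
Qed.

Lemma newton_rhs2 (w mu : F) : C2a a w -> C2a a mu ->
  Defs.periodic (fun y => G2 lam m0 U M y + dG2 U M w mu y) /\
  exists H, c0a_le a (fun y => G2 lam m0 U M y + dG2 U M w mu y) H.
Proof.
move=> Cw Cmu; have [p1 [H1 h1]] := c0a_div_mul_grad_ex CM CU.
have [p2 [H2 h2]] := c0a_div_mul_grad_ex Cmu CU.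
have [p3 [H3 h3]] := c0a_div_mul_grad_ex CM Cw; have [p4 [H4 h4]] := C0a_c0a_le Cm0.
split; first by move=> i x; rewrite /G2 /dG2 p1 p2 p3 p4.
eexists; apply: c0a_leD.
  by apply: c0a_leB; [exact: (c0a_leN h1)|exact: (c0a_leZ lam h4)].
by apply: c0a_leB; [exact: (c0a_leN h2)|exact: h3].
Qed.

Let Tsol_neg_eq (g V : F) : C2a a V -> Defs.periodic g -> (exists H, c0a_le a g H) ->
  (forall x, V x + Tsol lam g x = 0) <-> (forall x, - lap V x + lam * V x = - g x).
Proof.
move=> CV pg [H gH]; have [[cT _] eT _] := Tsol_spec lam0 a01 pg gH.
have cV := proj1 CV; have z := proj1 (C2a0 d a).
have negE : (fun x => - V x) = (fun x => (-1) * V x + 0) by apply/funext => x; rewrite mulN1r addr0.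
have lapN x : lap (fun x => - V x) x = - lap V x.
  rewrite negE (lap_affine (-1) x (proj1 cV) (proj1 z)) mulN1r.
  have -> : lap (fun _ : 'rV[R]_d => 0 : R) x = 0.
    rewrite /lap big1// => i _; have -> : pd i (fun _ : 'rV[R]_d => 0 : R) = (fun=> 0).
      by apply/funext => y; exact: derive_cst.
    exact: derive_cst.
  by rewrite addr0.
split=> [h x|h x].
  have e : Tsol lam g = fun x => - V x.
    apply/funext => y; have := h y; move: (Tsol lam g y) (V y) => t v tv; lra.
  by have := eT x; rewrite e lapN; move: (lap V x) (V x) (g x) => l v b; lra.
have cN : C2per (fun x => - V x) by rewrite negE; exact: (C2per_affine (-1) cV z).
have eN y : - lap (fun x => - V x) y + lam * (- V y) = g y.
  by rewrite lapN; have := h y; move: (lap V y) (V y) (g y) => l v b; lra.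
rewrite (Tsol_eq lam0 cN eN).
by rewrite subrr.
Qed.

(** By uniqueness for [- lap + lam] the fixed-point form of the step is a pair of differential
    equations. Subtracting the equations of (u, m), with [G] expanded at (U, M), leaves the
    linearized operator acting on the new error. *)
Lemma newton_stepP (U' M' : F) : C2a a U' -> C2a a M' ->
  newton_step U M U' M' <->
  (forall x, lin1 lam (slope M) U (fun x => U' x - u x) (fun x => M' x - m x) x = err1 U M x) /\
  (forall x, lin2 lam U M (fun x => U' x - u x) (fun x => M' x - m x) x = err2 U M x).
Proof.
move=> CU' CM'; have cU' := proj1 (proj1 CU'); have cM' := proj1 (proj1 CM').
have Cdu := C2a_sub CU' CU; have Cdm := C2a_sub CM' CM.
have [q1 b1] := newton_rhs1 Cdu Cdm; have [q2 b2] := newton_rhs2 Cdu Cdm.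
have E1 x : - lap U' x + lam * U' x = - (G1 f U M x + dG1 f U M (fun x => U' x - U x) (fun x => M' x - M x) x)
  <-> lin1 lam (slope M) U (fun x => U' x - u x) (fun x => M' x - m x) x = err1 U M x.
  rewrite /G1 /dG1 /lin1 /err1 /slope /taylor_rem.
  have -> : M x + (m x - M x) = m x by ring.
  rewrite (dot_grad_subr U x cU' cU) (dot_grad_subr U x cU' cu) (lap_sub x cU' cu).
  rewrite (dot_grad_subr _ x cU cu) (dot_grad_subl U x cU cu) (dot_grad_subl u x cU cu).
  rewrite (dot_gradC u U x).
  have := mfg1 x.
  move: (lap U' x) (lap u x) (dot_grad U U x) (dot_grad U U' x) (dot_grad U u x) (dot_grad u u x)
    (f (M x)) (f (m x)) (derive1 f (M x)) (U' x) (u x) (M' x) (M x) (m x) => *.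
  by split=> *; lra.
have E2 x : - lap M' x + lam * M' x = - (G2 lam m0 U M x + dG2 U M (fun x => U' x - U x) (fun x => M' x - M x) x)
  <-> lin2 lam U M (fun x => U' x - u x) (fun x => M' x - m x) x = err2 U M x.
  rewrite /G2 /dG2 /lin2 /err2.
  rewrite (lap_sub x cM' cm) (div_mul_grad_subl x cM' cM cU) (div_mul_grad_subr x cU' cU cM).
  rewrite (div_mul_grad_subl x cM' cm cU) (div_mul_grad_subr x cU' cu cM).
  rewrite (div_mul_grad_subl x cM cm (C2_sub cU cu)) (div_mul_grad_subr x cU cu cM).
  rewrite (div_mul_grad_subr x cU cu cm).
  have := mfg2 x.
  move: (lap M' x) (lap m x) (div_mul_grad M U x) (div_mul_grad M' U x) (div_mul_grad M U' x)
    (div_mul_grad m U x) (div_mul_grad M u x) (div_mul_grad m u x) (m0 x) (M' x) (m x) => *.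
  by split=> *; lra.
have [T1 T1'] := Tsol_neg_eq CU' q1 b1; have [T2 T2'] := Tsol_neg_eq CM' q2 b2.
split=> [[h1 h2]|[h1 h2]].
  by split=> x; [apply/E1; exact: T1|apply/E2; exact: T2].
by split; [apply: T1' => x; apply/E1|apply: T2' => x; apply/E2].
Qed.

End Step.

End NewtonStep.

Section PerturbationArithmetic.
Variables (R : realType) (D c q k x y : R).
Hypotheses (D0 : 0 <= D) (c0 : 0 <= c) (q0 : 0 <= q) (k0 : 0 <= k) (x0 : 0 <= x) (y0 : 0 <= y).

(** Here q is the distance to (u, m), k the size of the slope perturbation, and x, y are the norms
    of the two unknowns in [perturbed_estimate]. *)
Lemma perturbation_arith : let Q := (4 * D * c ^+ 2 * q + 2 * k * c) * (x + y) in
  D * (2 * (c * q * (c * x))) + 2 * (k * (c * y)) <= Q /\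
  4 * D * (c * y * (c * q)) + 4 * D * (c * q * (c * x)) <= Q.
Proof.
have X : 0 <= D * c ^+ 2 * q by rewrite mulr_ge0// mulr_ge0// exprn_ge0.
have Y : 0 <= k * c by rewrite mulr_ge0.
have X1 := mulr_ge0 X x0; have X2 := mulr_ge0 X y0.
have Y1 := mulr_ge0 Y x0; have Y2 := mulr_ge0 Y y0.
split; nra.
Qed.

End PerturbationArithmetic.

Lemma quarter2 (R : realType) : 4^-1 + 4^-1 <= 2^-1 :> R.
Proof. lra. Qed.

Lemma absorb_half (R : realType) (N C H Q : R) :
  N <= C * (H + Q) -> C * Q <= 2^-1 * N -> N <= 2 * C * H.
Proof. by rewrite mulrDr -mulrA => h1 h2; lra. Qed.

Section LocalConvergence.
Variables (R : realType) (d : nat) (lam a : R) (m0 : 'rV[R]_d -> R) (f : R -> R).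
Hypotheses (lam0 : 0 < lam) (a01 : 0 < a < 1) (Cm0 : C0a a m0) (hf : C1b_C2 f).
Local Notation F := ('rV[R]_d -> R).
Local Notation cd := (cdim R d).

Let a0 : 0 < a. Proof. by case/andP: a01. Qed.
Let a1 : a < 1. Proof. by case/andP: a01. Qed.
Let cd1 : 1 <= cd := cdim_ge1 R d.

Lemma c2a_le_near (m M : F) (K D : R) : C2a a m -> C2a a M -> c2a_le a m K ->
  c2a_le a (fun x => M x - m x) D -> c2a_le a M (K + D).
Proof.
move=> Cm CM mK MD.
have -> : M = fun x => 1 * (M x - m x) + m x by apply/funext => x; ring.
have -> : K + D = `|1| * D + K by rewrite normr1; ring.
exact: c2a_le_affine (proj1 (proj1 (C2a_sub CM Cm))) (proj1 (proj1 Cm)) MD mK.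
Qed.

(** The difference of slopes is small in the sup norm but only bounded in the Lipschitz norm, the
    second derivative of f being merely continuous; interpolation gives smallness in C^{0,a}. *)
Lemma slope_perturbation (m : F) (e : R) : C2a a m -> 0 < e -> exists2 D, 0 < D &
  forall M, C2a a M -> c2a_norm a (fun x => M x - m x) <= D ->
  c0a_le a (fun x => slope f M x - slope f m x) e.
Proof.
move=> Cm e0; have mK := C2a_le_norm a01 Cm; set K := c2a_norm a m in mK.
have K0 : 0 <= K := c2a_le_ge0 mK.
have [L L0 hL] := derive_lipschitz hf (K + 1).
pose B := L * (d%:R * (K + 1)) + L * (d%:R * (K + 1)) + 1.
have B1 : 0 <= L * (d%:R * (K + 1)) by rewrite !mulr_ge0// addr_ge0.
have B0 : 0 < B by rewrite /B; lra.
have [A A0 [Ae Ai]] := small_interpolation a01 B e0.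
have L1 : 0 < L + 1 by rewrite ltr_wpDl.
exists (Num.min 1 (A / (L + 1))) => [|M CM].
  by rewrite lt_min ltr01 divr_gt0.
rewrite le_min => /andP[D1 DA].
have CD := C2a_sub CM Cm.
have MK := c2a_le_mono D1 (C2a_le_norm a01 CD).
have MK' := c2a_le_near Cm CM mK MK.
have mK' : c2a_le a m (K + 1) by apply: c2a_le_mono mK; rewrite lerDl.
have [b1 _ _ _] := MK'; have [b2 _ _ _] := mK'.
have [b3 _ _ _] := C2a_le_norm a01 CD.
apply: (c0a_le_interpolation a01 A0 B0) => // [x|x y].
  have [h _] := hL (M x) (m x) (b1 x) (b2 x).
  apply: (le_trans h); apply: (@le_trans _ _ (L * (A / (L + 1)))).
    by rewrite ler_wpM2l// (le_trans (b3 x)).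
  rewrite mulrA ler_pdivrMr// mulrC ler_wpM2l ?(ltW A0)//; lra.
have [h1 _] := hL (M x) (M y) (b1 x) (b1 y).
have [h2 _] := hL (m x) (m y) (b2 x) (b2 y).
have l1 := compose_lipschitz x y (proj1 (proj1 CM)) MK'.
have l2 := compose_lipschitz x y (proj1 (proj1 Cm)) mK'.
have g1 : `|slope f M x - slope f M y| <= L * (d%:R * (K + 1)) * `|x - y|.
  by apply: (le_trans h1); rewrite -mulrA ler_wpM2l.
have g2 : `|slope f m x - slope f m y| <= L * (d%:R * (K + 1)) * `|x - y|.
  by apply: (le_trans h2); rewrite -mulrA ler_wpM2l.
have -> : slope f M x - slope f m x - (slope f M y - slope f m y)
  = (slope f M x - slope f M y) - (slope f m x - slope f m y) by ring.
apply: (le_trans (ler_normB _ _)); apply: (le_trans (lerD g1 g2)).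
rewrite -mulrDl ler_wpM2r// /B; lra.
Qed.

Lemma c0a_le_derivatives (v : F) : C2a a v -> exists V,
  [/\ c0a_le a v V, forall i, c0a_le a (pd i v) V & c0a_le a (lap v) V].
Proof.
move=> Cv; have cv := proj1 (proj1 Cv); have [K vK] := C2a_bounded a01 Cv.
have K0 : 0 <= cd * K by rewrite mulr_ge0 ?(c2a_le_ge0 vK)// (le_trans _ cd1).
have dK : 0 <= d%:R * (cd * K) by rewrite mulr_ge0.
have h : cd * K <= cd * K + d%:R * (cd * K) by rewrite lerDl.
exists (cd * K + d%:R * (cd * K)); split=> [|i|].
- exact: c0a_le_mono h (c2a_c0a a01 cv vK).
- exact: c0a_le_mono h (c2a_c0a_pd a01 cv vK i).
- have h2 : d%:R * (cd * K) <= cd * K + d%:R * (cd * K) by rewrite lerDr.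
  exact: c0a_le_mono h2 (c2a_c0a_lap vK).
Qed.

Lemma c0a_le_common (phi v rho : F) : C2a a v -> C2a a rho ->
  (exists H, c0a_le a phi H) -> exists M,
  [/\ c0a_le a phi M, forall i, c0a_le a (pd i v) M, c0a_le a (lap v) M, c0a_le a rho M
    & forall i, c0a_le a (pd i rho) M].
Proof.
move=> Cv Cr [H pH].
have [V [v1 v2 v3]] := c0a_le_derivatives Cv; have [P [r1 r2 r3]] := c0a_le_derivatives Cr.
have H0 := c0a_le_ge0 pH; have V0 := c0a_le_ge0 v1; have P0 := c0a_le_ge0 r1.
have h1 : H <= H + V + P by lra.
have h2 : V <= H + V + P by lra.
have h3 : P <= H + V + P by lra.
exists (H + V + P); split=> [|i|||i].
- exact: c0a_le_mono h1 pH.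
- exact: c0a_le_mono h2 (v2 i).
- exact: c0a_le_mono h2 v3.
- exact: c0a_le_mono h3 r1.
- exact: c0a_le_mono h3 (r2 i).
Qed.

Variables (u m : F).
Hypotheses (Cu : C2a a u) (Cm : C2a a m).
Hypotheses (mfg : MFG_solution lam m0 f u m) (stab : stable lam f u m).

Let cu : C2 u := proj1 (proj1 Cu).
Let cm : C2 m := proj1 (proj1 Cm).

(** Stability, restricted to C^{2,a} pairs, is the injectivity hypothesis of [linear_estimate]. *)
Lemma stable_estimate : exists2 C, 0 < C & forall w mu xi zeta H, C2a a w -> C2a a mu ->
  Defs.periodic xi -> Defs.periodic zeta -> c0a_le a xi H -> c0a_le a zeta H ->
  (forall x, lin1 lam (slope f m) u w mu x = xi x) -> (forall x, lin2 lam u m w mu x = zeta x) ->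
  c2a_norm a w + c2a_norm a mu <= C * H.
Proof.
have [ps hs] := slope_c0a a01 hf Cm.
have [M [h1 h2 h3 h4 h5]] := c0a_le_common Cu Cm hs.
apply: (linear_estimate lam0 a01 ps Cu Cm h1 h2 h3 h4 h5) => w mu Cw Cmu e1 e2.
apply: stab; [exact: (proj1 Cw)|exact: (proj1 Cmu)| |] => x.
  by have := e1 x; rewrite /lin1 /slope => /eqP; rewrite subr_eq0 => /eqP.
by have := e2 x; rewrite /lin2 => /eqP; rewrite subr_eq0 => /eqP.
Qed.

Lemma perturbed_lin1 (U M w mu : F) x : C2 U -> C2 w ->
  lin1 lam (slope f m) u w mu x = lin1 lam (slope f M) U w mu x
    - dot_grad (fun x => U x - u x) w x + (slope f M x - slope f m x) * mu x.
Proof.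
move=> cU cw; rewrite /lin1 (dot_grad_subl w x cU cu).
move: (lap w x) (dot_grad u w x) (dot_grad U w x) (slope f M x) (slope f m x) => *; ring.
Qed.

Lemma perturbed_lin2 (U M w mu : F) x : C2 U -> C2 M -> C2 w -> C2 mu ->
  lin2 lam u m w mu x = lin2 lam U M w mu x
    + div_mul_grad mu (fun x => U x - u x) x + div_mul_grad (fun x => M x - m x) w x.
Proof.
move=> cU cM cw cmu; rewrite /lin2 (div_mul_grad_subr x cU cu cmu) (div_mul_grad_subl x cM cm cw).
move: (lap mu x) (div_mul_grad mu U x) (div_mul_grad mu u x) (div_mul_grad M w x)
  (div_mul_grad m w x) => *; ring.
Qed.

Lemma perturbed_estimate : exists D C, [/\ 0 < D, D <= 1, 0 < C & forall U M, C2a a U -> C2a a M ->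
  c2a_norm a (fun x => U x - u x) <= D -> c2a_norm a (fun x => M x - m x) <= D ->
  forall w mu xi zeta H, C2a a w -> C2a a mu ->
  Defs.periodic xi -> Defs.periodic zeta -> c0a_le a xi H -> c0a_le a zeta H ->
  (forall x, lin1 lam (slope f M) U w mu x = xi x) -> (forall x, lin2 lam U M w mu x = zeta x) ->
  c2a_norm a w + c2a_norm a mu <= C * H].
Proof.
have [C C0 hC] := stable_estimate.
have cd0 : 0 < cd by rewrite (lt_le_trans _ cd1).
(* The numbers k, for the slope, and q below, for the distance to (u, m), make C times each
   perturbation at most a quarter of the norm of the unknown. The summand 1 in q covers d = 0. *)
pose k := (8 * C * cd)^-1.
have k0 : 0 < k by rewrite invr_gt0 !mulr_gt0.
have [D1 D10 hD1] := slope_perturbation Cm k0.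
pose q := (16 * C * (d%:R + 1) * cd ^+ 2)^-1.
have d1 : 0 < d%:R + 1 :> R by rewrite ltr_wpDl.
have q0 : 0 < q by rewrite invr_gt0 !mulr_gt0// exprn_gt0.
pose D := Num.min 1 (Num.min D1 q).
exists D, (2 * C); split; [by rewrite !lt_min ltr01 D10 q0|by rewrite ge_min lexx|by rewrite mulr_gt0|].
move=> U M CU CM UD MD w mu xi zeta H Cw Cmu pxi pze xH zH e1 e2.
have MD1 : c2a_norm a (fun x => M x - m x) <= D1 by rewrite (le_trans MD)// !ge_min lexx orbT.
have Uq : c2a_norm a (fun x => U x - u x) <= q by rewrite (le_trans UD)// !ge_min lexx !orbT.
have Mq : c2a_norm a (fun x => M x - m x) <= q by rewrite (le_trans MD)// !ge_min lexx !orbT.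
have CdU := C2a_sub CU Cu; have CdM := C2a_sub CM Cm.
have cU := proj1 (proj1 CU); have cM := proj1 (proj1 CM).
have cw := proj1 (proj1 Cw); have cmu := proj1 (proj1 Cmu).
have cdU := proj1 (proj1 CdU); have cdM := proj1 (proj1 CdM).
have bU := c2a_le_mono Uq (C2a_le_norm a01 CdU).
have bM := c2a_le_mono Mq (C2a_le_norm a01 CdM).
have bw := C2a_le_norm a01 Cw; have bmu := C2a_le_norm a01 Cmu.
have w0 := c2a_le_ge0 bw; have mu0 := c2a_le_ge0 bmu; have H0 := c0a_le_ge0 xH.
have t1 := c0a_dot_grad a01 cdU bU cw bw.
have t2 := c0a_leM (hD1 M CM MD1) (c2a_c0a a01 cmu bmu).
have t3 := c0a_div_mul_grad a01 cmu bmu cdU bU.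
have t4 := c0a_div_mul_grad a01 cdM bM cw bw.
set nw := c2a_norm a w in bw w0 t1 t4 *; set nm := c2a_norm a mu in bmu mu0 t2 t3 *.
have s1 := c0a_leD (c0a_leB xH t1) t2.
have s2 := c0a_leD (c0a_leD zH t3) t4.
pose Q := (4 * d%:R * cd ^+ 2 * q + 2 * k * cd) * (nw + nm).
have kk : C * (2 * k * cd) <= 4^-1.
  by have -> : C * (2 * k * cd) = 4^-1 by rewrite /k; field; rewrite !gt_eqF.
have qq : C * (4 * d%:R * cd ^+ 2 * q) <= 4^-1.
  have -> : C * (4 * d%:R * cd ^+ 2 * q) = 4^-1 * (d%:R / (d%:R + 1)).
    by rewrite /q; field; rewrite !gt_eqF.
  by rewrite ler_piMr ?invr_ge0// ler_pdivrMr// mul1r lerDl.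
have [ar1 ar2] := perturbation_arith (ler0n R d) (ltW cd0) (ltW q0) (ltW k0) w0 mu0.
have [pdU _] := c0a_dot_grad_ex a01 CdU Cw; have [ps _] := slope_c0a a01 hf Cm.
have [psM _] := slope_c0a a01 hf CM.
have [p3 _] := c0a_div_mul_grad_ex a01 Cmu CdU; have [p4 _] := c0a_div_mul_grad_ex a01 CdM Cw.
have pmu := proj2 (proj1 Cmu).
have r1 : c0a_le a (fun x => xi x - dot_grad (fun x => U x - u x) w x
    + (slope f M x - slope f m x) * mu x) (H + Q).
  by apply: c0a_le_mono s1; rewrite -addrA lerD2l; exact: ar1.
have r2 : c0a_le a (fun x => zeta x + div_mul_grad mu (fun x => U x - u x) x
    + div_mul_grad (fun x => M x - m x) w x) (H + Q).
  by apply: c0a_le_mono s2; rewrite -addrA lerD2l; exact: ar2.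
have g : nw + nm <= C * (H + Q).
  apply: (hC w mu _ _ _ Cw Cmu _ _ r1 r2).
  - by move=> i x; rewrite pxi pdU ps psM pmu.
  - by move=> i x; rewrite pze p3 p4.
  - by move=> x; rewrite -e1; exact: perturbed_lin1.
  - by move=> x; rewrite -e2; exact: perturbed_lin2.
have CQ : C * Q <= 2^-1 * (nw + nm).
  have n0 : 0 <= nw + nm := addr_ge0 w0 mu0.
  have e4 : C * (4 * d%:R * cd ^+ 2 * q + 2 * k * cd) <= 2^-1.
    by rewrite mulrDr (le_trans (lerD qq kk))// quarter2.
  by rewrite /Q mulrA; exact: ler_wpM2r.
exact: absorb_half g CQ.
Qed.

Lemma err_periodic (U M : F) : C2a a U -> C2a a M ->
  Defs.periodic (err1 f u m U M) /\ Defs.periodic (err2 u m U M).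
Proof.
move=> CU CM; have CdU := C2a_sub CU Cu; have CdM := C2a_sub CM Cm.
have [p1 _] := c0a_dot_grad_ex a01 CdU CdU; have [p2 _] := c0a_div_mul_grad_ex a01 CdM CdU.
have pM := proj2 (proj1 CM); have pm := proj2 (proj1 Cm).
by split=> i x; rewrite ?/err1 ?/err2 ?p1 ?p2 ?pM ?pm.
Qed.

Lemma err2_le (U M : F) (e : R) : C2a a U -> C2a a M ->
  c2a_norm a (fun x => U x - u x) <= e -> c2a_norm a (fun x => M x - m x) <= e ->
  c0a_le a (err2 u m U M) (4 * d%:R * cd ^+ 2 * e ^+ 2).
Proof.
move=> CU CM Ue Me; have CdU := C2a_sub CU Cu; have CdM := C2a_sub CM Cm.
have -> : 4 * d%:R * cd ^+ 2 * e ^+ 2 = 4 * d%:R * (cd * e * (cd * e)) by ring.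
apply: c0a_leN; apply: (c0a_div_mul_grad a01 (proj1 (proj1 CdM)) _ (proj1 (proj1 CdU))).
  exact: c2a_le_mono Me (C2a_le_norm a01 CdM).
exact: c2a_le_mono Ue (C2a_le_norm a01 CdU).
Qed.

Lemma err1_le (U M : F) (e H : R) : C2a a U ->
  c2a_norm a (fun x => U x - u x) <= e -> c0a_le a (fun x => taylor_rem f (M x) (m x - M x)) H ->
  c0a_le a (err1 f u m U M) (d%:R * cd ^+ 2 * e ^+ 2 + H).
Proof.
move=> CU Ue hH; have CdU := C2a_sub CU Cu; have c := proj1 (proj1 CdU).
have b := c2a_le_mono Ue (C2a_le_norm a01 CdU).
have -> : d%:R * cd ^+ 2 * e ^+ 2 + H = `|2^-1| * (d%:R * (2 * (cd * e * (cd * e)))) + H.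
  by rewrite ger0_norm ?invr_ge0//; field.
exact: c0a_leB (c0a_leZ 2^-1 (c0a_dot_grad a01 c b c b)) hH.
Qed.

(** In the Lipschitz bound the variation of the increment m - M gives order e^2; the variation of
    the base point M gives only order e. *)
Lemma rem_bounds : exists2 Q, 0 < Q & forall M e, C2a a M ->
  c2a_norm a (fun x => M x - m x) <= e -> e <= 1 ->
  (forall x, `|taylor_rem f (M x) (m x - M x)| <= Q * e ^+ 2) /\
  (forall x y, `|taylor_rem f (M x) (m x - M x) - taylor_rem f (M y) (m y - M y)|
     <= Q * e * `|x - y|).
Proof.
have mK := C2a_le_norm a01 Cm; set K := c2a_norm a m in mK; have K0 := c2a_le_ge0 mK.
have [L L0 hL] := derive_lipschitz hf (K + 1 + 1).
have X0 : 0 <= L * d%:R by rewrite mulr_ge0.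
have Y0 : 0 <= 2 * L * (d%:R * (K + 1)) by rewrite !mulr_ge0// addr_ge0.
exists (L + L * d%:R + 2 * L * (d%:R * (K + 1)) + 1) => [|M e CM Me e1]; first by lra.
have CdM := C2a_sub CM Cm; have bd := c2a_le_mono Me (C2a_le_norm a01 CdM).
have e0 : 0 <= e := c2a_le_ge0 bd.
have bM : c2a_le a M (K + 1) := c2a_le_near Cm CM mK (c2a_le_mono e1 bd).
have [b1 _ _ _] := bM; have [b2 _ _ _] := bd.
have b2' x : `|m x - M x| <= e by rewrite distrC; exact: b2.
split=> [x|x y].
  apply: (le_trans (taylor_rem_le hf L0 hL (b1 x) (b2' x) e1)).
  by rewrite ler_wpM2r ?sqr_ge0//; lra.
have hS s : `|s| <= K + 1 ->
    `|derive1 f (s + (m y - M y)) - derive1 f s - derive1n 2 f s * (m y - M y)| <= 2 * L * e.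
  by move=> sK; exact: (taylor_slope_le L0 hL sK (b2' y) e1).
apply: (le_trans (taylor_rem_lipschitz hf L0 hL (b1 x) (b1 y) (b2' x) (b2' y) e1 hS)).
have l1 : `|m x - M x - (m y - M y)| <= d%:R * e * `|x - y|.
  have -> : m x - M x - (m y - M y) = - ((M x - m x) - (M y - m y)) by ring.
  by rewrite normrN; exact: (compose_lipschitz x y (proj1 (proj1 CdM)) bd).
have l2 := compose_lipschitz x y (proj1 (proj1 CM)) bM.
have Le : 0 <= L * e by rewrite mulr_ge0.
have Le2 : 0 <= 2 * L * e by rewrite mulr_ge0// mulr_ge0.
apply: (le_trans (lerD (ler_wpM2l Le l1) (ler_wpM2l Le2 l2))).
rewrite !mulrA -mulrDl ler_wpM2r//.
have -> : L * e * d%:R * e + 2 * L * e * d%:R * (K + 1)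
  = L * d%:R * e * e + 2 * L * (d%:R * (K + 1)) * e by ring.
have Xe : 0 <= L * d%:R * e by rewrite mulr_ge0.
have Xee : L * d%:R * e * e <= L * d%:R * e by rewrite ler_piMr.
rewrite !mulrDl; move: Le e0 Xee; move: (L * e) (L * d%:R * e) => *; lra.
Qed.

Lemma rem_c0a : exists2 Q, 0 < Q & forall M e, C2a a M ->
  c2a_norm a (fun x => M x - m x) <= e -> e <= 1 ->
  c0a_le a (fun x => taylor_rem f (M x) (m x - M x)) (Q * (e * e `^ (1 - a))).
Proof.
have [Q Q0 hQ] := rem_bounds; exists (2 * Q) => [|M e CM Me e1]; first by rewrite mulr_gt0.
have [h1 h2] := hQ M e CM Me e1.
have e0 : 0 <= e := le_trans (c2a_norm_ge0 a _) Me.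
have p0 : 0 <= 1 - a by rewrite subr_ge0 ltW.
move: e0; rewrite le_eqVlt => /predU1P[e0|e0].
  (* Interpolation requires positive bounds, so e = 0, where the remainder vanishes, is treated
     separately. *)
  rewrite -e0 mul0r mulr0.
  have z x : taylor_rem f (M x) (m x - M x) = 0.
    by apply/eqP; rewrite -normr_le0 (le_trans (h1 x))// -e0 expr0n mulr0.
  by split=> [x|x y]; rewrite !z ?subrr normr0// mul0r.
have ee : e <= e `^ (1 - a).
  by apply: powR_ge_id; rewrite ?(ltW e0)//; apply/andP; split; have := a0; have := a1; lra.
have A0 : 0 < Q * e ^+ 2 by rewrite mulr_gt0// exprn_gt0.
have B0 : 0 < Q * e by rewrite mulr_gt0.
apply: (c0a_le_interpolation a01 A0 B0 h1 h2).
  have -> : 2 * Q * (e * e `^ (1 - a)) = Q * (e * e `^ (1 - a)) + Q * (e * e `^ (1 - a)) by ring.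
  have l : Q * e ^+ 2 <= Q * (e * e `^ (1 - a)).
    by rewrite ler_wpM2l ?(ltW Q0)// expr2 ler_wpM2l// ltW.
  by rewrite (le_trans l)// lerDl (le_trans (ltW A0) l).
rewrite -mulrA ler_wpM2l//; apply: le_of_eq.
rewrite expr2 mulrA (powRM _ (ltW B0) (ltW e0)) mulrAC -powRD; last by rewrite (gt_eqF B0) implybT.
by rewrite subrK powRr1 ?(ltW B0)// mulrA.
Qed.

Lemma rem_c0a_quadratic : C21loc f -> exists2 Q, 0 <= Q & forall M e, C2a a M ->
  c2a_norm a (fun x => M x - m x) <= e -> e <= 1 ->
  c0a_le a (fun x => taylor_rem f (M x) (m x - M x)) (Q * e ^+ 2).
Proof.
move=> [_ [_ [_ f21]]].
have mK := C2a_le_norm a01 Cm; set K := c2a_norm a m in mK; have K0 := c2a_le_ge0 mK.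
have [L L0 hL] := derive_lipschitz hf (K + 1 + 1).
have [L2' hL2'] := f21 (K + 1 + 1); pose L2 := `|L2'|.
have hL2 x y : `|x| <= K + 1 + 1 -> `|y| <= K + 1 + 1 ->
    `|derive1n 2 f x - derive1n 2 f y| <= L2 * `|x - y|.
  by move=> xK yK; rewrite (le_trans (hL2' x y xK yK))// ler_wpM2r// ler_norm.
have L20 : 0 <= L2 := normr_ge0 _.
exists (2 * L + (L * d%:R + L2 * (d%:R * (K + 1)))) => [|M e CM Me e1].
  by rewrite addr_ge0 ?mulr_ge0// addr_ge0 ?mulr_ge0// addr_ge0.
have CdM := C2a_sub CM Cm; have bd := c2a_le_mono Me (C2a_le_norm a01 CdM).
have e0 : 0 <= e := c2a_le_ge0 bd.
have bM : c2a_le a M (K + 1) := c2a_le_near Cm CM mK (c2a_le_mono e1 bd).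
have [b1 _ _ _] := bM; have [b2 _ _ _] := bd.
have b2' x : `|m x - M x| <= e by rewrite distrC; exact: b2.
rewrite mulrDl -mulrA; apply: (c0a_le_lipschitz a01) => [x|x y|].
- exact: (taylor_rem_le hf L0 hL (b1 x) (b2' x) e1).
- have hS s : `|s| <= K + 1 ->
    `|derive1 f (s + (m y - M y)) - derive1 f s - derive1n 2 f s * (m y - M y)| <= L2 * e ^+ 2.
    by move=> sK; exact: (taylor_slope_le2 hf L20 hL2 sK (b2' y) e1).
  apply: (le_trans (taylor_rem_lipschitz hf L0 hL (b1 x) (b1 y) (b2' x) (b2' y) e1 hS)).
  have l1 : `|m x - M x - (m y - M y)| <= d%:R * e * `|x - y|.
    have -> : m x - M x - (m y - M y) = - ((M x - m x) - (M y - m y)) by ring.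
    by rewrite normrN; exact: (compose_lipschitz x y (proj1 (proj1 CdM)) bd).
  have l2 := compose_lipschitz x y (proj1 (proj1 CM)) bM.
  have Le : 0 <= L * e by rewrite mulr_ge0.
  have Le2 : 0 <= L2 * e ^+ 2 by rewrite mulr_ge0// sqr_ge0.
  apply: (le_trans (lerD (ler_wpM2l Le l1) (ler_wpM2l Le2 l2))).
  by apply: le_of_eq; ring.
- by rewrite mulr_ge0 ?sqr_ge0// addr_ge0 ?mulr_ge0// addr_ge0.
Qed.

End LocalConvergence.

Section SmallPowers.
Variable R : realType.

Lemma eq_of_shift (x y c : R) : x - c - (y - c) = 0 -> x = y.
Proof. lra. Qed.

Lemma summands_le (x y c : R) : 0 <= x -> 0 <= y -> x + y <= c -> x <= c /\ y <= c.
Proof. by move=> *; split; lra. Qed.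

Lemma powR_small (b e : R) : 0 < b -> 0 < e ->
  exists2 D, 0 < D & forall x, 0 <= x -> x <= D -> x `^ b <= e.
Proof.
move=> b0 e0; exists (e `^ b^-1) => [|x x0 xD]; first exact: powR_gt0.
have -> : e = (e `^ b^-1) `^ b by rewrite -powRrM mulVf ?gt_eqF// powRr1// ltW.
by apply: ge0_ler_powR; rewrite ?nnegrE ?powR_ge0// ltW.
Qed.

(** The products e k * 2^k never exceed e 0, and 2^k >= k passes any bound by the Archimedean
    property. *)
Lemma half_geometric_small (e : nat -> R) (c : R) : 0 < c -> (forall k, 0 <= e k) ->
  (forall k, e k.+1 <= 2^-1 * e k) -> exists N, forall k, (N <= k)%N -> e k <= c.
Proof.
move=> c0 e0 eh.
have g k : e k * 2 ^+ k <= e 0%N.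
  elim: k => [|k IH]; first by rewrite expr0 mulr1.
  apply: le_trans IH; rewrite exprS mulrA ler_wpM2r ?exprn_ge0//.
  by have := eh k; move: (e k.+1) (e k) => *; lra.
have q0 : 0 <= e 0%N / c by rewrite divr_ge0// ltW.
exists (Num.bound (e 0%N / c)) => k Nk.
have B := archi_boundP q0.
have k2 : k%:R <= 2 ^+ k :> R by rewrite -natrX ler_nat ltnW// ltn_expl.
have Bk : (Num.bound (e 0%N / c))%:R <= k%:R :> R by rewrite ler_nat.
have p0 : 0 < 2 ^+ k :> R by rewrite exprn_gt0.
rewrite -(ler_pM2r p0); apply: (le_trans (g k)).
rewrite -ler_pdivrMl// mulrC; apply: (le_trans (ltW B)); exact: (le_trans Bk).
Qed.

End SmallPowers.

Section LinearDifference.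
Variables (R : realType) (d : nat) (lam : R).
Implicit Types (phi v rho w mu : 'rV[R]_d -> R).

Lemma lin1_sub phi v w mu w' mu' x : C2 w -> C2 w' ->
  lin1 lam phi v (fun x => w x - w' x) (fun x => mu x - mu' x) x
  = lin1 lam phi v w mu x - lin1 lam phi v w' mu' x.
Proof.
move=> cw cw'; rewrite /lin1 (lap_sub x cw cw') (dot_grad_subr v x cw cw').
move: (lap w x) (lap w' x) (dot_grad v w x) (dot_grad v w' x) => *; ring.
Qed.

Lemma lin2_sub v rho w mu w' mu' x : C2 v -> C2 rho -> C2 w -> C2 w' -> C2 mu -> C2 mu' ->
  lin2 lam v rho (fun x => w x - w' x) (fun x => mu x - mu' x) x
  = lin2 lam v rho w mu x - lin2 lam v rho w' mu' x.
Proof.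
move=> cv cr cw cw' cmu cmu'; rewrite /lin2 (lap_sub x cmu cmu').
rewrite (div_mul_grad_subl x cmu cmu' cv) (div_mul_grad_subr x cw cw' cr).
move: (lap mu x) (lap mu' x) (div_mul_grad mu v x) (div_mul_grad mu' v x)
  (div_mul_grad rho w x) (div_mul_grad rho w' x) => *; ring.
Qed.

End LinearDifference.

Section NewtonConvergence.
Variables (R : realType) (d : nat) (lam a : R) (m0 : 'rV[R]_d -> R) (f : R -> R).
Hypotheses (lam0 : 0 < lam) (a01 : 0 < a < 1) (Cm0 : C0a a m0) (hf : C1b_C2 f).
Local Notation F := ('rV[R]_d -> R).
Local Notation cd := (cdim R d).
Variables (u m : F).
Hypotheses (Cu : C2a a u) (Cm : C2a a m).
Hypotheses (mfg : MFG_solution lam m0 f u m) (stab : stable lam f u m).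

Let a0 : 0 < a. Proof. by case/andP: a01. Qed.
Let a1 : a < 1. Proof. by case/andP: a01. Qed.
Let cu : C2 u := proj1 (proj1 Cu).
Let cm : C2 m := proj1 (proj1 Cm).

Lemma c2a_norm_eq0 (w : F) : C2a a w -> c2a_norm a w <= 0 -> w = (fun=> 0).
Proof.
move=> Cw w0; have [h _ _ _] := C2a_le_norm a01 Cw.
by apply/funext => x; apply/eqP; rewrite -normr_le0 (le_trans (h x)).
Qed.

Let dist_le (U M : F) (D : R) : c2a_dist a U M u m <= D ->
  c2a_norm a (fun x => U x - u x) <= D /\ c2a_norm a (fun x => M x - m x) <= D.
Proof.
exact: summands_le (c2a_norm_ge0 _ _) (c2a_norm_ge0 _ _).
Qed.

Lemma newton_step_estimate : exists D C, [/\ 0 < D, D <= 1, 0 < C &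
  forall U M, C2a a U -> C2a a M -> c2a_dist a U M u m <= D ->
  [/\ exists U' M', [/\ C2a a U', C2a a M' & newton_step lam m0 f U M U' M'],
      forall U' M' H, C2a a U' -> C2a a M' -> newton_step lam m0 f U M U' M' ->
        c0a_le a (err1 f u m U M) H -> c0a_le a (err2 u m U M) H ->
        c2a_dist a U' M' u m <= C * H &
      forall U1 M1 U2 M2, C2a a U1 -> C2a a M1 -> C2a a U2 -> C2a a M2 ->
        newton_step lam m0 f U M U1 M1 -> newton_step lam m0 f U M U2 M2 -> U1 = U2 /\ M1 = M2]].
Proof.
have [D [C [D0 D1 C0 hC]]] := perturbed_estimate lam0 a01 hf Cu Cm stab.
exists D, C; split; [exact: D0|exact: D1|exact: C0|] => U M CU CM /dist_le[UD MD].
have est := hC U M CU CM UD MD.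
have [p1 p2] := err_periodic f a01 Cu Cm CU CM.
have cU := proj1 (proj1 CU); have cM := proj1 (proj1 CM).
(* The estimate near (u, m) with zero right-hand side gives injectivity at the iterate: it feeds the
   Fredholm argument for existence, and applied to the difference of two steps it gives
   uniqueness. *)
have inj (w mu : F) : C2a a w -> C2a a mu -> (forall x, lin1 lam (slope f M) U w mu x = 0) ->
    (forall x, lin2 lam U M w mu x = 0) -> w = (fun=> 0) /\ mu = (fun=> 0).
  move=> Cw Cmu e1 e2.
  have z : c0a_le a (fun _ : 'rV[R]_d => 0) 0.
    by split=> [x|x y]; rewrite ?subrr normr0// mul0r.
  have p : Defs.periodic (fun _ : 'rV[R]_d => 0 : R) by [].
  have := est w mu _ _ 0 Cw Cmu p p z z e1 e2; rewrite mulr0 => h.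
  have [h1 h2] := summands_le (c2a_norm_ge0 a w) (c2a_norm_ge0 a mu) h.
  split; [exact: c2a_norm_eq0 Cw h1|exact: c2a_norm_eq0 Cmu h2].
have P := newton_stepP lam0 a01 Cm0 hf Cu Cm mfg CU CM.
split.
- have [ps hs] := slope_c0a a01 hf CM.
  have [B [h1 h2 h3 h4 h5]] := c0a_le_common a01 CU CM hs.
  (* Here the remainder bound, taken at the radius D, only serves to place the right-hand side in
     C^{0,a}. *)
  have [Q _ hQ] := rem_c0a a01 hf Cm.
  have b1 := err1_le a01 Cu CU UD (hQ M D CM MD D1).
  have b2 := err2_le a01 Cu Cm CU CM UD MD.
  have l1 := c0a_le_ge0 b1; have l2 := c0a_le_ge0 b2.
  have l3 : d%:R * cd ^+ 2 * D ^+ 2 + Q * (D * D `^ (1 - a)) <=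
    d%:R * cd ^+ 2 * D ^+ 2 + Q * (D * D `^ (1 - a)) + 4 * d%:R * cd ^+ 2 * D ^+ 2 by rewrite lerDl.
  have l4 : 4 * d%:R * cd ^+ 2 * D ^+ 2 <=
    d%:R * cd ^+ 2 * D ^+ 2 + Q * (D * D `^ (1 - a)) + 4 * d%:R * cd ^+ 2 * D ^+ 2 by rewrite lerDr.
  have [w [mu [Cw Cmu e1 e2]]] := linear_solvable lam0 a01 ps CU CM h1 h2 h3 h4 h5 inj p1 p2
    (c0a_le_mono l3 b1) (c0a_le_mono l4 b2).
  have Ew : (fun x => 1 * w x + u x - u x) = w by apply/funext => x; rewrite mul1r addrK.
  have Em : (fun x => 1 * mu x + m x - m x) = mu by apply/funext => x; rewrite mul1r addrK.
  have CU' := C2a_affine 1 Cw Cu; have CM' := C2a_affine 1 Cmu Cm.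
  exists (fun x => 1 * w x + u x), (fun x => 1 * mu x + m x); split=> //.
  by apply/(P _ _ CU' CM'); rewrite Ew Em.
- move=> U' M' H CU' CM' /(P _ _ CU' CM')[e1 e2] b1 b2.
  exact: est (C2a_sub CU' Cu) (C2a_sub CM' Cm) p1 p2 b1 b2 e1 e2.
- move=> U1 M1 U2 M2 CU1 CM1 CU2 CM2 /(P _ _ CU1 CM1)[e1 e2] /(P _ _ CU2 CM2)[e3 e4].
  have c1 := C2a_sub CU1 Cu; have c2 := C2a_sub CM1 Cm.
  have c3 := C2a_sub CU2 Cu; have c4 := C2a_sub CM2 Cm.
  have k1 := proj1 (proj1 c1); have k2 := proj1 (proj1 c2).
  have k3 := proj1 (proj1 c3); have k4 := proj1 (proj1 c4).
  have [z1 z2] := inj _ _ (C2a_sub c1 c3) (C2a_sub c2 c4)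
    (fun x => etrans (lin1_sub lam _ _ _ _ x k1 k3) (etrans (congr2 (fun p q => p - q) (e1 x) (e3 x)) (subrr _)))
    (fun x => etrans (lin2_sub lam x cU cM k1 k3 k2 k4) (etrans (congr2 (fun p q => p - q) (e2 x) (e4 x)) (subrr _))).
  split; apply/funext => x.
    exact: eq_of_shift (congr1 (fun g : F => g x) z1).
  exact: eq_of_shift (congr1 (fun g : F => g x) z2).
Qed.

Lemma err_superlinear : exists2 Q, 0 < Q & forall U M e, C2a a U -> C2a a M ->
  c2a_dist a U M u m <= e -> e <= 1 ->
  c0a_le a (err1 f u m U M) (Q * (e * e `^ (1 - a))) /\
  c0a_le a (err2 u m U M) (Q * (e * e `^ (1 - a))).
Proof.
have [Q Q0 hQ] := rem_c0a a01 hf Cm; pose P := d%:R * cd ^+ 2.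
have P0 : 0 <= P by rewrite mulr_ge0// sqr_ge0.
exists (4 * P + Q) => [|U M e CU CM ed e1]; first by rewrite ltr_wpDl// mulr_ge0.
have [Ue Me] := dist_le ed.
have e0 : 0 <= e := le_trans (c2a_norm_ge0 a _) Me.
have e2 : e ^+ 2 <= e * e `^ (1 - a).
  rewrite expr2 ler_wpM2l//; apply: powR_ge_id; last by rewrite e0.
  by rewrite subr_gt0 a1/= ltrBlDr ltrDl.
have b1 := err1_le a01 Cu CU Ue (hQ M e CM Me e1).
have b2 := err2_le a01 Cu Cm CU CM Ue Me.
have w0 : 0 <= e * e `^ (1 - a) by rewrite mulr_ge0// powR_ge0.
have s1 := ler_wpM2l P0 e2; have s2 := mulr_ge0 P0 w0; have s3 := mulr_ge0 (ltW Q0) w0.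
rewrite mulrDl; split; [apply: c0a_le_mono b1|apply: c0a_le_mono b2].
  by rewrite -/P lerD2r; apply: (le_trans s1); rewrite -[leRHS]mulrA ler_peMl// ler1n.
apply: (@le_trans _ _ (4 * P * (e * e `^ (1 - a)))); last by rewrite lerDl.
by rewrite -[4 * d%:R * _]mulrA -/P ler_wpM2l// mulr_ge0.
Qed.

Lemma err_quadratic : C21loc f -> exists2 Q, 0 < Q & forall U M e, C2a a U -> C2a a M ->
  c2a_dist a U M u m <= e -> e <= 1 ->
  c0a_le a (err1 f u m U M) (Q * e ^+ 2) /\ c0a_le a (err2 u m U M) (Q * e ^+ 2).
Proof.
move=> f21; have [Q Q0 hQ] := rem_c0a_quadratic a01 hf Cm f21; pose P := d%:R * cd ^+ 2.
have P0 : 0 <= P by rewrite mulr_ge0// sqr_ge0.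
have k1 : P + Q <= 4 * P + Q + 1 by lra.
have k2 : 4 * P <= 4 * P + Q + 1 by lra.
exists (4 * P + Q + 1) => [|U M e CU CM ed e1]; first by rewrite ltr_wpDl// addr_ge0// mulr_ge0.
have [Ue Me] := dist_le ed.
have b1 := err1_le a01 Cu CU Ue (hQ M e CM Me e1).
have b2 := err2_le a01 Cu Cm CU CM Ue Me.
split; [apply: c0a_le_mono b1|apply: c0a_le_mono b2].
  by rewrite -/P -mulrDl; apply: ler_wpM2r => //; exact: sqr_ge0.
by rewrite -[4 * d%:R * _]mulrA -/P; apply: ler_wpM2r => //; exact: sqr_ge0.
Qed.

End NewtonConvergence.

Theorem theorem5p9 (R : realType) (d : nat) (lam a : R)
  (m0 : 'rV[R]_d -> R) (f : R -> R) (u m : 'rV[R]_d -> R) :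
  0 < lam -> 0 < a < 1 ->
  C0a a m0 -> prob_density m0 ->
  C1b_C2 f -> (forall x, 0 <= (derive1 f) x) ->
  C2a a u -> C2a a m ->
  MFG_solution lam m0 f u m -> stable lam f u m ->
  exists r : R, 0 < r /\
    forall u0 mi0 : 'rV[R]_d -> R, C2a a u0 -> C2a a mi0 ->
      c2a_dist a u0 mi0 u m < r ->
      (exists U M, newton_seq a lam m0 f u0 mi0 U M) /\
      (forall U M U' M', newton_seq a lam m0 f u0 mi0 U M ->
         newton_seq a lam m0 f u0 mi0 U' M' -> U = U' /\ M = M') /\
      (forall U M, newton_seq a lam m0 f u0 mi0 U M ->
         let e := fun k => c2a_dist a (U k) (M k) u m in
         (forall eps : R, 0 < eps -> exists N, forall k, (N <= k)%N -> e k <= eps) /\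
         (forall eps : R, 0 < eps -> exists N, forall k, (N <= k)%N ->
              e k.+1 <= eps * e k) /\
         (C21loc f -> exists C : R, forall k, e k.+1 <= C * e k ^+ 2)).
Proof.
move=> lam0 a01 Cm0 _ hf _ Cu Cm mfg stab.
have [D [C [D0 D1 C0 step]]] := newton_step_estimate lam0 a01 Cm0 hf Cu Cm mfg stab.
have [Q Q0 hQ] := err_superlinear a01 hf Cu Cm.
have b0 : 0 < 1 - a by rewrite subr_gt0; case/andP: a01.
have CQ0 : 0 < C * Q by rewrite mulr_gt0.
(* Below r1 the factor C Q e^(1-a) of the superlinear bound is at most 1/2, so each step halves the
   distance and stays in the ball. *)
have [r1 r10 hr1] : exists2 r, 0 < r & forall x, 0 <= x -> x <= r -> x `^ (1 - a) <= (2 * (C * Q))^-1.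
  by apply: powR_small => //; rewrite invr_gt0 mulr_gt0.
pose r := Num.min D r1.
have r0 : 0 < r by rewrite lt_min D0.
have rD : r <= D by rewrite ge_min lexx.
have rr1 : r <= r1 by rewrite ge_min lexx orbT.
have dist0 U M : 0 <= c2a_dist a U M u m by rewrite addr_ge0 ?c2a_norm_ge0.
have superlinear U M U' M' : C2a a U -> C2a a M -> C2a a U' -> C2a a M' ->
    c2a_dist a U M u m <= r -> newton_step lam m0 f U M U' M' ->
    c2a_dist a U' M' u m <= C * Q * c2a_dist a U M u m `^ (1 - a) * c2a_dist a U M u m.
  move=> CU CM CU' CM' er st; have eD := le_trans er rD.
  have [_ h _] := step U M CU CM eD.
  have [q1 q2] := hQ U M _ CU CM (lexx _) (le_trans eD D1).
  have -> : C * Q * c2a_dist a U M u m `^ (1 - a) * c2a_dist a U M u m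
    = C * (Q * (c2a_dist a U M u m * c2a_dist a U M u m `^ (1 - a))).
    by rewrite -!mulrA; congr (_ * (_ * _)); rewrite mulrC.
  exact: h CU' CM' st q1 q2.
have contract U M U' M' : C2a a U -> C2a a M -> C2a a U' -> C2a a M' ->
    c2a_dist a U M u m <= r -> newton_step lam m0 f U M U' M' ->
    c2a_dist a U' M' u m <= 2^-1 * c2a_dist a U M u m.
  move=> CU CM CU' CM' er st.
  apply: (le_trans (superlinear _ _ _ _ CU CM CU' CM' er st)).
  apply: ler_wpM2r; first exact: dist0.
  apply: (le_trans (ler_wpM2l (ltW CQ0) (hr1 _ (dist0 U M) (le_trans er rr1)))).
  by rewrite invfM mulrCA divff ?gt_eqF// mulr1.
have stay (x y : R) : 0 <= x -> x <= r -> y <= 2^-1 * x -> y <= r by move=> *; lra.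
exists r; split=> // u0 mi0 Cu0 Cmi0 /ltW e0r.
have iterates U M : newton_seq a lam m0 f u0 mi0 U M ->
    [/\ forall k, C2a a (U k), forall k, C2a a (M k), forall k, c2a_dist a (U k) (M k) u m <= r
      & forall k, newton_step lam m0 f (U k) (M k) (U k.+1) (M k.+1)].
  move=> [eU [eM [CUM st]]].
  have CU k : C2a a (U k) := proj1 (CUM k); have CM k : C2a a (M k) := proj2 (CUM k).
  split; [exact: CU|exact: CM| |exact: st].
  elim=> [|k IH]; first by rewrite eU eM; exact: e0r.
  exact: stay (dist0 _ _) IH (contract _ _ _ _ (CU k) (CM k) (CU k.+1) (CM k.+1) IH (st k)).
split; [|split].
(* The step map must be total to be iterated: outside the ball it is the identity, where the
   requirement is vacuous, and [inv] keeps the orbit inside. *)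
- have /choice[s hs] (p : ('rV[R]_d -> R) * ('rV[R]_d -> R)) : exists q : ('rV[R]_d -> R) * ('rV[R]_d -> R),
      C2a a p.1 -> C2a a p.2 -> c2a_dist a p.1 p.2 u m <= r ->
      [/\ C2a a q.1, C2a a q.2 & newton_step lam m0 f p.1 p.2 q.1 q.2].
    have [[c1 [c2 c3]]|n] := pselect (C2a a p.1 /\ C2a a p.2 /\ c2a_dist a p.1 p.2 u m <= r).
      have [[U' [M' h]] _ _] := step _ _ c1 c2 (le_trans c3 rD).
      by exists (U', M').
    by exists p => c1 c2 c3; exfalso; apply: n.
  pose S k := iter k s (u0, mi0).
  have inv k : [/\ C2a a (S k).1, C2a a (S k).2 & c2a_dist a (S k).1 (S k).2 u m <= r].
    elim: k => [|k [c1 c2 c3]]; first by split; [exact: Cu0|exact: Cmi0|exact: e0r].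
    have [c4 c5 c6] := hs (S k) c1 c2 c3; split; [exact: c4|exact: c5|].
    exact: stay (dist0 _ _) c3 (contract _ _ _ _ c1 c2 c4 c5 c3 c6).
  exists (fun k => (S k).1), (fun k => (S k).2); split; [by []|split; [by []|split=> k]].
    by have [c1 c2 _] := inv k; split; [exact: c1|exact: c2].
  by have [c1 c2 c3] := inv k; have [_ _ h] := hs (S k) c1 c2 c3; exact: h.
- move=> U M U' M' sUM sUM'.
  have [CU CM er st] := iterates _ _ sUM; have [CU' CM' _ st'] := iterates _ _ sUM'.
  have same k : U k = U' k /\ M k = M' k.
    elim: k => [|k [IHU IHM]].
      by case: sUM => -> [-> _]; case: sUM' => -> [-> _].
    have [_ _ uniq] := step _ _ (CU k) (CM k) (le_trans (er k) rD).
    have s' := st' k; rewrite -IHU -IHM in s'.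
    exact: uniq (CU k.+1) (CM k.+1) (CU' k.+1) (CM' k.+1) (st k) s'.
  by split; apply/funext => k; have [] := same k.
- move=> U M sUM e; have [CU CM er st] := iterates _ _ sUM.
  have small c : 0 < c -> exists N, forall k, (N <= k)%N -> e k <= c.
    move=> c0; apply: (half_geometric_small c0) => k; first exact: dist0.
    exact: (contract _ _ _ _ (CU k) (CM k) (CU k.+1) (CM k.+1) (er k) (st k)).
  split; [exact: small|split].
    move=> eps eps0.
    (* The ratio of successive distances is at most C Q e^(1-a), which drops below eps once e is
       small. *)
    have [x x0 hx] := powR_small b0 (divr_gt0 eps0 CQ0).
    have [N hN] := small x x0; exists N => k Nk.
    apply: (le_trans (superlinear _ _ _ _ (CU k) (CM k) (CU k.+1) (CM k.+1) (er k) (st k))).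
    apply: ler_wpM2r; first exact: dist0.
    have := hx _ (dist0 (U k) (M k)) (hN k Nk).
    by rewrite ler_pdivlMr// mulrC.
  move=> f21; have [P P0 hP] := err_quadratic a01 hf Cu Cm f21.
  exists (C * P) => k; have eD := le_trans (er k) rD.
  have [_ h _] := step _ _ (CU k) (CM k) eD.
  have [q1 q2] := hP _ _ _ (CU k) (CM k) (lexx _) (le_trans eD D1).
  by rewrite -mulrA; exact: h (CU k.+1) (CM k.+1) (st k) q1 q2.
Qed.
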